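(* (i) If $\gamma$ defines a force-free strip, then its tangent vector $T$ (reparametrized by arclength) is a spherical elastic curve with Lagrange multiplier $1$. (ii) Conversely, let $T:[0,\tilde L]\to S^2$ be an arclength parametrized spherical elastic curve with Lagrange multiplier $1$ and geodesic curvature $\lambda$. Then the space curve $$\gamma(t)=\int_0^t(1+\lambda^2(s))\,T(s)\,ds,\qquad t\in[0,\tilde L],$$ defines a force-free strip (with Lagrange multiplier $\mu=-1$), and $$S_{-1}(\gamma)=\int_0^{\tilde L}2(1+\lambda^2)\,dt=2L(\gamma),$$ where $L(\gamma)$ is the length of $\gamma$.
   Context: All curves and variations are smooth ($C^\infty$). A Frenet curve is a regular curve $\gamma:[0,L]\to\mathbb{R}^3$ with nowhere vanishing curvature. Write $v=|\gamma'|$, $\kappa$ for the curvature, $\tau=\det(\gamma',\gamma'',\gamma''')/|\gamma'\times\gamma''|^2$ for the torsion, and $\lambda=\tau/\kappa$ for the modified torsion. The Frenet frame $(T,N,B)$ satisfies $\gamma'=vT$, $T'=v\kappa N$, $N'=-v\kappa T+v\lambda\kappa B$, $B'=-v\lambda\kappa N$. For $\mu\in\mathbb{R}$ the modified Sadowsky functional is $$S_\mu(\gamma)=\int_0^L\left(\kappa^2(1+\lambda^2)^2-\mu\right)v\,dt.$$ The curve $\gamma$ defines an elastic strip with Lagrange multiplier $\mu$ if it is a critical point of $S_\mu$, i.e. $\frac{d}{dt}\big|_{t=0}S_\mu(\gamma_t)=0$ for every smooth family of Frenet curves $\gamma_t$ with $\gamma_0=\gamma$ and $\gamma_t=\gamma$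 near both end points. An elastic strip with Lagrange multiplier $\mu$ is called force-free if $b_0=0$, where (in arclength parametrization) $b_0=a_1T+a_2N+a_3B$ with $a_1=\frac12(\kappa^2(1+\lambda^2)^2+\mu)$, $a_2=\kappa'(1+\lambda^2)^2+2\kappa(1+\lambda^2)\lambda\lambda'$, $a_3=-\left(\kappa^2(1+\lambda^2)^2\lambda+\left(\frac{\kappa'}{\kappa}(1+\lambda^2)2\lambda\right)'+\left((1+\lambda^2)2\lambda\right)''\right)$. Necessarily $\mu<0$, and by scaling one may normalize $\mu=-1$. A spherical elastic curve with Lagrange multiplier $l\in\mathbb{R}$ is an arclength parametrized curve in the unit sphere $S^2$ which is a critical point (under variations in $S^2$ fixed near the end points) of $\int(k^2+l)\,ds$, with $k$ the geodesic curvature; equivalently $k''+\frac12k^3+(1-\frac l2)k=0$, which implies $k'^2+\frac14k^4+(1-\frac l2)k^2=A$ for a constant $A$. *)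

(* Defs.v *)
From Stdlib Require Import Reals.
From Coquelicot Require Import Coquelicot.
Open Scope R_scope.

Record vec := Vec { xc : R; yc : R; zc : R }.

Definition vzero : vec := Vec 0 0 0.
Definition vadd (u v : vec) : vec := Vec (xc u + xc v) (yc u + yc v) (zc u + zc v).
Definition vscal (a : R) (u : vec) : vec := Vec (a * xc u) (a * yc u) (a * zc u).
Definition dot (u v : vec) : R := xc u * xc v + yc u * yc v + zc u * zc v.
Definition cross (u v : vec) : vec :=
  Vec (yc u * zc v - zc u * yc v)
      (zc u * xc v - xc u * zc v)
      (xc u * yc v - yc u * xc v).
Definition vnorm (u : vec) : R := sqrt (dot u u).
Definition det3 (u v w : vec) : R := dot (cross u v) w.

Definition vDerive (c : R -> vec) (t : R) : vec :=
  Vec (Derive (fun s => xc (c s)) t)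
      (Derive (fun s => yc (c s)) t)
      (Derive (fun s => zc (c s)) t).

Definition vRInt (c : R -> vec) (a b : R) : vec :=
  Vec (RInt (fun s => xc (c s)) a b)
      (RInt (fun s => yc (c s)) a b)
      (RInt (fun s => zc (c s)) a b).

(* A smooth map on the closed interval [0, L] is represented by any function on
   R that is smooth on an open neighbourhood of [0, L]; every smooth map on
   [0, L] has such an extension.  All geometric conditions below are imposed on
   [0, L] only, where derivatives of every order do not depend on the chosen
   extension. *)
Definition smooth (L : R) (f : R -> R) : Prop :=
  exists d : R, 0 < d /\
    forall (n : nat) (x : R), - d < x < L + d -> ex_derive_n f n x.

Definition smooth_curve (L : R) (c : R -> vec) : Prop :=
  smooth L (fun t => xc (c t)) /\ smooth L (fun t => yc (c t)) /\
  smooth L (fun t => zc (c t)).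

(* Joint smoothness in (t, s) for |t| < e and s near [0, L]: [F i j] is the
   partial derivative of order i in t and j in s, and all of these exist and are
   continuous in two variables. *)
Definition smooth2 (e L : R) (g : R -> R -> R) : Prop :=
  exists (d : R) (F : nat -> nat -> R -> R -> R), 0 < d /\
    forall t s : R, Rabs t < e -> - d < s < L + d ->
      F 0%nat 0%nat t s = g t s /\
      forall i j : nat,
        is_derive (fun u => F i j u s) t (F (S i) j t s) /\
        is_derive (fun u => F i j t u) s (F i (S j) t s) /\
        continuity_2d_pt (F i j) t s.

Definition smooth_family (e L : R) (G : R -> R -> vec) : Prop :=
  smooth2 e L (fun t s => xc (G t s)) /\ smooth2 e L (fun t s => yc (G t s)) /\
  smooth2 e L (fun t s => zc (G t s)).

(* [G t] is the curve with parameter t of the family; the neighbourhoods of the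
   end points on which it is fixed are uniform in t. *)
Definition variation (L : R) (c : R -> vec) (G : R -> R -> vec) : Prop :=
  exists e : R, 0 < e /\ smooth_family e L G /\
    (forall s, 0 <= s <= L -> G 0 s = c s) /\
    exists d : R, 0 < d /\
      forall t s, Rabs t < e -> 0 <= s <= L -> (s <= d \/ L - d <= s) ->
        G t s = c s.

Definition speed (c : R -> vec) (t : R) : R := vnorm (vDerive c t).

Definition curve_length (L : R) (c : R -> vec) : R := RInt (speed c) 0 L.

Definition curvature (c : R -> vec) (t : R) : R :=
  vnorm (cross (vDerive c t) (vDerive (vDerive c) t)) / speed c t ^ 3.

Definition torsion (c : R -> vec) (t : R) : R :=
  det3 (vDerive c t) (vDerive (vDerive c) t) (vDerive (vDerive (vDerive c)) t) /
  vnorm (cross (vDerive c t) (vDerive (vDerive c) t)) ^ 2.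

Definition mod_torsion (c : R -> vec) (t : R) : R := torsion c t / curvature c t.

Definition tangent (c : R -> vec) (t : R) : vec :=
  vscal (/ speed c t) (vDerive c t).
Definition normal (c : R -> vec) (t : R) : vec :=
  vscal (/ speed (tangent c) t) (vDerive (tangent c) t).
Definition binormal (c : R -> vec) (t : R) : vec :=
  cross (tangent c t) (normal c t).

Definition frenet_curve (L : R) (c : R -> vec) : Prop :=
  smooth_curve L c /\
  forall t, 0 <= t <= L -> speed c t <> 0 /\ curvature c t <> 0.

Definition sadowsky (mu L : R) (c : R -> vec) : R :=
  RInt (fun t =>
    (curvature c t ^ 2 * (1 + mod_torsion c t ^ 2) ^ 2 - mu) * speed c t) 0 L.

Definition elastic_strip (mu L : R) (c : R -> vec) : Prop :=
  frenet_curve L c /\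
  forall G : R -> R -> vec,
    variation L c G -> locally 0 (fun t => frenet_curve L (G t)) ->
    is_derive (fun t => sadowsky mu L (G t)) 0 0.

(* Derivative of a function along c with respect to the arclength of c. *)
Definition arc_derive (c : R -> vec) (f : R -> R) (t : R) : R :=
  Derive f t / speed c t.

Definition force_T (mu : R) (c : R -> vec) (t : R) : R :=
  / 2 * (curvature c t ^ 2 * (1 + mod_torsion c t ^ 2) ^ 2 + mu).

Definition force_N (c : R -> vec) (t : R) : R :=
  let k := curvature c in
  let lam := mod_torsion c in
  arc_derive c k t * (1 + lam t ^ 2) ^ 2 +
  2 * k t * (1 + lam t ^ 2) * lam t * arc_derive c lam t.

Definition force_B (c : R -> vec) (t : R) : R :=
  let k := curvature c in
  let lam := mod_torsion c in
  - (k t ^ 2 * (1 + lam t ^ 2) ^ 2 * lam t +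
     arc_derive c
       (fun u => arc_derive c k u / k u * (1 + lam u ^ 2) * (2 * lam u)) t +
     arc_derive c (arc_derive c (fun u => (1 + lam u ^ 2) * (2 * lam u))) t).

Definition force (mu : R) (c : R -> vec) (t : R) : vec :=
  vadd (vscal (force_T mu c t) (tangent c t))
    (vadd (vscal (force_N c t) (normal c t))
          (vscal (force_B c t) (binormal c t))).

Definition force_free_strip (mu L : R) (c : R -> vec) : Prop :=
  elastic_strip mu L c /\ forall t, 0 <= t <= L -> force mu c t = vzero.

(* c o phi is the orientation preserving reparametrization of c (on [0, L]) by
   arclength, defined on [0, L']. *)
Definition arclength_reparam
    (L : R) (c : R -> vec) (L' : R) (phi : R -> R) : Prop :=
  0 < L' /\ smooth L' phi /\ phi 0 = 0 /\ phi L' = L /\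
  forall s, 0 <= s <= L' ->
    0 < Derive phi s /\ speed (fun u => c (phi u)) s = 1.

Definition spherical_curve (L : R) (c : R -> vec) : Prop :=
  smooth_curve L c /\
  forall s, 0 <= s <= L -> vnorm (c s) = 1 /\ speed c s <> 0.

(* Signed, for a curve in the unit sphere in an arbitrary regular
   parametrization. *)
Definition geodesic_curvature (c : R -> vec) (t : R) : R :=
  det3 (c t) (vDerive c t) (vDerive (vDerive c) t) / speed c t ^ 3.

Definition spherical_energy (l L : R) (c : R -> vec) : R :=
  RInt (fun s => (geodesic_curvature c s ^ 2 + l) * speed c s) 0 L.

Definition spherical_elastic (l L : R) (c : R -> vec) : Prop :=
  spherical_curve L c /\
  (forall s, 0 <= s <= L -> speed c s = 1) /\
  forall G : R -> R -> vec,
    variation L c G -> locally 0 (fun t => spherical_curve L (G t)) ->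
    is_derive (fun t => spherical_energy l L (G t)) 0 0.

Definition strip_curve (T : R -> vec) (t : R) : vec :=
  vRInt (fun s => vscal (1 + geodesic_curvature T s ^ 2) (T s)) 0 t.

(* Main.v *)
(* Write [v, kap, lam] for speed, curvature and modified torsion.  If the force
   vanishes, then [kap (1 + lam^2)] is a constant, and the binormal component of
   the force becomes, in terms of the arclength of the tangent indicatrix [T],
   the equation [2 lam'' + lam^3 + lam = 0].  As [lam] is the geodesic curvature
   of [T], this is the Euler-Lagrange equation of a spherical elastic curve with
   multiplier 1.

   Spherical curves: let [T, N = T', B = T x T'] be the frame of a unit speed
   curve with geodesic curvature [k] and [V] the variation field, so that
   [<T, V> = 0].  The variation of the energy density [k^2 + l] is
     d/ds (2 k <B, V'> + (l - k^2) <N, V> - 2 k' <B, V>)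
       + (2 k'' + k^3 + (2 - l) k) <B, V>.
   Conversely, the variations [cos (t f) T + sin (t f) B] stay in the sphere, and
   [f = bump * (2 k'' + k^3 + (2 - l) k)] forces the last factor to vanish.

   Strips: if [2 k'' + k^3 + k = 0] and [c' = v T] with [v = 1 + k^2], then for an
   arbitrary variation with [P = V'] the variation of the Sadowsky density is
   the exact derivative of
     4 k / v <B, P'> + (2 - 2 k^2) / v <N, P> - 4 k' (1 + 3 k^2) / v^2 <B, P>. *)
Require Import Defs.
From Stdlib Require Import Reals Lra Lia Ranalysis5 ClassicalEpsilon.
From Coquelicot Require Import Coquelicot.
Open Scope R_scope.

(** The Sadowsky density contains only derivatives of the curve. Integrating its variation by parts
    down to [P] leaves a factor paired with [P] that is, up to a constant, the force vector
    conserved by translation invariance. For a force-free strip it vanishes, which is why the whole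
    variation is an exact derivative in [P] and [P'] alone. The factor 1 + lam^2 of the strip curve
    is forced as well: unit speed of T means v kap = 1, and mu = -1 normalizes the constant kap (1 +
    lam^2) to 1. For other mu the constant cancels as soon as the arclength of T is the parameter.
    What shapes the formal proof is that curves are total functions on R, while the geometric
    identities hold on [0, L] only. At the end points such identities cannot be differentiated as
    germs; derivatives are compared through difference quotients taken from inside the interval,
    while smoothness is available on a full neighbourhood. *)

Lemma is_derive_Rplus (f g : R -> R) (x df dg : R) :
  is_derive f x df -> is_derive g x dg ->
  is_derive (fun y => f y + g y) x (df + dg).
Proof. intros Hf Hg; exact (is_derive_plus f g x df dg Hf Hg). Qed.

Lemma is_derive_Rmult (f g : R -> R) (x df dg : R) :
  is_derive f x df -> is_derive g x dg ->
  is_derive (fun y => f y * g y) x (df * g x + f x * dg).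
Proof.
  intros Hf Hg; exact (is_derive_mult f g x df dg Hf Hg Rmult_comm).
Qed.

Lemma is_derive_Rcomp (f g : R -> R) (x df dg : R) :
  is_derive f (g x) df -> is_derive g x dg ->
  is_derive (fun y => f (g y)) x (df * dg).
Proof.
  intros Hf Hg; rewrite Rmult_comm.
  exact (is_derive_comp f g x df dg Hf Hg).
Qed.

Lemma is_derive_continuity_pt (f : R -> R) (x l : R) :
  is_derive f x l -> continuity_pt f x.
Proof.
  intros H; apply continuity_pt_filterlim.
  apply (ex_derive_continuous f x); exists l; exact H.
Qed.

Lemma is_derive_eq (f : R -> R) (x l l' : R) :
  is_derive f x l -> l = l' -> is_derive f x l'.
Proof. intros H <-; exact H. Qed.

Lemma is_derive_unique2 (f : R -> R) (x l m : R) :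
  is_derive f x l -> is_derive f x m -> l = m.
Proof. intros <-%is_derive_unique <-%is_derive_unique; easy. Qed.

Lemma locally_2d_locally_2d (P : R -> R -> Prop) (x y : R) :
  locally_2d P x y -> locally_2d (fun u v => locally_2d P u v) x y.
Proof.
  apply locally_2d_impl_strong, locally_2d_forall; auto.
Qed.

(** * Germs of smooth functions *)

(* Only the germ at the point matters, so that quotients and square roots need no
   domain bookkeeping. *)
Fixpoint Cn_at (n : nat) (f : R -> R) (x : R) : Prop :=
  match n with
  | O => continuity_pt f x
  | S m => exists f' : R -> R,
      locally x (fun u => is_derive f u (f' u)) /\ Cn_at m f' x
  end.

(** Existence of both partial derivatives does not give joint continuity, so continuity of [g] is
    recorded at every level; in one variable it follows from the derivative. *)
Fixpoint Cn2_at (n : nat) (g : R -> R -> R) (t s : R) : Prop :=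
  match n with
  | O => continuity_2d_pt g t s
  | S m => exists gt gs : R -> R -> R,
      continuity_2d_pt g t s /\
      locally_2d (fun t' s' => is_derive (fun u => g u s') t' (gt t' s') /\
                               is_derive (fun u => g t' u) s' (gs t' s')) t s /\
      Cn2_at m gt t s /\ Cn2_at m gs t s
  end.

Definition smooth_at (f : R -> R) (x : R) : Prop := forall n, Cn_at n f x.
Definition smooth2_at (g : R -> R -> R) (t s : R) : Prop := forall n, Cn2_at n g t s.

Lemma Cn_at_continuity (n : nat) (f : R -> R) (x : R) :
  Cn_at n f x -> continuity_pt f x.
Proof.
  destruct n as [|n]; simpl; [easy|intros [f' [H _]]].
  apply (is_derive_continuity_pt f x (f' x)), (locally_singleton _ _ H).
Qed.

Lemma Cn2_at_continuity (n : nat) (g : R -> R -> R) (t s : R) :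
  Cn2_at n g t s -> continuity_2d_pt g t s.
Proof. destruct n as [|n]; simpl; [easy|intros (gt & gs & H & _)]; easy. Qed.

Lemma Cn_at_S (n : nat) (f : R -> R) (x : R) : Cn_at (S n) f x -> Cn_at n f x.
Proof.
  revert f; induction n as [|n IH]; intros f H.
  - apply (Cn_at_continuity _ _ _ H).
  - destruct H as [f' [H1 H2]]; exists f'; split; [easy|now apply IH].
Qed.

Lemma Cn2_at_S (n : nat) (g : R -> R -> R) (t s : R) :
  Cn2_at (S n) g t s -> Cn2_at n g t s.
Proof.
  revert g; induction n as [|n IH]; intros g H.
  - apply (Cn2_at_continuity _ _ _ _ H).
  - destruct H as (gt & gs & H0 & H1 & H2 & H3); exists gt, gs.
    repeat split; auto.
Qed.

Lemma Cn_at_ext_loc (n : nat) (f g : R -> R) (x : R) :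
  locally x (fun u => f u = g u) -> Cn_at n f x -> Cn_at n g x.
Proof.
  intros He; destruct n as [|n]; simpl.
  - intros H; apply continuity_pt_ext_loc with f; [|easy].
    revert He; apply filter_imp; auto.
  - intros [f' [H1 H2]]; exists f'; split; [|easy].
    generalize (filter_and _ _ (locally_locally _ _ He) H1).
    apply filter_imp; intros u [Hu Hd].
    now apply is_derive_ext_loc with f.
Qed.

Lemma Cn2_at_ext_loc (n : nat) (f g : R -> R -> R) (t s : R) :
  locally_2d (fun u v => f u v = g u v) t s -> Cn2_at n f t s -> Cn2_at n g t s.
Proof.
  intros He; destruct n as [|n]; simpl.
  - now apply continuity_2d_pt_ext_loc.
  - intros (ft & fs & H0 & H1 & H2 & H3); exists ft, fs.
    split; [now apply continuity_2d_pt_ext_loc with f|].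
    split; [|easy].
    generalize (locally_2d_and _ _ _ _ (locally_2d_locally_2d _ _ _ He) H1).
    apply locally_2d_impl, locally_2d_forall; intros u v [Hu [Ha Hb]]; split.
    + apply is_derive_ext_loc with (2 := Ha).
      exact (locally_2d_1d_const_y _ _ _ Hu).
    + apply is_derive_ext_loc with (2 := Hb).
      exact (locally_2d_1d_const_x _ _ _ Hu).
Qed.

Lemma smooth2_at_ext_loc (f g : R -> R -> R) (t s : R) :
  locally_2d (fun u v => f u v = g u v) t s -> smooth2_at f t s -> smooth2_at g t s.
Proof. intros He H n; apply Cn2_at_ext_loc with f; auto. Qed.

Lemma Cn2_at_const (n : nat) (c t s : R) : Cn2_at n (fun _ _ => c) t s.
Proof.
  revert c; induction n as [|n IH]; intros c; simpl.
  - apply continuity_2d_pt_const.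
  - exists (fun _ _ => 0), (fun _ _ => 0).
    split; [apply continuity_2d_pt_const|split; [|auto]].
    apply locally_2d_forall; intros; split; apply (is_derive_const c).
Qed.

Lemma smooth2_at_const (c t s : R) : smooth2_at (fun _ _ => c) t s.
Proof. intros n; apply Cn2_at_const. Qed.

Lemma smooth2_at_fst (t s : R) : smooth2_at (fun u _ => u) t s.
Proof.
  intros [|n]; simpl; [apply continuity_2d_pt_id1|].
  exists (fun _ _ => 1), (fun _ _ => 0).
  split; [apply continuity_2d_pt_id1|split; [|split; apply Cn2_at_const]].
  apply locally_2d_forall; intros; split.
  - apply (is_derive_id (K := R_AbsRing)).
  - apply (is_derive_const (K := R_AbsRing) (V := R_NormedModule)).
Qed.

Lemma smooth2_at_snd (t s : R) : smooth2_at (fun _ v => v) t s.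
Proof.
  intros [|n]; simpl; [apply continuity_2d_pt_id2|].
  exists (fun _ _ => 0), (fun _ _ => 1).
  split; [apply continuity_2d_pt_id2|split; [|split; apply Cn2_at_const]].
  apply locally_2d_forall; intros; split.
  - apply (is_derive_const (K := R_AbsRing) (V := R_NormedModule)).
  - apply (is_derive_id (K := R_AbsRing)).
Qed.

Lemma Cn2_at_plus (n : nat) (f g : R -> R -> R) (t s : R) :
  Cn2_at n f t s -> Cn2_at n g t s -> Cn2_at n (fun u v => f u v + g u v) t s.
Proof.
  revert f g; induction n as [|n IH]; intros f g Hf Hg.
  - now apply continuity_2d_pt_plus.
  - destruct Hf as (ft & fs & F0 & F1 & F2 & F3).
    destruct Hg as (gt & gs & G0 & G1 & G2 & G3).
    exists (fun u v => ft u v + gt u v), (fun u v => fs u v + gs u v).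
    split; [now apply continuity_2d_pt_plus|split; [|auto]].
    generalize (locally_2d_and _ _ _ _ F1 G1).
    apply locally_2d_impl, locally_2d_forall; intros u v [[A B] [C D]]; split.
    + exact (is_derive_Rplus _ _ _ _ _ A C).
    + exact (is_derive_Rplus _ _ _ _ _ B D).
Qed.

Lemma Cn2_at_mult (n : nat) (f g : R -> R -> R) (t s : R) :
  Cn2_at n f t s -> Cn2_at n g t s -> Cn2_at n (fun u v => f u v * g u v) t s.
Proof.
  revert f g; induction n as [|n IH]; intros f g Hf Hg.
  - now apply continuity_2d_pt_mult.
  - assert (Kf := Cn2_at_S _ _ _ _ Hf); assert (Kg := Cn2_at_S _ _ _ _ Hg).
    destruct Hf as (ft & fs & F0 & F1 & F2 & F3).
    destruct Hg as (gt & gs & G0 & G1 & G2 & G3).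
    exists (fun u v => ft u v * g u v + f u v * gt u v),
      (fun u v => fs u v * g u v + f u v * gs u v).
    split; [now apply continuity_2d_pt_mult|].
    split; [|split; apply Cn2_at_plus; auto].
    generalize (locally_2d_and _ _ _ _ F1 G1).
    apply locally_2d_impl, locally_2d_forall; intros u v [[A B] [C D]]; split.
    + exact (is_derive_Rmult _ _ _ _ _ A C).
    + exact (is_derive_Rmult _ _ _ _ _ B D).
Qed.

Lemma continuity_2d_pt_locally (g : R -> R -> R) (t s : R) (P : R -> Prop) :
  continuity_2d_pt g t s -> locally (g t s) P ->
  locally_2d (fun u v => P (g u v)) t s.
Proof.
  intros Hc [d Hd]; generalize (Hc d).
  apply locally_2d_impl, locally_2d_forall; intros u v H; apply Hd, H.
Qed.

(** By the chain rule each partial derivative is a product of [f'] composed with [g] and a partial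
    of [g], so the induction needs closure under products and [g] at the lower order. Quotients,
    roots and trigonometric functions all enter through this rule. *)
Lemma Cn2_at_comp (n : nat) (f : R -> R) (g : R -> R -> R) (t s : R) :
  Cn_at n f (g t s) -> Cn2_at n g t s -> Cn2_at n (fun u v => f (g u v)) t s.
Proof.
  revert f; induction n as [|n IH]; intros f Hf Hg.
  - now apply continuity_1d_2d_pt_comp.
  - assert (Kg := Cn2_at_S _ _ _ _ Hg).
    assert (Kf := Cn_at_continuity _ _ _ Hf).
    destruct Hf as (f' & F1 & F2).
    destruct Hg as (gt & gs & G0 & G1 & G2 & G3).
    exists (fun u v => f' (g u v) * gt u v), (fun u v => f' (g u v) * gs u v).
    split; [now apply continuity_1d_2d_pt_comp|].
    split; [|split; apply Cn2_at_mult; auto].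
    generalize (locally_2d_and _ _ _ _ (continuity_2d_pt_locally g t s _ G0 F1) G1).
    apply locally_2d_impl, locally_2d_forall; intros u v [A [B C]]; split.
    + exact (is_derive_Rcomp f (fun u => g u v) u _ _ A B).
    + exact (is_derive_Rcomp f (fun v => g u v) v _ _ A C).
Qed.

Lemma smooth2_at_plus (f g : R -> R -> R) (t s : R) :
  smooth2_at f t s -> smooth2_at g t s -> smooth2_at (fun u v => f u v + g u v) t s.
Proof. intros Hf Hg n; apply Cn2_at_plus; auto. Qed.

Lemma smooth2_at_mult (f g : R -> R -> R) (t s : R) :
  smooth2_at f t s -> smooth2_at g t s -> smooth2_at (fun u v => f u v * g u v) t s.
Proof. intros Hf Hg n; apply Cn2_at_mult; auto. Qed.

Lemma smooth2_at_comp (f : R -> R) (g : R -> R -> R) (t s : R) :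
  smooth_at f (g t s) -> smooth2_at g t s -> smooth2_at (fun u v => f (g u v)) t s.
Proof. intros Hf Hg n; apply Cn2_at_comp; auto. Qed.

Lemma smooth2_at_opp (f : R -> R -> R) (t s : R) :
  smooth2_at f t s -> smooth2_at (fun u v => - f u v) t s.
Proof.
  intros H; apply smooth2_at_ext_loc with (fun u v => (-1) * f u v).
  - apply locally_2d_forall; intros; ring.
  - apply smooth2_at_mult; [apply smooth2_at_const|easy].
Qed.

Lemma smooth2_at_minus (f g : R -> R -> R) (t s : R) :
  smooth2_at f t s -> smooth2_at g t s -> smooth2_at (fun u v => f u v - g u v) t s.
Proof. intros Hf Hg; apply smooth2_at_plus; [easy|now apply smooth2_at_opp]. Qed.

Lemma smooth2_at_pow (f : R -> R -> R) (k : nat) (t s : R) :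
  smooth2_at f t s -> smooth2_at (fun u v => f u v ^ k) t s.
Proof.
  intros H; induction k as [|k IH]; simpl.
  - apply smooth2_at_const.
  - now apply smooth2_at_mult.
Qed.

Lemma Cn_at_of_Cn2_at (n : nat) (g : R -> R -> R) (t s : R) :
  Cn2_at n g t s -> Cn_at n (g t) s.
Proof.
  revert g; induction n as [|n IH]; intros g H.
  - intros e He.
    destruct (H (mkposreal e He)) as [d Hd].
    exists d; split; [apply cond_pos|].
    intros x [_ Hx]; apply Hd; [|exact Hx].
    rewrite Rminus_eq_0, Rabs_R0; apply cond_pos.
  - destruct H as (gt & gs & H0 & H1 & H2 & H3).
    exists (gs t); split; [|auto].
    generalize (locally_2d_1d_const_x _ _ _ H1).
    apply filter_imp; intros u [_ Hu]; exact Hu.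
Qed.

(** Restricting to a slice, together with the converse embedding that follows, lets the one-variable
    closure rules be read off from the two-variable ones. *)
Lemma smooth_at_of_smooth2_at (g : R -> R -> R) (t s : R) : smooth2_at g t s -> smooth_at (g t) s.
Proof. intros H n; apply Cn_at_of_Cn2_at, H. Qed.

Lemma smooth2_at_of_smooth_at (f : R -> R) (t s : R) : smooth_at f s -> smooth2_at (fun _ v => f v) t s.
Proof. intros H; apply (smooth2_at_comp f (fun _ v => v)); [easy|apply smooth2_at_snd]. Qed.

Lemma smooth_at_const (c x : R) : smooth_at (fun _ => c) x.
Proof. apply (smooth_at_of_smooth2_at (fun _ _ => c) 0), smooth2_at_const. Qed.

Lemma smooth_at_id (x : R) : smooth_at (fun u => u) x.
Proof. apply (smooth_at_of_smooth2_at (fun _ v => v) 0), smooth2_at_snd. Qed.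

Lemma smooth_at_plus (f g : R -> R) (x : R) :
  smooth_at f x -> smooth_at g x -> smooth_at (fun u => f u + g u) x.
Proof.
  intros; apply (smooth_at_of_smooth2_at (fun _ v => f v + g v) 0), smooth2_at_plus;
    now apply smooth2_at_of_smooth_at.
Qed.

Lemma smooth_at_mult (f g : R -> R) (x : R) :
  smooth_at f x -> smooth_at g x -> smooth_at (fun u => f u * g u) x.
Proof.
  intros; apply (smooth_at_of_smooth2_at (fun _ v => f v * g v) 0), smooth2_at_mult;
    now apply smooth2_at_of_smooth_at.
Qed.

Lemma smooth_at_opp (f : R -> R) (x : R) : smooth_at f x -> smooth_at (fun u => - f u) x.
Proof.
  intros; apply (smooth_at_of_smooth2_at (fun _ v => - f v) 0), smooth2_at_opp; now apply smooth2_at_of_smooth_at.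
Qed.

Lemma smooth_at_minus (f g : R -> R) (x : R) :
  smooth_at f x -> smooth_at g x -> smooth_at (fun u => f u - g u) x.
Proof. intros; apply smooth_at_plus; [easy|now apply smooth_at_opp]. Qed.

Lemma smooth_at_pow (f : R -> R) (k : nat) (x : R) :
  smooth_at f x -> smooth_at (fun u => f u ^ k) x.
Proof.
  intros; apply (smooth_at_of_smooth2_at (fun _ v => f v ^ k) 0), smooth2_at_pow; now apply smooth2_at_of_smooth_at.
Qed.

Lemma Cn_at_comp (n : nat) (f g : R -> R) (x : R) :
  Cn_at n f (g x) -> Cn_at n g x -> Cn_at n (fun u => f (g u)) x.
Proof.
  intros Hf Hg; apply (Cn_at_of_Cn2_at n (fun _ v => f (g v)) 0).
  apply (Cn2_at_comp n f (fun _ v => g v)); [easy|].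
  apply (Cn2_at_comp n g (fun _ v => v)); [easy|apply smooth2_at_snd].
Qed.

Lemma smooth_at_comp (f g : R -> R) (x : R) :
  smooth_at f (g x) -> smooth_at g x -> smooth_at (fun u => f (g u)) x.
Proof. intros Hf Hg n; apply Cn_at_comp; auto. Qed.

Lemma Cn_at_mult (n : nat) (f g : R -> R) (x : R) :
  Cn_at n f x -> Cn_at n g x -> Cn_at n (fun u => f u * g u) x.
Proof.
  intros Hf Hg; apply (Cn_at_of_Cn2_at n (fun _ v => f v * g v) 0), Cn2_at_mult.
  - apply (Cn2_at_comp n f (fun _ v => v)); [easy|apply smooth2_at_snd].
  - apply (Cn2_at_comp n g (fun _ v => v)); [easy|apply smooth2_at_snd].
Qed.

Lemma locally_neq_0 (x : R) : x <> 0 -> locally x (fun u => u <> 0).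
Proof. apply (open_neq 0). Qed.

Lemma locally_pos (x : R) : 0 < x -> locally x (fun u => 0 < u).
Proof. apply (open_gt 0). Qed.

(** The derivative is a polynomial in the inverse itself, so the induction on the order closes up.
    The square root works the same way, its derivative being a multiple of its own inverse. *)
Lemma smooth_at_inv (x : R) : x <> 0 -> smooth_at Rinv x.
Proof.
  intros Hx n; induction n as [|n IH].
  - apply continuity_pt_filterlim, continuous_Rinv, Hx.
  - exists (fun u => (-1) * (/ u * / u)); split.
    + generalize (locally_neq_0 x Hx); apply filter_imp; intros u Hu.
      auto_derive; [easy|now field].
    + apply Cn_at_mult; [apply smooth_at_const|now apply Cn_at_mult].
Qed.

Lemma smooth_at_sqrt (x : R) : 0 < x -> smooth_at sqrt x.
Proof.
  intros Hx n; induction n as [|n IH].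
  - apply continuity_pt_sqrt; lra.
  - exists (fun u => / 2 * / sqrt u); split.
    + generalize (locally_pos x Hx); apply filter_imp; intros u Hu.
      assert (sqrt u <> 0) by (apply Rgt_not_eq, sqrt_lt_R0, Hu).
      auto_derive; [easy|now field].
    + apply Cn_at_mult; [apply smooth_at_const|].
      apply Cn_at_comp; [|easy].
      apply smooth_at_inv, Rgt_not_eq, sqrt_lt_R0, Hx.
Qed.

Lemma smooth_at_cos_sin (x : R) : smooth_at cos x /\ smooth_at sin x.
Proof.
  assert (H : forall n, Cn_at n cos x /\ Cn_at n sin x).
  { induction n as [|n [IHc IHs]]; split.
    - apply continuity_cos.
    - apply continuity_sin.
    - exists (fun u => (-1) * sin u); split.
      + apply filter_forall; intros u.
        apply (is_derive_eq _ _ (- sin u)); [apply is_derive_cos|ring].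
      + apply Cn_at_mult; [apply smooth_at_const|easy].
    - exists cos; split; [|easy].
      apply filter_forall, is_derive_sin. }
  split; intros n; apply H.
Qed.

Lemma smooth2_at_inv (f : R -> R -> R) (t s : R) :
  smooth2_at f t s -> f t s <> 0 -> smooth2_at (fun u v => / f u v) t s.
Proof. intros H Hf; apply (smooth2_at_comp Rinv); [now apply smooth_at_inv|easy]. Qed.

Lemma smooth2_at_div (f g : R -> R -> R) (t s : R) :
  smooth2_at f t s -> smooth2_at g t s -> g t s <> 0 -> smooth2_at (fun u v => f u v / g u v) t s.
Proof. intros; apply smooth2_at_mult; [easy|now apply smooth2_at_inv]. Qed.

Lemma smooth2_at_sqrt (f : R -> R -> R) (t s : R) :
  smooth2_at f t s -> 0 < f t s -> smooth2_at (fun u v => sqrt (f u v)) t s.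
Proof. intros H Hf; apply (smooth2_at_comp sqrt); [now apply smooth_at_sqrt|easy]. Qed.

Lemma smooth_at_Rinv (f : R -> R) (x : R) :
  smooth_at f x -> f x <> 0 -> smooth_at (fun u => / f u) x.
Proof. intros H Hf; apply (smooth_at_comp Rinv); [now apply smooth_at_inv|easy]. Qed.

Lemma smooth_at_div (f g : R -> R) (x : R) :
  smooth_at f x -> smooth_at g x -> g x <> 0 -> smooth_at (fun u => f u / g u) x.
Proof. intros; apply smooth_at_mult; [easy|now apply smooth_at_Rinv]. Qed.

Lemma smooth_at_Rsqrt (f : R -> R) (x : R) :
  smooth_at f x -> 0 < f x -> smooth_at (fun u => sqrt (f u)) x.
Proof. intros H Hf; apply (smooth_at_comp sqrt); [now apply smooth_at_sqrt|easy]. Qed.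

Lemma smooth_at_ex_derive (f : R -> R) (x : R) : smooth_at f x -> ex_derive f x.
Proof.
  intros H; destruct (H 1%nat) as (f' & H1 & _).
  exists (f' x); exact (locally_singleton _ _ H1).
Qed.

Lemma smooth_at_is_derive (f : R -> R) (x : R) : smooth_at f x -> is_derive f x (Derive f x).
Proof. intros H; now apply Derive_correct, smooth_at_ex_derive. Qed.

Lemma smooth_at_continuous (f : R -> R) (x : R) : smooth_at f x -> continuous f x.
Proof. intros H; now apply (ex_derive_continuous f x), smooth_at_ex_derive. Qed.

Lemma smooth_at_Derive (f : R -> R) (x : R) : smooth_at f x -> smooth_at (Derive f) x.
Proof.
  intros H n; destruct (H (S n)) as (f' & H1 & H2).
  apply Cn_at_ext_loc with f'; [|easy].
  revert H1; apply filter_imp; intros u Hu; symmetry; now apply is_derive_unique.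
Qed.

Lemma Cn_at_of_is_derive (n : nat) (f f' : R -> R) (x : R) :
  locally x (fun u => is_derive f u (f' u)) -> Cn_at n f' x -> Cn_at n f x.
Proof. intros H1 H2; apply Cn_at_S; now exists f'. Qed.

Lemma smooth_at_of_is_derive (f f' : R -> R) (x : R) :
  locally x (fun u => is_derive f u (f' u)) -> smooth_at f' x -> smooth_at f x.
Proof. intros H1 H2 n; apply Cn_at_of_is_derive with f'; auto. Qed.

Lemma smooth2_at_continuity (g : R -> R -> R) (t s : R) :
  smooth2_at g t s -> continuity_2d_pt g t s.
Proof. intros H; exact (H 0%nat). Qed.

Lemma smooth2_at_ex_derive (g : R -> R -> R) (t s : R) :
  smooth2_at g t s ->
  locally_2d (fun u v => ex_derive (fun z => g z v) u /\
                         ex_derive (fun z => g u z) v) t s.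
Proof.
  intros H; destruct (H 1%nat) as (gt & gs & _ & H1 & _); revert H1.
  apply locally_2d_impl, locally_2d_forall; intros u v [A B].
  split; [now exists (gt u v)|now exists (gs u v)].
Qed.

Lemma smooth2_at_Derive_fst (g : R -> R -> R) (t s : R) :
  smooth2_at g t s -> smooth2_at (fun u v => Derive (fun z => g z v) u) t s.
Proof.
  intros H n; destruct (H (S n)) as (gt & gs & _ & H1 & H2 & H3).
  apply Cn2_at_ext_loc with gt; [|easy]; revert H1.
  apply locally_2d_impl, locally_2d_forall; intros u v [A B].
  symmetry; now apply is_derive_unique.
Qed.

Lemma smooth2_at_Derive_snd (g : R -> R -> R) (t s : R) :
  smooth2_at g t s -> smooth2_at (fun u v => Derive (fun z => g u z) v) t s.
Proof.
  intros H n; destruct (H (S n)) as (gt & gs & _ & H1 & H2 & H3).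
  apply Cn2_at_ext_loc with gs; [|easy]; revert H1.
  apply locally_2d_impl, locally_2d_forall; intros u v [A B].
  symmetry; now apply is_derive_unique.
Qed.

(** * From germs to smoothness on intervals and rectangles *)

Lemma smooth_smooth_at (L : R) (f : R -> R) :
  smooth L f <-> exists d, 0 < d /\ forall x, - d < x < L + d -> smooth_at f x.
Proof.
  split; intros (d & Hd & H); exists d; (split; [easy|]).
  - intros x Hx n.
    (* Passing from order n + 1 to n trades one differentiation, so the induction must treat all the
       derivatives of [f] at once. *)
    enough (K : forall m y, - d < y < L + d -> Cn_at n (Derive_n f m) y)
      by now apply (K 0%nat).
    induction n as [|n IH]; intros m y Hy.
    + apply (is_derive_continuity_pt _ _ (Derive (Derive_n f m) y)).
      now apply Derive_correct, (H (S m)).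
    + exists (Derive_n f (S m)); split; [|now apply IH].
      apply (locally_interval _ _ (- d) (L + d)); [easy|easy|].
      intros z Hz1 Hz2; apply Derive_correct.
      apply (H (S m)); split; [exact Hz1|exact Hz2].
  - intros [|n] x Hx; [easy|].
    apply smooth_at_ex_derive.
    clear -H Hx; induction n as [|n IH]; [now apply H|].
    now apply smooth_at_Derive.
Qed.

Lemma smooth2_at_Schwarz (g : R -> R -> R) (t s : R) :
  locally_2d (smooth2_at g) t s ->
  Derive (fun u => Derive (fun z => g u z) s) t =
  Derive (fun v => Derive (fun z => g z v) t) s.
Proof.
  intros H; apply (Schwarz (fun u v => g u v)).
  - apply (locally_2d_impl _ _ _ _) with (2 := H), locally_2d_forall.
    intros u v K.
    destruct (locally_2d_singleton _ _ _ (smooth2_at_ex_derive _ _ _ K)).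
    destruct (locally_2d_singleton _ _ _ (smooth2_at_ex_derive _ _ _ (smooth2_at_Derive_fst _ _ _ K))).
    destruct (locally_2d_singleton _ _ _ (smooth2_at_ex_derive _ _ _ (smooth2_at_Derive_snd _ _ _ K))).
    auto.
  - apply smooth2_at_continuity, (smooth2_at_Derive_fst (fun u v => Derive (fun z => g u z) v)).
    apply smooth2_at_Derive_snd, (locally_2d_singleton _ _ _ H).
  - apply smooth2_at_continuity, (smooth2_at_Derive_snd (fun u v => Derive (fun z => g z v) u)).
    apply smooth2_at_Derive_fst, (locally_2d_singleton _ _ _ H).
Qed.

Definition partial_fst (g : R -> R -> R) (u v : R) : R := Derive (fun z => g z v) u.
Definition partial_snd (g : R -> R -> R) (u v : R) : R := Derive (fun z => g u z) v.

Lemma locally_2d_rectangle (e a b t s : R) :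
  Rabs t < e -> a < s < b -> locally_2d (fun u v => Rabs u < e /\ a < v < b) t s.
Proof.
  intros Ht Hs.
  assert (Hp : 0 < Rmin (e - Rabs t) (Rmin (s - a) (b - s))).
  { repeat apply Rmin_glb_lt; lra. }
  exists (mkposreal _ Hp); simpl; intros u v Hu Hv.
  assert (H1 := Rmin_l (e - Rabs t) (Rmin (s - a) (b - s))).
  assert (H2 := Rmin_r (e - Rabs t) (Rmin (s - a) (b - s))).
  assert (H3 := Rmin_l (s - a) (b - s)).
  assert (H4 := Rmin_r (s - a) (b - s)).
  apply Rabs_def2 in Hv.
  assert (H5 := Rabs_triang (u - t) t); replace (u - t + t) with u in H5 by ring.
  split; [|split]; lra.
Qed.

Lemma smooth2_intro (e L d : R) (g : R -> R -> R) :
  0 < d ->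
  (forall t s, Rabs t < e -> - d < s < L + d -> smooth2_at g t s) ->
  smooth2 e L g.
Proof.
  intros Hd H.
  set (F := fun i j => Nat.iter j partial_snd (Nat.iter i partial_fst g)).
  assert (HF : forall i j t s, Rabs t < e -> - d < s < L + d -> smooth2_at (F i j) t s).
  { intros i j t s Ht Hs; unfold F.
    induction j as [|j IHj]; [|now apply smooth2_at_Derive_snd].
    induction i as [|i IHi]; [now apply H|now apply smooth2_at_Derive_fst]. }
  (* The s-derivatives are the outermost ones in [F]. Hence differentiating in s is immediate, while
     a t-derivative has to be moved inwards past all of them by Schwarz. *)
  assert (HS : forall i j t s, Rabs t < e -> - d < s < L + d ->
             partial_fst (F i j) t s = F (S i) j t s).
  { intros i j; induction j as [|j IHj]; intros t s Ht Hs; [reflexivity|].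
    change (partial_fst (partial_snd (F i j)) t s = partial_snd (F (S i) j) t s).
    unfold partial_fst, partial_snd at 1.
    rewrite smooth2_at_Schwarz.
    - apply Derive_ext_loc.
      apply (locally_interval _ _ (- d) (L + d)); [easy|easy|].
      intros v Hv1 Hv2; apply IHj; [easy|split; [exact Hv1|exact Hv2]].
    - generalize (locally_2d_rectangle e (- d) (L + d) t s Ht Hs).
      apply locally_2d_impl, locally_2d_forall; intros u v [Hu Hv].
      now apply HF. }
  exists d, F; split; [easy|]; intros t s Ht Hs; split; [reflexivity|].
  intros i j; split; [|split].
  - rewrite <- HS by easy; apply Derive_correct.
    apply (locally_2d_singleton _ _ _ (smooth2_at_ex_derive _ _ _ (HF i j t s Ht Hs))).
  - apply Derive_correct.
    apply (locally_2d_singleton _ _ _ (smooth2_at_ex_derive _ _ _ (HF i j t s Ht Hs))).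
  - now apply smooth2_at_continuity, HF.
Qed.

Lemma smooth2_at_of_partials (F : nat -> nat -> R -> R -> R) (e a b : R) :
  (forall t s, Rabs t < e -> a < s < b -> forall i j : nat,
        is_derive (fun u => F i j u s) t (F (S i) j t s) /\
        is_derive (fun u => F i j t u) s (F i (S j) t s) /\
        continuity_2d_pt (F i j) t s) ->
  forall i j t s, Rabs t < e -> a < s < b -> smooth2_at (F i j) t s.
Proof.
  intros H i j t s Ht Hs n; revert i j.
  induction n as [|n IH]; intros i j; simpl; [now apply H|].
  exists (F (S i) j), (F i (S j)); split; [now apply H|split; [|auto]].
  generalize (locally_2d_rectangle e a b t s Ht Hs).
  apply locally_2d_impl, locally_2d_forall; intros u v [Hu Hv].
  split; now apply H.
Qed.

(** * Closed intervals, compactness and differentiation under the integral *)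

(** A two-sided derivative is already determined by increments pointing into the interval, so even
    at an end point the values on [a, b] suffice. This is the tool for differentiating identities
    known on [0, L] only. *)
Lemma is_derive_unique_Icc (a b : R) (f g : R -> R) (x l m : R) :
  a < b -> a <= x <= b -> is_derive f x l -> is_derive g x m ->
  (forall y, a <= y <= b -> f y = g y) -> l = m.
Proof.
  intros Hab Hx Hf Hg He.
  assert (H : derivable_pt_lim (fun y => f y - g y) x (l - m)).
  { apply is_derive_Reals; exact (is_derive_minus f g x l m Hf Hg). }
  destruct (Req_dec l m) as [E|E]; [easy|exfalso].
  assert (Hp : 0 < Rabs (l - m)) by (apply Rabs_pos_lt; lra).
  destruct (H _ Hp) as [d Hd].
  (* Step to the right from the left half of the interval and to the left from the right half; at
     most half the length keeps the increment inside. *)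
  assert (Hh : exists h, h <> 0 /\ Rabs h < d /\ a <= x + h <= b).
  { assert (Hd0 := cond_pos d).
    assert (M1 := Rmin_l (d / 2) ((b - a) / 2)).
    assert (M2 := Rmin_r (d / 2) ((b - a) / 2)).
    assert (M3 : 0 < Rmin (d / 2) ((b - a) / 2)) by (apply Rmin_glb_lt; lra).
    destruct (Rle_dec x ((a + b) / 2)).
    - exists (Rmin (d / 2) ((b - a) / 2)); rewrite Rabs_pos_eq; lra.
    - exists (- Rmin (d / 2) ((b - a) / 2)); rewrite Rabs_Ropp, Rabs_pos_eq; lra. }
  destruct Hh as (h & Hh0 & Hhd & Hh).
  specialize (Hd h Hh0 Hhd).
  rewrite (He (x + h)), (He x) in Hd by lra.
  replace ((g (x + h) - g (x + h) - (g x - g x)) / h - (l - m)) with (- (l - m)) in Hd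
    by (field; easy).
  rewrite Rabs_Ropp in Hd; lra.
Qed.

(** Tube lemma: pointwise radii chosen over the compact interval have a uniform positive lower
    bound. *)
Lemma locally_2d_tube (P : R -> R -> Prop) (t a b : R) :
  (forall s, a <= s <= b -> locally_2d P t s) ->
  exists d : posreal, forall u s, Rabs (u - t) < d -> a <= s <= b -> P u s.
Proof.
  intros H.
  (* The condition on s is moved under the existential, with radius 1 outside [a, b], because the
     gauge must be defined on all of R. *)
  assert (H' : forall s, exists d : posreal, a <= s <= b -> forall u v,
            Rabs (u - t) < d -> Rabs (v - s) < d -> P u v).
  { intros s; destruct (Rle_dec a s) as [Ha|Ha].
    - destruct (Rle_dec s b) as [Hb|Hb].
      + destruct (H s (conj Ha Hb)) as [d Hd]; exists d; auto.
      + exists (mkposreal 1 Rlt_0_1); lra.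
    - exists (mkposreal 1 Rlt_0_1); lra. }
  set (delta := fun s => proj1_sig (constructive_indefinite_description _ (H' s))).
  destruct (compactness_value_1d a b delta) as [d Hd].
  exists d; intros u s Hu Hs; apply NNPP; intros N.
  (* Compactness provides the centre [s0] only under a double negation, so the goal has been turned
     into a contradiction first. *)
  apply (Hd s Hs); intros (s0 & Hs0 & H1 & H2); apply N.
  apply (proj2_sig (constructive_indefinite_description _ (H' s0)) Hs0).
  - fold (delta s0); lra.
  - exact H1.
Qed.

Lemma is_derive_RInt_smooth2_at (f : R -> R -> R) (a b t : R) :
  a <= b -> (forall s, a <= s <= b -> smooth2_at f t s) ->
  is_derive (fun u => RInt (f u) a b) t
            (RInt (fun s => Derive (fun u => f u s) t) a b).
Proof.
  intros Hab H.
  assert (Hloc : exists d : posreal, forall u s, Rabs (u - t) < d -> a <= s <= b ->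
            ex_derive (fun z => f z s) u /\ ex_derive (fun z => f u z) s).
  { apply (locally_2d_tube
      (fun u s => ex_derive (fun z => f z s) u /\ ex_derive (fun z => f u z) s)).
    intros s Hs; apply smooth2_at_ex_derive, H, Hs. }
  destruct Hloc as [d Hd].
  apply is_derive_RInt_param; rewrite ?(Rmin_left a b), ?(Rmax_right a b) by easy.
  - exists d; intros u Hu s Hs; exact (proj1 (Hd u s Hu Hs)).
  - intros s Hs.
    apply smooth2_at_continuity, (smooth2_at_Derive_fst f), H, Hs.
  - exists d; intros u Hu.
    apply (ex_RInt_continuous (V := R_CompleteNormedModule)).
    rewrite ?(Rmin_left a b), ?(Rmax_right a b) by easy; intros s Hs.
    apply (ex_derive_continuous (fun z => f u z)).
    exact (proj2 (Hd u s Hu Hs)).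
Qed.

(** Common skeleton of both first variations: [h] is the geometric density, [f] its expression
    through partial derivatives of the family, [H] the boundary term left by integration by parts
    and [K] the Euler-Lagrange part. *)
Lemma is_derive_RInt_primitive (f h : R -> R -> R) (H K : R -> R) (L e : R) :
  0 < L -> 0 < e ->
  (forall s, 0 <= s <= L -> smooth2_at f 0 s) ->
  (forall u s, Rabs u < e -> 0 <= s <= L -> h u s = f u s) ->
  (forall s, 0 <= s <= L -> exists l,
     is_derive (fun u => f u s) 0 l /\ is_derive H s (l - K s)) ->
  (forall s, 0 <= s <= L -> continuous K s) ->
  H 0 = 0 -> H L = 0 ->
  is_derive (fun u => RInt (h u) 0 L) 0 (RInt K 0 L).
Proof.
  intros HL He Hf Hh HH HK H0 H1.
  apply is_derive_ext_loc with (fun u => RInt (f u) 0 L).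
  - exists (mkposreal e He); intros u Hu; apply RInt_ext; intros s.
    rewrite Rmin_left, Rmax_right by lra; intros Hs.
    symmetry; apply Hh; [|lra].
    replace u with (u - 0) by ring; exact Hu.
  - apply (is_derive_eq _ _ (RInt (fun s => Derive (fun u => f u s) 0) 0 L)).
    { apply is_derive_RInt_smooth2_at; [lra|exact Hf]. }
    assert (C : forall s, 0 <= s <= L -> continuous (fun s => Derive (fun u => f u s) 0) s).
    { intros s Hs; apply smooth_at_continuous.
      apply (smooth_at_of_smooth2_at (fun u v => Derive (fun z => f z v) u) 0), smooth2_at_Derive_fst, Hf, Hs. }
    assert (I : is_RInt (fun s => Derive (fun u => f u s) 0 - K s) 0 L (H L - H 0)).
    { apply (is_RInt_derive H); rewrite Rmin_left, Rmax_right by lra.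
      - intros s Hs; destruct (HH s Hs) as (l & Hl & Hd).
        rewrite (is_derive_unique _ _ _ Hl : Derive (fun u => f u s) 0 = l); exact Hd.
      - intros s Hs; apply (continuous_minus (V := R_NormedModule)); auto. }
    assert (IK : ex_RInt K 0 L).
    { apply (ex_RInt_continuous (V := R_CompleteNormedModule)).
      rewrite Rmin_left, Rmax_right by lra; exact HK. }
    apply is_RInt_unique.
    apply is_RInt_ext with
      (fun s => plus (Derive (fun u => f u s) 0 - K s) (K s)).
    { intros s _; unfold plus; simpl; ring. }
    replace (RInt K 0 L) with (plus (H L - H 0) (RInt K 0 L)).
    { apply (is_RInt_plus (V := R_NormedModule)); [exact I|exact (RInt_correct K 0 L IK)]. }
    unfold plus; simpl; rewrite H0, H1; ring.
Qed.

(** * A smooth bump function *)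

(* The derivatives of [exp (- 1 / x)], extended by 0 to [x <= 0], are combinations
   of the functions [flat n]. *)
Definition flat (n : nat) (x : R) : R :=
  if Rle_dec x 0 then 0 else exp (- / x) * (/ x) ^ n.

Lemma flat_nonpos (n : nat) (x : R) : x <= 0 -> flat n x = 0.
Proof. intros H; unfold flat; destruct (Rle_dec x 0); [easy|contradiction]. Qed.

Lemma flat_pos_eq (n : nat) (x : R) : 0 < x -> flat n x = exp (- / x) * (/ x) ^ n.
Proof. intros H; unfold flat; destruct (Rle_dec x 0); [lra|easy]. Qed.

(** Write exp y as the (k + 1)-st power of exp (y / (k + 1)) and use exp z >= 1 + z. *)
Lemma pow_le_exp (k : nat) (y : R) : 0 < y -> (y / INR (S k)) ^ S k <= exp y.
Proof.
  intros Hy.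
  assert (Hk : 0 < INR (S k)) by (apply lt_0_INR; lia).
  assert (E : forall n z, exp (INR n * z) = exp z ^ n).
  { induction n as [|n IH]; intros z.
    - simpl; rewrite Rmult_0_l; apply exp_0.
    - rewrite S_INR, Rmult_plus_distr_r, exp_plus, IH, Rmult_1_l; simpl; ring. }
  replace y with (INR (S k) * (y / INR (S k))) at 2 by (field; lra).
  rewrite E; apply pow_incr.
  assert (0 < y / INR (S k)) by now apply Rdiv_lt_0_compat.
  assert (H1 := exp_ineq1_le (y / INR (S k))); lra.
Qed.

(** The exponential beats the power n + 2 of / x. A quadratic bound is what makes the difference
    quotient at 0 tend to 0. *)
Lemma flat_le_square (n : nat) :
  exists C, 0 < C /\ forall x, 0 < x -> 0 <= flat n x <= C * (x * x).
Proof.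
  set (k := INR (S (S n))).
  assert (Hk : 0 < k) by (apply lt_0_INR; lia).
  exists (k ^ S (S n)); split; [now apply pow_lt|]; intros x Hx.
  rewrite flat_pos_eq by easy.
  assert (Hi : 0 < / x) by now apply Rinv_0_lt_compat.
  assert (Hpn := pow_lt (/ x) n Hi).
  assert (He := exp_pos (- / x)).
  split; [nra|].
  assert (P := pow_le_exp (S n) (/ x) Hi); fold k in P.
  unfold Rdiv in P; rewrite Rpow_mult_distr, (pow_inv k) in P.
  assert (Hkn : 0 < k ^ S (S n)) by now apply pow_lt.
  assert (Hkn' : 0 < k ^ n) by now apply pow_lt.
  apply Rmult_le_compat_r with (r := k ^ S (S n) * exp (- / x)) in P;
    [|now apply Rlt_le, Rmult_lt_0_compat].
  replace ((/ x) ^ S (S n) * / k ^ S (S n) * (k ^ S (S n) * exp (- / x)))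
    with (exp (- / x) * (/ x) ^ n * (/ x * / x)) in P
    by (simpl; field; repeat split; lra).
  replace (exp (/ x) * (k ^ S (S n) * exp (- / x))) with (k ^ S (S n)) in P.
  2:{ replace (exp (/ x) * (k ^ S (S n) * exp (- / x)))
        with (k ^ S (S n) * (exp (/ x) * exp (- / x))) by ring.
      rewrite <- exp_plus, Rplus_opp_r, exp_0; ring. }
  apply Rmult_le_compat_r with (r := x * x) in P; [|nra].
  replace (exp (- / x) * (/ x) ^ n * (/ x * / x) * (x * x))
    with (exp (- / x) * (/ x) ^ n) in P by (field; lra).
  exact P.
Qed.

Lemma is_derive_flat (n : nat) (x : R) :
  is_derive (flat n) x (flat (S (S n)) x - INR n * flat (S n) x).
Proof.
  destruct (Rtotal_order x 0) as [Hx|[Hx|Hx]].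
  - rewrite !flat_nonpos by lra.
    apply is_derive_ext_loc with (fun _ => 0).
    + generalize (open_lt 0 x Hx); apply filter_imp; intros u Hu.
      rewrite flat_nonpos; lra.
    + apply (is_derive_eq _ _ 0); [apply (is_derive_const 0)|ring].
  - subst x; rewrite !flat_nonpos by lra.
    apply (is_derive_eq _ _ 0); [|ring].
    apply is_derive_Reals; intros eps Heps.
    destruct (flat_le_square n) as (C & HC & HCx).
    (* The quadratic bound makes the quotient at most C h, hence smaller than eps for h < eps /
       C. *)
    assert (Hd : 0 < eps / C) by now apply Rdiv_lt_0_compat.
    exists (mkposreal _ Hd); simpl; intros h Hh Hhd.
    rewrite Rplus_0_l, (flat_nonpos n 0) by lra.
    destruct (Rle_dec h 0) as [Hn|Hp].
    + rewrite flat_nonpos by easy.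
      replace ((0 - 0) / h - 0) with 0 by (field; easy).
      now rewrite Rabs_R0.
    + assert (Hp' : 0 < h) by lra.
      rewrite Rabs_pos_eq in Hhd by lra.
      destruct (HCx h Hp') as [A1 A2].
      replace ((flat n h - 0) / h - 0) with (flat n h / h) by (field; easy).
      assert (0 <= flat n h / h).
      { apply Rmult_le_pos; [easy|]; left; now apply Rinv_0_lt_compat. }
      rewrite Rabs_pos_eq by easy.
      apply Rle_lt_trans with (C * h).
      * apply Rmult_le_reg_r with h; [easy|].
        replace (flat n h / h * h) with (flat n h) by (field; easy); lra.
      * apply Rmult_lt_compat_l with (r := C) in Hhd; [|easy].
        replace (C * (eps / C)) with eps in Hhd by (field; lra); exact Hhd.
  - rewrite !flat_pos_eq by easy.
    apply is_derive_ext_loc with (fun u => exp (- / u) * (/ u) ^ n).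
    + generalize (locally_pos x Hx); apply filter_imp; intros u Hu.
      symmetry; now apply flat_pos_eq.
    + auto_derive; [lra|].
      destruct n as [|n]; simpl pred.
      * simpl; field; lra.
      * rewrite S_INR; simpl; field; lra.
Qed.

Lemma smooth_at_flat (n : nat) (x : R) : smooth_at (flat n) x.
Proof.
  intros m; revert n; induction m as [|m IH]; intros n.
  - apply (is_derive_continuity_pt _ _ _ (is_derive_flat n x)).
  - exists (fun u => flat (S (S n)) u - INR n * flat (S n) u); split.
    + apply filter_forall, is_derive_flat.
    + apply Cn_at_ext_loc with (fun u => flat (S (S n)) u + (-1 * INR n) * flat (S n) u).
      { apply filter_forall; intros u; simpl; ring. }
      apply (Cn_at_of_Cn2_at m
        (fun _ u => flat (S (S n)) u + (-1 * INR n) * flat (S n) u) 0).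
      apply Cn2_at_plus; [|apply Cn2_at_mult; [apply Cn2_at_const|]].
      * apply (Cn2_at_comp m (flat (S (S n))) (fun _ v => v)); [easy|apply smooth2_at_snd].
      * apply (Cn2_at_comp m (flat (S n)) (fun _ v => v)); [easy|apply smooth2_at_snd].
Qed.

(** The test function is [bump] times [E] itself: the integrand becomes bump E^2, which is
    nonnegative, and one nonzero value of [E] would make its integral positive. *)
Lemma fundamental_lemma (E : R -> R) (L : R) :
  0 < L -> (forall s, 0 <= s <= L -> continuous E s) ->
  (forall (bump : R -> R) (d : R), 0 < d -> (forall s, smooth_at bump s) ->
     (forall s, s <= d \/ L - d <= s -> bump s = 0) ->
     RInt (fun s => E s * (bump s * E s)) 0 L = 0) ->
  forall s, 0 < s < L -> E s = 0.
Proof.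
  intros HL HE H s Hs.
  set (d := Rmin s (L - s) / 2).
  assert (Hm : 0 < Rmin s (L - s)) by (apply Rmin_glb_lt; lra).
  assert (M1 := Rmin_l s (L - s)); assert (M2 := Rmin_r s (L - s)).
  assert (Hd : 0 < d) by (unfold d; lra).
  assert (Hds : d < s) by (unfold d; lra).
  assert (HdL : s < L - d) by (unfold d; lra).
  (* The quadratic is positive exactly on (d, L - d), an interval that contains s. *)
  set (bump := fun u => flat 0 ((u - d) * (L - d - u))).
  assert (Hb : forall u, smooth_at bump u).
  { intros u; apply (smooth_at_comp (flat 0)); [apply smooth_at_flat|].
    apply smooth_at_mult; apply smooth_at_minus; first [apply smooth_at_const|apply smooth_at_id]. }
  assert (Hbs : 0 < bump s).
  { unfold bump; rewrite flat_pos_eq by nra.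
    simpl; rewrite Rmult_1_r; apply exp_pos. }
  assert (Hb0 : forall u, 0 <= bump u).
  { intros u; unfold bump, flat; destruct (Rle_dec _ 0); [lra|].
    simpl; rewrite Rmult_1_r; left; apply exp_pos. }
  assert (HbE : forall u, u <= d \/ L - d <= u -> bump u = 0).
  { intros u Hu; apply flat_nonpos; destruct Hu; nra. }
  specialize (H bump d Hd Hb HbE).
  set (g := fun u => E u * (bump u * E u)) in H.
  assert (Hg : forall u, 0 <= u <= L -> continuous g u).
  { intros u Hu; apply (continuous_mult (K := R_AbsRing)); [now apply HE|].
    apply (continuous_mult (K := R_AbsRing)); [now apply smooth_at_continuous|now apply HE]. }
  assert (Hg0 : forall u, 0 <= g u).
  { intros u; unfold g; replace (E u * (bump u * E u)) with (bump u * Rsqr (E u))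
      by (unfold Rsqr; ring).
    apply Rmult_le_pos; [apply Hb0|apply Rle_0_sqr]. }
  assert (I : forall a b, 0 <= a <= b -> b <= L -> ex_RInt g a b).
  { intros a b Ha HbL; apply (ex_RInt_continuous (V := R_CompleteNormedModule)).
    rewrite Rmin_left, Rmax_right by lra; intros u Hu; apply Hg; lra. }
  destruct (Req_dec (E s) 0) as [Es|Es]; [easy|exfalso].
  assert (Hgs : 0 < g s).
  { unfold g; replace (E s * (bump s * E s)) with (bump s * Rsqr (E s))
      by (unfold Rsqr; ring).
    apply Rmult_lt_0_compat; [easy|now apply Rsqr_pos_lt]. }
  assert (Hl : locally s (fun u => 0 < g u)).
  { apply (Hg s); [lra|]; now apply locally_pos. }
  destruct Hl as [e He].
  (* Halving keeps [s - r, s + r] inside both the neighbourhood where [g] is positive and (0, L). *)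
  set (r := Rmin e d / 2).
  assert (Hm' : 0 < Rmin e d) by (apply Rmin_glb_lt; [apply cond_pos|easy]).
  assert (M3 := Rmin_l e d); assert (M4 := Rmin_r e d).
  assert (Hr : 0 < r) by (unfold r; lra).
  assert (J : 0 < RInt g (s - r) (s + r)).
  { apply RInt_gt_0; [lra| |].
    - intros u Hu; apply He; apply Rabs_def1; unfold minus, plus, opp; simpl;
        unfold r in Hu; lra.
    - intros u Hu; apply Hg; unfold r in Hu; lra. }
  assert (J1 : 0 <= RInt g 0 (s - r)).
  { apply RInt_ge_0; [unfold r; lra|apply I; unfold r; lra|auto]. }
  assert (J2 : 0 <= RInt g (s + r) L).
  { apply RInt_ge_0; [unfold r; lra|apply I; unfold r; lra|auto]. }
  assert (C1 : RInt g 0 (s - r) + RInt g (s - r) (s + r) = RInt g 0 (s + r)).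
  { apply (RInt_Chasles (V := R_CompleteNormedModule)); apply I; unfold r; lra. }
  assert (C2 : RInt g 0 (s + r) + RInt g (s + r) L = RInt g 0 L).
  { apply (RInt_Chasles (V := R_CompleteNormedModule)); apply I; unfold r; lra. }
  lra.
Qed.

(** * Smooth inverse functions *)

Lemma increasing_of_Derive (A : R -> R) (a b : R) :
  (forall x, a < x < b -> smooth_at A x /\ 0 < Derive A x) ->
  forall x y, a < x -> x < y -> y < b -> A x < A y.
Proof.
  intros H x y Hx Hxy Hy.
  destruct (MVT_gen A x y (Derive A)) as (c & Hc & E).
  - rewrite Rmin_left, Rmax_right by lra.
    intros z Hz; apply smooth_at_is_derive, H; lra.
  - rewrite Rmin_left, Rmax_right by lra.
    intros z Hz; apply (is_derive_continuity_pt _ _ (Derive A z)), smooth_at_is_derive, H; lra.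
  - rewrite Rmin_left, Rmax_right in Hc by lra.
    assert (0 < Derive A c) by (apply H; lra); nra.
Qed.

(** The compact interval [p, q] inside (a, b) is where the intermediate value theorem supplies
    preimages; monotonicity makes the inverse continuous, the mean value theorem differentiates it,
    and phi' = / A'(phi) then raises its smoothness order by order. *)
Lemma smooth_inverse (A : R -> R) (a b p q : R) :
  a < p -> p < q -> q < b ->
  (forall x, a < x < b -> smooth_at A x /\ 0 < Derive A x) ->
  exists phi : R -> R,
    (forall x, p < x < q -> phi (A x) = x) /\
    forall y, A p < y < A q ->
      p < phi y < q /\ smooth_at phi y /\ is_derive phi y (/ Derive A (phi y)).
Proof.
  intros Hap Hpq Hqb H.
  assert (Inc := increasing_of_Derive A a b H).
  assert (Inc' : forall x y, a < x < b -> a < y < b -> A x < A y -> x < y).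
  { intros x y Hx Hy HA; destruct (Rtotal_order x y) as [K|[K|K]]; [easy|subst; lra|].
    specialize (Inc y x); lra. }
  assert (Cont : forall x, a < x < b -> continuity_pt A x).
  { intros z Hz; apply (is_derive_continuity_pt _ _ (Derive A z)), smooth_at_is_derive, H; lra. }
  (* The value 0 is a placeholder outside the image of (p, q), so that a preimage can be chosen for
     every real y. *)
  assert (Ex : forall y, exists x, A p < y < A q -> p < x < q /\ A x = y).
  { intros y; destruct (Rlt_dec (A p) y) as [H1|H1]; [|exists 0; lra].
    destruct (Rlt_dec y (A q)) as [H2|H2]; [|exists 0; lra].
    destruct (f_interv_is_interv A p q y) as (x & Hx & E); [easy|lra| |].
    { intros z Hz; apply Cont; lra. }
    exists x; intros _; split; [|easy].
    assert (x <> p) by (intros ->; lra).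
    assert (x <> q) by (intros ->; lra).
    lra. }
  set (phi := fun y => proj1_sig (constructive_indefinite_description _ (Ex y))).
  assert (Hphi : forall y, A p < y < A q -> p < phi y < q /\ A (phi y) = y).
  { intros y; apply (proj2_sig (constructive_indefinite_description _ (Ex y))). }
  assert (Cphi : forall y, A p < y < A q -> forall e : posreal,
             locally y (fun z => A p < z < A q /\ Rabs (phi z - phi y) < e)).
  { intros y Hy e; destruct (Hphi y Hy) as [B E].
    (* By monotonicity (A u, A v) is a neighbourhood of y whose preimages lie in (u, v), within e of
       phi y. *)
    set (u := Rmax p (phi y - e / 2)); set (v := Rmin q (phi y + e / 2)).
    assert (He := cond_pos e).
    assert (Hu : p <= u < phi y).
    { unfold u; split; [apply Rmax_l|apply Rmax_lub_lt; lra]. }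
    assert (Hu2 := Rmax_r p (phi y - e / 2)); fold u in Hu2.
    assert (Hv : phi y < v <= q).
    { unfold v; split; [apply Rmin_glb_lt; lra|apply Rmin_l]. }
    assert (Hv2 := Rmin_r q (phi y + e / 2)); fold v in Hv2.
    assert (Huy : A u < y) by (rewrite <- E; apply Inc; lra).
    assert (Hvy : y < A v) by (rewrite <- E; apply Inc; lra).
    assert (Hpu : A p <= A u).
    { destruct (Req_dec p u) as [<-|]; [lra|left; apply Inc; lra]. }
    assert (Hvq : A v <= A q).
    { destruct (Req_dec v q) as [->|]; [lra|left; apply Inc; lra]. }
    apply (locally_interval _ _ (A u) (A v)); [easy|easy|].
    simpl; intros z Hz1 Hz2.
    assert (Hz : A p < z < A q) by lra; split; [easy|].
    destruct (Hphi z Hz) as [Bz Ez].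
    assert (u < phi z) by (apply Inc'; lra).
    assert (phi z < v) by (apply Inc'; lra).
    apply Rabs_def1; lra. }
  assert (Dphi : forall y, A p < y < A q -> is_derive phi y (/ Derive A (phi y))).
  { intros y Hy; destruct (Hphi y Hy) as [B E].
    apply is_derive_Reals; intros eps Heps.
    assert (Cinv : continuous (fun x => / Derive A x) (phi y)).
    { apply smooth_at_continuous, smooth_at_Rinv.
      - apply smooth_at_Derive, H; lra.
      - apply Rgt_not_eq, H; lra. }
    destruct (proj1 (filterlim_locally _ _) Cinv (mkposreal eps Heps)) as [d Hd].
    destruct (Cphi y Hy d) as [r Hr].
    exists r; intros h Hh0 Hh.
    assert (Hb : ball y r (y + h)).
    { unfold ball; simpl; unfold AbsRing_ball, abs, minus, plus, opp; simpl.
      now replace (y + h + - y) with h by ring. }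
    destruct (Hr _ Hb) as [Hz Hzd].
    destruct (Hphi _ Hz) as [Bz Ez].
    (* The difference quotient of phi equals / A'(c) with c between phi y and phi (y + h), so
       continuity of / A' gives the limit. *)
    destruct (MVT_gen A (phi y) (phi (y + h)) (Derive A)) as (c & Hc & Ec).
    { intros x Hx; apply smooth_at_is_derive, H.
      assert (p < Rmin (phi y) (phi (y + h))) by (apply Rmin_glb_lt; lra).
      assert (Rmax (phi y) (phi (y + h)) < q) by (apply Rmax_lub_lt; lra).
      lra. }
    { intros x Hx; apply Cont.
      assert (p < Rmin (phi y) (phi (y + h))) by (apply Rmin_glb_lt; lra).
      assert (Rmax (phi y) (phi (y + h)) < q) by (apply Rmax_lub_lt; lra).
      lra. }
    rewrite Ez, E in Ec.
    assert (Hcb : p < c < q).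
    { assert (p < Rmin (phi y) (phi (y + h))) by (apply Rmin_glb_lt; lra).
      assert (Rmax (phi y) (phi (y + h)) < q) by (apply Rmax_lub_lt; lra).
      lra. }
    assert (Hc0 : 0 < Derive A c) by (apply H; lra).
    replace ((phi (y + h) - phi y) / h) with (/ Derive A c).
    - apply (Hd c).
      unfold ball; simpl; unfold AbsRing_ball, abs, minus, plus, opp; simpl.
      apply Rabs_def2 in Hzd.
      revert Hc; unfold Rmin, Rmax; destruct (Rle_dec _ _); intros Hc;
        apply Rabs_def1; lra.
    - replace h with (Derive A c * (phi (y + h) - phi y)) at 2 by lra.
      field; split; [|lra].
      intros Z; rewrite Z in Ec; apply Hh0; lra. }
  exists phi; split.
  - intros x Hx.
    assert (Hy : A p < A x < A q) by (split; apply Inc; lra).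
    destruct (Hphi _ Hy) as [B E].
    destruct (Rtotal_order (phi (A x)) x) as [K|[K|K]]; [|easy|].
    + specialize (Inc (phi (A x)) x); lra.
    + specialize (Inc x (phi (A x))); lra.
  - intros y Hy; destruct (Hphi y Hy) as [B E]; split; [easy|split; [|auto]].
    intros n; revert y Hy B E; induction n as [|n IH]; intros y Hy B E.
    + now apply (is_derive_continuity_pt _ _ _ (Dphi y Hy)).
    + exists (fun z => / Derive A (phi z)); split.
      * apply (locally_interval _ _ (A p) (A q)); [apply Hy|apply Hy|].
        intros z Hz1 Hz2; apply Dphi; split; [exact Hz1|exact Hz2].
      * apply (Cn_at_comp n (fun x => / Derive A x)); [|now apply IH].
        apply smooth_at_Rinv.
        -- apply smooth_at_Derive, H; lra.
        -- apply Rgt_not_eq, H; lra.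
Qed.

(** * Vector calculus *)

Lemma vec_ext (u v : vec) : xc u = xc v -> yc u = yc v -> zc u = zc v -> u = v.
Proof. destruct u, v; simpl; intros -> -> ->; easy. Qed.

Ltac vec_ring :=
  intros; try apply vec_ext; unfold det3, dot, cross, vadd, vscal, vzero in *;
  simpl in *; ring.

Lemma dot_comm (u v : vec) : dot u v = dot v u.
Proof. vec_ring. Qed.

Lemma dot_vadd_r (u v w : vec) : dot u (vadd v w) = dot u v + dot u w.
Proof. vec_ring. Qed.

Lemma dot_vscal_r (a : R) (u v : vec) : dot u (vscal a v) = a * dot u v.
Proof. vec_ring. Qed.

Lemma dot_vadd_l (u v w : vec) : dot (vadd u v) w = dot u w + dot v w.
Proof. vec_ring. Qed.

Lemma dot_vscal_l (a : R) (u v : vec) : dot (vscal a u) v = a * dot u v.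
Proof. vec_ring. Qed.

Lemma dot_vzero_r (u : vec) : dot u vzero = 0.
Proof. vec_ring. Qed.

Lemma det3_cycle (u v w : vec) : det3 u v w = dot u (cross v w).
Proof. vec_ring. Qed.

Lemma det3_cycle' (u v w : vec) : det3 u v w = dot v (cross w u).
Proof. vec_ring. Qed.

Lemma cross_cross (u v w : vec) :
  cross u (cross v w) = vadd (vscal (dot u w) v) (vscal (- dot u v) w).
Proof. vec_ring. Qed.

Lemma dot_cross_cross (u v : vec) :
  dot (cross u v) (cross u v) = dot u u * dot v v - dot u v * dot u v.
Proof. vec_ring. Qed.

Lemma dot_self_nonneg (u : vec) : 0 <= dot u u.
Proof. unfold dot; nra. Qed.

Lemma vnorm_1 (u : vec) : vnorm u = 1 <-> dot u u = 1.
Proof.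
  unfold vnorm; split; intros H.
  - rewrite <- (sqrt_sqrt (dot u u)) by apply dot_self_nonneg; rewrite H; ring.
  - rewrite H; apply sqrt_1.
Qed.

Lemma vnorm_vscal (a : R) (u : vec) : vnorm (vscal a u) = Rabs a * vnorm u.
Proof.
  unfold vnorm.
  replace (dot (vscal a u) (vscal a u)) with (Rsqr a * dot u u)
    by (unfold Rsqr; vec_ring).
  rewrite sqrt_mult; [|apply Rle_0_sqr|apply dot_self_nonneg].
  now rewrite sqrt_Rsqr_abs.
Qed.

Lemma vnorm_nonneg (u : vec) : 0 <= vnorm u.
Proof. apply sqrt_pos. Qed.

Definition orthonormal (t n : vec) : Prop := dot t t = 1 /\ dot n n = 1 /\ dot t n = 0.

Definition comb (t n : vec) (a b c : R) : vec :=
  vadd (vscal a t) (vadd (vscal b n) (vscal c (cross t n))).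

Lemma orthonormal_cross (t n : vec) : orthonormal t n ->
  cross n (cross t n) = t /\ cross (cross t n) t = n /\
  dot (cross t n) (cross t n) = 1 /\ dot t (cross t n) = 0 /\ dot n (cross t n) = 0.
Proof.
  intros (Ht & Hn & Htn); repeat split.
  - rewrite cross_cross, (dot_comm n t), Hn, Htn; vec_ring.
  - replace (cross (cross t n) t) with (vscal (-1) (cross t (cross t n))) by vec_ring.
    rewrite cross_cross, Ht, Htn; vec_ring.
  - rewrite dot_cross_cross, Ht, Hn, Htn; ring.
  - vec_ring.
  - vec_ring.
Qed.

(** With w = t x n, the vector w x (w x u) is computed twice: as <w, u> w - u since w is a unit
    vector, and through w x u = <t, u> n - <n, u> t. Comparing the results isolates u. *)
Lemma orthonormal_expand (t n u : vec) : orthonormal t n ->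
  u = comb t n (dot t u) (dot n u) (dot (cross t n) u).
Proof.
  intros H; destruct (orthonormal_cross t n H) as (E1 & E2 & E3 & _ & _).
  assert (K : vadd (vscal (dot (cross t n) u) (cross t n)) (vscal (-1) u) =
              vadd (vscal (dot t u) (cross (cross t n) n))
                   (vscal (- dot n u) (cross (cross t n) t))).
  { transitivity (cross (cross t n) (cross (cross t n) u)).
    - rewrite cross_cross, E3; vec_ring.
    - vec_ring. }
  replace (cross (cross t n) n) with (vscal (-1) (cross n (cross t n))) in K by vec_ring.
  rewrite E1, E2 in K.
  unfold comb; revert K; generalize (dot (cross t n) u) (dot t u) (dot n u) (cross t n).
  intros c a b w K; apply vec_ext; unfold vadd, vscal in *; simpl in *;
    injection K; intros; lra.
Qed.

Lemma cross_comb (t n : vec) (a b c a' b' c' : R) : orthonormal t n ->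
  cross (comb t n a b c) (comb t n a' b' c') =
  comb t n (b * c' - c * b') (c * a' - a * c') (a * b' - b * a').
Proof.
  intros H; destruct (orthonormal_cross t n H) as (E1 & E2 & _).
  transitivity (vadd (vscal (b * c' - c * b') (cross n (cross t n)))
    (vadd (vscal (c * a' - a * c') (cross (cross t n) t))
          (vscal (a * b' - b * a') (cross t n)))).
  - unfold comb; vec_ring.
  - now rewrite E1, E2.
Qed.

Lemma dot_comb_r (t n u : vec) (a b c : R) :
  dot u (comb t n a b c) = a * dot u t + b * dot u n + c * dot u (cross t n).
Proof. unfold comb; vec_ring. Qed.

Lemma dot_comb (t n : vec) (a b c a' b' c' : R) : orthonormal t n ->
  dot (comb t n a b c) (comb t n a' b' c') = a * a' + b * b' + c * c'.
Proof.
  intros H; destruct (orthonormal_cross t n H) as (_ & _ & E3 & E4 & E5).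
  destruct H as (Ht & Hn & Htn).
  rewrite dot_comb_r, (dot_comm _ t), (dot_comm _ n), (dot_comm _ (cross t n)).
  rewrite !dot_comb_r, (dot_comm n t), (dot_comm (cross t n) t), (dot_comm (cross t n) n).
  rewrite Ht, Hn, Htn, E3, E4, E5; ring.
Qed.

Definition vis_derive (c : R -> vec) (t : R) (d : vec) : Prop :=
  is_derive (fun s => xc (c s)) t (xc d) /\
  is_derive (fun s => yc (c s)) t (yc d) /\
  is_derive (fun s => zc (c s)) t (zc d).

Lemma vis_derive_unique (c : R -> vec) (t : R) (d : vec) :
  vis_derive c t d -> vDerive c t = d.
Proof. intros (X & Y & Z); apply vec_ext; now apply is_derive_unique. Qed.

Lemma vis_derive_ext_loc (c c' : R -> vec) (t : R) (d : vec) :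
  locally t (fun s => c s = c' s) -> vis_derive c t d -> vis_derive c' t d.
Proof.
  intros H (X & Y & Z); split; [|split].
  1: apply is_derive_ext_loc with (2 := X).
  2: apply is_derive_ext_loc with (2 := Y).
  3: apply is_derive_ext_loc with (2 := Z).
  all: revert H; apply filter_imp; intros s ->; easy.
Qed.

Lemma vis_derive_eq (c : R -> vec) (t : R) (d d' : vec) :
  vis_derive c t d -> d = d' -> vis_derive c t d'.
Proof. intros H <-; easy. Qed.

Lemma vis_derive_dot (u v : R -> vec) (t : R) (du dv : vec) :
  vis_derive u t du -> vis_derive v t dv ->
  is_derive (fun s => dot (u s) (v s)) t (dot du (v t) + dot (u t) dv).
Proof.
  intros (X & Y & Z) (X' & Y' & Z').
  apply (is_derive_eq _ _ ((xc du * xc (v t) + xc (u t) * xc dv) +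
    (yc du * yc (v t) + yc (u t) * yc dv) + (zc du * zc (v t) + zc (u t) * zc dv))).
  - apply is_derive_Rplus; [apply is_derive_Rplus|]; now apply is_derive_Rmult.
  - vec_ring.
Qed.

Lemma is_derive_Rminus (f g : R -> R) (x df dg : R) :
  is_derive f x df -> is_derive g x dg ->
  is_derive (fun y => f y - g y) x (df - dg).
Proof. intros Hf Hg; exact (is_derive_minus f g x df dg Hf Hg). Qed.

Lemma vis_derive_cross (u v : R -> vec) (t : R) (du dv : vec) :
  vis_derive u t du -> vis_derive v t dv ->
  vis_derive (fun s => cross (u s) (v s)) t (vadd (cross du (v t)) (cross (u t) dv)).
Proof.
  intros (X & Y & Z) (X' & Y' & Z'); split; [|split]; simpl;
  (eapply is_derive_eq; [apply is_derive_Rminus; apply is_derive_Rmult; eassumption|vec_ring]).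
Qed.

Lemma vis_derive_vscal (f : R -> R) (u : R -> vec) (t df : R) (du : vec) :
  is_derive f t df -> vis_derive u t du ->
  vis_derive (fun s => vscal (f s) (u s)) t (vadd (vscal df (u t)) (vscal (f t) du)).
Proof.
  intros F (X & Y & Z); split; [|split]; simpl; now apply is_derive_Rmult.
Qed.

Lemma vis_derive_vadd (u v : R -> vec) (t : R) (du dv : vec) :
  vis_derive u t du -> vis_derive v t dv ->
  vis_derive (fun s => vadd (u s) (v s)) t (vadd du dv).
Proof.
  intros (X & Y & Z) (X' & Y' & Z'); split; [|split]; simpl; now apply is_derive_Rplus.
Qed.

Lemma vis_derive_det3 (u v w : R -> vec) (t : R) (du dv dw : vec) :
  vis_derive u t du -> vis_derive v t dv -> vis_derive w t dw ->
  is_derive (fun s => det3 (u s) (v s) (w s)) t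
    (det3 du (v t) (w t) + det3 (u t) dv (w t) + det3 (u t) (v t) dw).
Proof.
  intros U V W.
  eapply is_derive_eq.
  - exact (vis_derive_dot _ _ _ _ _ (vis_derive_cross _ _ _ _ _ U V) W).
  - unfold det3; rewrite dot_vadd_l; ring.
Qed.

Lemma vis_derive_unique_Icc (a b : R) (f g : R -> vec) (x : R) (l m : vec) :
  a < b -> a <= x <= b -> vis_derive f x l -> vis_derive g x m ->
  (forall y, a <= y <= b -> f y = g y) -> l = m.
Proof.
  intros Hab Hx (X & Y & Z) (X' & Y' & Z') He; apply vec_ext.
  - apply (is_derive_unique_Icc a b _ _ x _ _ Hab Hx X X'); intros y Hy; now rewrite He.
  - apply (is_derive_unique_Icc a b _ _ x _ _ Hab Hx Y Y'); intros y Hy; now rewrite He.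
  - apply (is_derive_unique_Icc a b _ _ x _ _ Hab Hx Z Z'); intros y Hy; now rewrite He.
Qed.

Definition vsmooth_at (c : R -> vec) (x : R) : Prop :=
  smooth_at (fun s => xc (c s)) x /\ smooth_at (fun s => yc (c s)) x /\ smooth_at (fun s => zc (c s)) x.

Definition vsmooth2_at (c : R -> R -> vec) (t s : R) : Prop :=
  smooth2_at (fun u v => xc (c u v)) t s /\ smooth2_at (fun u v => yc (c u v)) t s /\
  smooth2_at (fun u v => zc (c u v)) t s.

Lemma vsmooth_at_vis_derive (c : R -> vec) (x : R) : vsmooth_at c x -> vis_derive c x (vDerive c x).
Proof. intros (X & Y & Z); split; [|split]; now apply smooth_at_is_derive. Qed.

Lemma vsmooth_at_vDerive (c : R -> vec) (x : R) : vsmooth_at c x -> vsmooth_at (vDerive c) x.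
Proof. intros (X & Y & Z); split; [|split]; now apply smooth_at_Derive. Qed.

Lemma vsmooth2_at_of_vsmooth_at (c : R -> vec) (t s : R) : vsmooth_at c s -> vsmooth2_at (fun _ v => c v) t s.
Proof.
  intros (X & Y & Z); split; [|split].
  - exact (smooth2_at_of_smooth_at _ _ _ X).
  - exact (smooth2_at_of_smooth_at _ _ _ Y).
  - exact (smooth2_at_of_smooth_at _ _ _ Z).
Qed.

Lemma vsmooth_at_of_vsmooth2_at (c : R -> R -> vec) (t s : R) : vsmooth2_at c t s -> vsmooth_at (c t) s.
Proof.
  intros (X & Y & Z); split; [|split].
  - exact (smooth_at_of_smooth2_at _ _ _ X).
  - exact (smooth_at_of_smooth2_at _ _ _ Y).
  - exact (smooth_at_of_smooth2_at _ _ _ Z).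
Qed.

Lemma vsmooth2_at_dot (u v : R -> R -> vec) (t s : R) :
  vsmooth2_at u t s -> vsmooth2_at v t s -> smooth2_at (fun x y => dot (u x y) (v x y)) t s.
Proof.
  intros (X & Y & Z) (X' & Y' & Z').
  apply smooth2_at_plus; [apply smooth2_at_plus|]; now apply smooth2_at_mult.
Qed.

Lemma vsmooth2_at_cross (u v : R -> R -> vec) (t s : R) :
  vsmooth2_at u t s -> vsmooth2_at v t s -> vsmooth2_at (fun x y => cross (u x y) (v x y)) t s.
Proof.
  intros (X & Y & Z) (X' & Y' & Z').
  split; [|split]; simpl; apply smooth2_at_minus; now apply smooth2_at_mult.
Qed.

Lemma vsmooth2_at_det3 (u v w : R -> R -> vec) (t s : R) :
  vsmooth2_at u t s -> vsmooth2_at v t s -> vsmooth2_at w t s ->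
  smooth2_at (fun x y => det3 (u x y) (v x y) (w x y)) t s.
Proof.
  intros U V W; exact (vsmooth2_at_dot _ _ _ _ (vsmooth2_at_cross _ _ _ _ U V) W).
Qed.

Lemma vsmooth2_at_vscal (f : R -> R -> R) (u : R -> R -> vec) (t s : R) :
  smooth2_at f t s -> vsmooth2_at u t s -> vsmooth2_at (fun x y => vscal (f x y) (u x y)) t s.
Proof. intros F (X & Y & Z); split; [|split]; now apply smooth2_at_mult. Qed.

Lemma vsmooth2_at_vadd (u v : R -> R -> vec) (t s : R) :
  vsmooth2_at u t s -> vsmooth2_at v t s -> vsmooth2_at (fun x y => vadd (u x y) (v x y)) t s.
Proof.
  intros (X & Y & Z) (X' & Y' & Z'); split; [|split]; simpl; now apply smooth2_at_plus.
Qed.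

Lemma vsmooth_at_dot (u v : R -> vec) (s : R) :
  vsmooth_at u s -> vsmooth_at v s -> smooth_at (fun x => dot (u x) (v x)) s.
Proof.
  intros U V; apply (smooth_at_of_smooth2_at (fun _ x => dot (u x) (v x)) 0).
  apply vsmooth2_at_dot; now apply vsmooth2_at_of_vsmooth_at.
Qed.

Lemma vsmooth_at_cross (u v : R -> vec) (s : R) :
  vsmooth_at u s -> vsmooth_at v s -> vsmooth_at (fun x => cross (u x) (v x)) s.
Proof.
  intros U V; apply (vsmooth_at_of_vsmooth2_at (fun _ x => cross (u x) (v x)) 0).
  apply vsmooth2_at_cross; now apply vsmooth2_at_of_vsmooth_at.
Qed.

Lemma vsmooth_at_det3 (u v w : R -> vec) (s : R) :
  vsmooth_at u s -> vsmooth_at v s -> vsmooth_at w s -> smooth_at (fun x => det3 (u x) (v x) (w x)) s.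
Proof.
  intros U V W; exact (vsmooth_at_dot _ _ _ (vsmooth_at_cross _ _ _ U V) W).
Qed.

Lemma vsmooth_at_vscal (f : R -> R) (u : R -> vec) (s : R) :
  smooth_at f s -> vsmooth_at u s -> vsmooth_at (fun x => vscal (f x) (u x)) s.
Proof. intros F (X & Y & Z); split; [|split]; now apply smooth_at_mult. Qed.

Lemma vsmooth_at_comp (c : R -> vec) (f : R -> R) (s : R) :
  vsmooth_at c (f s) -> smooth_at f s -> vsmooth_at (fun x => c (f x)) s.
Proof.
  intros (X & Y & Z) F; split; [|split].
  - exact (smooth_at_comp (fun x => xc (c x)) f s X F).
  - exact (smooth_at_comp (fun x => yc (c x)) f s Y F).
  - exact (smooth_at_comp (fun x => zc (c x)) f s Z F).
Qed.

Lemma vis_derive_comp (c : R -> vec) (f : R -> R) (s df : R) (d : vec) :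
  vis_derive c (f s) d -> is_derive f s df ->
  vis_derive (fun x => c (f x)) s (vscal df d).
Proof.
  intros (X & Y & Z) F; split; [|split]; simpl; rewrite Rmult_comm.
  - exact (is_derive_Rcomp (fun x => xc (c x)) f s _ _ X F).
  - exact (is_derive_Rcomp (fun x => yc (c x)) f s _ _ Y F).
  - exact (is_derive_Rcomp (fun x => zc (c x)) f s _ _ Z F).
Qed.

Lemma vnorm_pos (u : vec) : vnorm u <> 0 -> 0 < dot u u.
Proof.
  intros H; destruct (Rle_lt_or_eq_dec 0 (dot u u) (dot_self_nonneg u)) as [K|K]; [easy|].
  exfalso; apply H; unfold vnorm; rewrite <- K; apply sqrt_0.
Qed.

Lemma vnorm_sqr (u : vec) : vnorm u * vnorm u = dot u u.
Proof. apply sqrt_sqrt, dot_self_nonneg. Qed.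

Lemma vsmooth_at_vnorm (u : R -> vec) (s : R) :
  vsmooth_at u s -> vnorm (u s) <> 0 -> smooth_at (fun x => vnorm (u x)) s.
Proof.
  intros U H; apply smooth_at_Rsqrt; [now apply vsmooth_at_dot|now apply vnorm_pos].
Qed.

Lemma vsmooth2_at_vnorm (u : R -> R -> vec) (t s : R) :
  vsmooth2_at u t s -> vnorm (u t s) <> 0 -> smooth2_at (fun x y => vnorm (u x y)) t s.
Proof.
  intros U H; apply smooth2_at_sqrt; [now apply vsmooth2_at_dot|now apply vnorm_pos].
Qed.

Lemma smooth_curve_vsmooth_at (L : R) (c : R -> vec) :
  smooth_curve L c <-> exists d, 0 < d /\ forall x, - d < x < L + d -> vsmooth_at c x.
Proof.
  unfold smooth_curve; rewrite !smooth_smooth_at; split.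
  - intros ((d1 & H1 & X) & (d2 & H2 & Y) & (d3 & H3 & Z)).
    exists (Rmin d1 (Rmin d2 d3)); split; [repeat apply Rmin_glb_lt; lra|].
    assert (M1 := Rmin_l d1 (Rmin d2 d3)); assert (M2 := Rmin_r d1 (Rmin d2 d3)).
    assert (M3 := Rmin_l d2 d3); assert (M4 := Rmin_r d2 d3).
    intros x Hx; split; [|split]; [apply X|apply Y|apply Z]; lra.
  - intros (d & Hd & H); split; [|split]; exists d; (split; [easy|]);
      intros x Hx; now apply H.
Qed.

(** * Variations *)

(** Working form of a variation: [F 0 j 0] is the jet of the base curve and [F 1 j 0] the jet of the
    variation field, which vanishes at both ends to all orders. The base curve is tied to the family
    on [0, L] only. *)
Record partials (e d L : R) (c : R -> vec) (G : R -> R -> vec)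
    (F : nat -> nat -> R -> R -> vec) : Prop := {
  partials_e : 0 < e;
  partials_d : 0 < d;
  partials_G : forall t s, Rabs t < e -> - d < s < L + d -> F 0%nat 0%nat t s = G t s;
  partials_t : forall i j t s, Rabs t < e -> - d < s < L + d ->
    vis_derive (fun u => F i j u s) t (F (S i) j t s);
  partials_s : forall i j t s, Rabs t < e -> - d < s < L + d ->
    vis_derive (fun u => F i j t u) s (F i (S j) t s);
  partials_sm : forall i j t s, Rabs t < e -> - d < s < L + d -> vsmooth2_at (F i j) t s;
  partials_0 : forall s, 0 <= s <= L -> F 0%nat 0%nat 0 s = c s;
  partials_end : forall j, F 1%nat j 0 0 = vzero /\ F 1%nat j 0 L = vzero }.

Lemma variation_partials (L : R) (c : R -> vec) (G : R -> R -> vec) :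
  0 < L -> variation L c G -> exists e d F, partials e d L c G F.
Proof.
  intros HL (e & He & (SX & SY & SZ) & H0 & (r & Hr & Hfix)).
  destruct SX as (d1 & X & Hd1 & HX), SY as (d2 & Y & Hd2 & HY), SZ as (d3 & Z & Hd3 & HZ).
  set (d := Rmin d1 (Rmin d2 d3)).
  assert (M1 := Rmin_l d1 (Rmin d2 d3)); assert (M2 := Rmin_r d1 (Rmin d2 d3)).
  assert (M3 := Rmin_l d2 d3); assert (M4 := Rmin_r d2 d3); fold d in M1, M2.
  assert (Hd : 0 < d) by (unfold d; repeat apply Rmin_glb_lt; lra).
  set (F := fun i j t s => Vec (X i j t s) (Y i j t s) (Z i j t s)).
  assert (HG : forall t s, Rabs t < e -> - d < s < L + d -> F 0%nat 0%nat t s = G t s).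
  { intros t s Ht Hs; apply vec_ext; [apply HX|apply HY|apply HZ]; lra. }
  assert (Ht : forall i j t s, Rabs t < e -> - d < s < L + d ->
    vis_derive (fun u => F i j u s) t (F (S i) j t s)).
  { intros i j t s Ht Hs; split; [|split]; [apply HX|apply HY|apply HZ]; lra. }
  assert (Hs : forall i j t s, Rabs t < e -> - d < s < L + d ->
    vis_derive (fun u => F i j t u) s (F i (S j) t s)).
  { intros i j t s Ht' Hs; split; [|split]; [apply HX|apply HY|apply HZ]; lra. }
  assert (He0 : Rabs 0 < e) by now rewrite Rabs_R0.
  (* On a collar the family does not depend on t, so the variation field is zero there. Its
     s-derivatives then vanish by uniqueness on the closed collar, including at the end point of
     [0, L], beyond which nothing is known. *)
  assert (Hzero : forall a b, 0 <= a -> a < b -> b <= L -> b <= r \/ L - r <= a ->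
            forall j s, a <= s <= b -> F 1%nat j 0 s = vzero).
  { intros a b Ha Hab Hb Hor j; induction j as [|j IH]; intros s Hs'.
    - assert (D := Ht 0%nat 0%nat 0 s He0 ltac:(lra)).
      rewrite <- (vis_derive_unique _ _ _ D).
      assert (K : locally 0 (fun u => c s = F 0%nat 0%nat u s)).
      { exists (mkposreal e He); intros u Hu.
        assert (Hu' : Rabs u < e) by (replace u with (u - 0) by ring; exact Hu).
        rewrite HG by (try easy; lra).
        symmetry; apply Hfix; [easy|lra|].
        destruct Hor; [left|right]; lra. }
      apply vis_derive_unique, (vis_derive_ext_loc (fun _ => c s)); [easy|].
      split; [|split]; apply (is_derive_const (K := R_AbsRing) (V := R_NormedModule)).
    - apply (vis_derive_unique_Icc a b (fun u => F 1%nat j 0 u) (fun _ => vzero) s);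
        [easy|easy|apply Hs; [easy|lra]| |exact IH].
      split; [|split]; apply (is_derive_const (K := R_AbsRing) (V := R_NormedModule)). }
  exists e, d, F; constructor; auto.
  - intros i j t s Ht' Hs'.
    split; [|split].
    + apply (smooth2_at_of_partials X e (- d1) (L + d1)); [|easy|lra].
      intros u v Hu Hv; apply (HX u v Hu Hv).
    + apply (smooth2_at_of_partials Y e (- d2) (L + d2)); [|easy|lra].
      intros u v Hu Hv; apply (HY u v Hu Hv).
    + apply (smooth2_at_of_partials Z e (- d3) (L + d3)); [|easy|lra].
      intros u v Hu Hv; apply (HZ u v Hu Hv).
  - intros s Hs'; rewrite HG by (try easy; lra); now apply H0.
  - intros j.
    (* The collar width r may exceed L, so it is cut down to fit into the interval. *)
    assert (Q1 := Rmin_l r L); assert (Q2 := Rmin_r r L).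
    assert (Q3 : 0 < Rmin r L) by now apply Rmin_glb_lt.
    split.
    + apply (Hzero 0 (Rmin r L)); lra.
    + apply (Hzero (L - Rmin r L) L); lra.
Qed.

Lemma partials_vDerive (e d L : R) c G F j t s (f : R -> vec) :
  partials e d L c G F -> Rabs t < e -> - d < s < L + d ->
  (forall u, - d < u < L + d -> f u = F 0%nat j t u) ->
  vDerive f s = F 0%nat (S j) t s.
Proof.
  intros P Ht Hs Hf; apply vis_derive_unique.
  apply vis_derive_ext_loc with (F 0%nat j t); [|now apply P].
  apply (locally_interval _ _ (- d) (L + d)); [apply Hs|apply Hs|].
  intros u Hu1 Hu2; symmetry; apply Hf; split; [exact Hu1|exact Hu2].
Qed.

Lemma partials_vDerive3 (e d L : R) c G F t s :
  partials e d L c G F -> Rabs t < e -> - d < s < L + d ->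
  G t s = F 0%nat 0%nat t s /\
  vDerive (G t) s = F 0%nat 1%nat t s /\
  vDerive (vDerive (G t)) s = F 0%nat 2%nat t s /\
  vDerive (vDerive (vDerive (G t))) s = F 0%nat 3%nat t s.
Proof.
  intros P Ht.
  assert (H0 : forall u, - d < u < L + d -> G t u = F 0%nat 0%nat t u).
  { intros u Hu; symmetry; now apply P. }
  assert (H1 : forall u, - d < u < L + d -> vDerive (G t) u = F 0%nat 1%nat t u).
  { intros u Hu; now apply (partials_vDerive e d L c G). }
  assert (H2 : forall u, - d < u < L + d -> vDerive (vDerive (G t)) u = F 0%nat 2%nat t u).
  { intros u Hu; now apply (partials_vDerive e d L c G). }
  intros Hs; repeat split; auto.
  now apply (partials_vDerive e d L c G).
Qed.

(** Since [c] and [G 0] agree on [0, L] only, their jets are matched inductively, by uniqueness of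
    derivatives on the closed interval, with any tower [f] of successive derivatives of [c]. *)
Lemma partials_base (e d L : R) c G F (f : nat -> R -> vec) :
  0 < L -> partials e d L c G F ->
  (forall s, 0 <= s <= L -> c s = f 0%nat s) ->
  forall n,
  (forall j s, (j < n)%nat -> 0 <= s <= L -> vis_derive (f j) s (f (S j) s)) ->
  forall s, 0 <= s <= L -> F 0%nat n 0 s = f n s.
Proof.
  intros HL P Hc n Hf.
  assert (He0 : Rabs 0 < e) by (rewrite Rabs_R0; apply P).
  assert (Hd := partials_d _ _ _ _ _ _ P).
  enough (K : forall m, (m <= n)%nat -> forall s, 0 <= s <= L -> F 0%nat m 0 s = f m s)
    by now apply K.
  induction m as [|m IH]; intros Hm s Hs.
  - rewrite <- Hc by easy; now apply P.
  - apply (vis_derive_unique_Icc 0 L (F 0%nat m 0) (f m) s); [easy|easy| | |].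
    + apply P; [easy|lra].
    + apply Hf; [lia|easy].
    + apply IH; lia.
Qed.

(** * Spherical elastic curves *)

(** Darboux frame of a unit speed spherical curve: T' = N and N' = - T + k B with B = T x N. The
    remaining equation B' = - k N is a consequence. *)
Definition frame_at (t n : R -> vec) (k : R -> R) (s : R) : Prop :=
  orthonormal (t s) (n s) /\ vis_derive t s (n s) /\
  vis_derive n s (comb (t s) (n s) (-1) 0 (k s)).

Lemma frame_binormal (t n : R -> vec) (k : R -> R) (s : R) : frame_at t n k s ->
  vis_derive (fun u => cross (t u) (n u)) s (vscal (- k s) (n s)).
Proof.
  intros (O & Ht & Hn).
  eapply vis_derive_eq; [exact (vis_derive_cross _ _ _ _ _ Ht Hn)|].
  replace (n s) with (comb (t s) (n s) 0 1 0) at 1 2 4 by (unfold comb; vec_ring).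
  replace (t s) with (comb (t s) (n s) 1 0 0) at 3 by (unfold comb; vec_ring).
  rewrite !cross_comb by easy.
  unfold comb; vec_ring.
Qed.

(** Differentiating <c, c> = 1, <c', c'> = 1 and <c, c'> = 0 gives the components of c'' along c and
    c'; at unit speed the third component is the geodesic curvature by definition. *)
Lemma unit_speed_frame (L : R) (c : R -> vec) :
  0 < L -> smooth_curve L c ->
  (forall s, 0 <= s <= L -> vnorm (c s) = 1 /\ speed c s = 1) ->
  forall s, 0 <= s <= L -> frame_at c (vDerive c) (geodesic_curvature c) s.
Proof.
  intros HL Hc H.
  destruct (proj1 (smooth_curve_vsmooth_at L c) Hc) as (d & Hd & Hsm).
  assert (D0 : forall s, 0 <= s <= L -> vis_derive c s (vDerive c s)).
  { intros s Hs; apply vsmooth_at_vis_derive, Hsm; lra. }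
  assert (D1 : forall s, 0 <= s <= L -> vis_derive (vDerive c) s (vDerive (vDerive c) s)).
  { intros s Hs; apply vsmooth_at_vis_derive, vsmooth_at_vDerive, Hsm; lra. }
  assert (N0 : forall s, 0 <= s <= L -> dot (c s) (c s) = 1).
  { intros s Hs; apply vnorm_1, H, Hs. }
  assert (N1 : forall s, 0 <= s <= L -> dot (vDerive c s) (vDerive c s) = 1).
  { intros s Hs; apply vnorm_1, (H s Hs). }
  assert (Z0 : forall s, 0 <= s <= L -> dot (c s) (vDerive c s) = 0).
  { intros s Hs.
    assert (E := is_derive_unique_Icc 0 L _ (fun _ => 1) s _ 0 HL Hs
      (vis_derive_dot _ _ _ _ _ (D0 s Hs) (D0 s Hs)) (is_derive_const 1 s) N0).
    rewrite (dot_comm (vDerive c s)) in E; lra. }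
  intros s Hs.
  assert (Z1 : dot (vDerive c s) (vDerive (vDerive c) s) = 0).
  { assert (E := is_derive_unique_Icc 0 L _ (fun _ => 1) s _ 0 HL Hs
      (vis_derive_dot _ _ _ _ _ (D1 s Hs) (D1 s Hs)) (is_derive_const 1 s) N1).
    rewrite (dot_comm (vDerive (vDerive c) s)) in E; lra. }
  assert (Z2 : dot (c s) (vDerive (vDerive c) s) = -1).
  { assert (E := is_derive_unique_Icc 0 L _ (fun _ => 0) s _ 0 HL Hs
      (vis_derive_dot _ _ _ _ _ (D0 s Hs) (D1 s Hs)) (is_derive_const 0 s) Z0).
    rewrite (N1 s Hs) in E; lra. }
  assert (O : orthonormal (c s) (vDerive c s)) by (repeat split; auto).
  split; [easy|split; [now apply D0|]].
  eapply vis_derive_eq; [now apply D1|].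
  rewrite (orthonormal_expand (c s) (vDerive c s) (vDerive (vDerive c) s)) at 1 by easy.
  rewrite Z1, Z2; f_equal.
  unfold geodesic_curvature; rewrite (proj2 (H s Hs)).
  unfold det3; field.
Qed.

Lemma geodesic_curvature_smooth_at (c : R -> vec) (s : R) :
  vsmooth_at c s -> speed c s <> 0 -> smooth_at (geodesic_curvature c) s.
Proof.
  intros H Hs; assert (H1 := vsmooth_at_vDerive _ _ H); assert (H2 := vsmooth_at_vDerive _ _ H1).
  apply smooth_at_div.
  - now apply vsmooth_at_det3.
  - now apply smooth_at_pow, vsmooth_at_vnorm.
  - now apply pow_nonzero.
Qed.

(** Here a stands for <c', c'> and D for det (c, c', c''), with the unit speed values 1 and k at the
    base curve. *)
Lemma is_derive_spherical_density (l k a' D' : R) (a D : R -> R) :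
  is_derive a 0 a' -> is_derive D 0 D' -> a 0 = 1 -> D 0 = k ->
  is_derive (fun u => ((D u / sqrt (a u) ^ 3) ^ 2 + l) * sqrt (a u)) 0
    (2 * k * D' + (l - 5 * k ^ 2) * (a' / 2)).
Proof.
  intros Ha HD Ha0 HD0.
  assert (Hs : is_derive (fun u => sqrt (a u)) 0 (a' / 2)).
  { eapply is_derive_eq; [apply (is_derive_sqrt a 0 a'); [easy|lra]|].
    rewrite Ha0, sqrt_1; field. }
  assert (Hs0 : sqrt (a 0) = 1) by (rewrite Ha0; apply sqrt_1).
  (* The root is replaced by an arbitrary function v with the same value and derivative, so that the
     remaining computation is rational. *)
  assert (K : forall v, is_derive v 0 (a' / 2) -> v 0 = 1 ->
    is_derive (fun u => ((D u / v u ^ 3) ^ 2 + l) * v u) 0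
      (2 * k * D' + (l - 5 * k ^ 2) * (a' / 2))); [|exact (K _ Hs Hs0)].
  intros v Hv Hv0; auto_derive.
  - repeat split; try (now exists D'); try (now exists (a' / 2)); rewrite Hv0; lra.
  - rewrite (is_derive_unique _ _ _ HD : Derive (fun x => D x) 0 = D').
    rewrite (is_derive_unique _ _ _ Hv : Derive (fun x => v x) 0 = a' / 2).
    rewrite Hv0, HD0; field.
Qed.

Lemma spherical_first_variation (l L : R) (c n : R -> vec) (k k1 k2 : R -> R)
    (G : R -> R -> vec) :
  0 < L ->
  (forall s, 0 <= s <= L -> frame_at c n k s /\
     is_derive k s (k1 s) /\ is_derive k1 s (k2 s) /\ continuous k2 s) ->
  variation L c G ->
  locally 0 (fun t => spherical_curve L (G t)) ->
  exists V : R -> vec,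
    (forall s, 0 <= s <= L -> vis_derive (fun t => G t s) 0 (V s)) /\
    is_derive (fun t => spherical_energy l L (G t)) 0
      (RInt (fun s => (2 * k2 s + k s ^ 3 + (2 - l) * k s) *
                      dot (cross (c s) (n s)) (V s)) 0 L).
Proof.
  intros HL HF HG [r Hr].
  destruct (variation_partials L c G HL HG) as (e & d & F & P).
  assert (He := partials_e _ _ _ _ _ _ P); assert (Hd := partials_d _ _ _ _ _ _ P).
  assert (He0 : Rabs 0 < e) by now rewrite Rabs_R0.
  assert (HV : forall s, 0 <= s <= L -> vis_derive (fun t => G t s) 0 (F 1%nat 0%nat 0 s)).
  { intros s Hs; apply vis_derive_ext_loc with (fun t => F 0%nat 0%nat t s).
    - exists (mkposreal e He); intros u Hu; apply (partials_G _ _ _ _ _ _ P); [|lra].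
      replace u with (u - 0) by ring; exact Hu.
    - apply (partials_t _ _ _ _ _ _ P); [easy|lra]. }
  exists (F 1%nat 0%nat 0); split; [exact HV|].
  (* The 2-jet of the base curve is T, N, - T + k B. *)
  assert (HB : forall j s, (j <= 2)%nat -> 0 <= s <= L -> F 0%nat j 0 s =
     match j with 0%nat => c s | 1%nat => n s | _ => comb (c s) (n s) (-1) 0 (k s) end).
  { intros j s Hj.
    apply (partials_base e d L c G F
      (fun j s => match j with 0%nat => c s | 1%nat => n s
                  | _ => comb (c s) (n s) (-1) 0 (k s) end) HL P); [easy|].
    intros i u Hi Hu; destruct (HF u Hu) as ((_ & D1 & D2) & _).
    destruct i as [|[|i]]; [easy|easy|lia]. }
  (* All curves of the family lie in the sphere, so differentiating <G, G> = 1 in t makes the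
     variation field orthogonal to c. *)
  assert (HT : forall s, 0 <= s <= L -> dot (c s) (F 1%nat 0%nat 0 s) = 0).
  { intros s Hs.
    assert (E1 := vis_derive_dot _ _ _ _ _ (HV s Hs) (HV s Hs)).
    assert (E2 : is_derive (fun t => dot (G t s) (G t s)) 0 0).
    { apply is_derive_ext_loc with (fun _ => 1); [|apply (is_derive_const 1)].
      exists r; intros u Hu; symmetry; apply vnorm_1, (Hr u Hu), Hs. }
    assert (E3 := is_derive_unique2 _ _ _ _ E2 E1); cbv beta in E3.
    rewrite <- (partials_G _ _ _ _ _ _ P 0 s), (partials_0 _ _ _ _ _ _ P s) in E3
      by (try easy; lra).
    rewrite (dot_comm (F _ _ _ _)) in E3; lra. }
  apply (is_derive_RInt_primitive
    (fun t s => ((det3 (F 0%nat 0%nat t s) (F 0%nat 1%nat t s) (F 0%nat 2%nat t s) /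
                  sqrt (dot (F 0%nat 1%nat t s) (F 0%nat 1%nat t s)) ^ 3) ^ 2 + l) *
                sqrt (dot (F 0%nat 1%nat t s) (F 0%nat 1%nat t s))) _
    (fun s => 2 * (k s * dot (cross (c s) (n s)) (F 1%nat 1%nat 0 s)) +
              (l - k s * k s) * dot (n s) (F 1%nat 0%nat 0 s) -
              2 * (k1 s * dot (cross (c s) (n s)) (F 1%nat 0%nat 0 s))) _ L e);
    try easy.
  - intros s Hs.
    assert (S : forall j, vsmooth2_at (F 0%nat j) 0 s).
    { intros j; apply (partials_sm _ _ _ _ _ _ P); [easy|lra]. }
    assert (Hpos : 0 < dot (F 0%nat 1%nat 0 s) (F 0%nat 1%nat 0 s)).
    { rewrite (HB 1%nat) by (lia || easy).
      destruct (HF s Hs) as (((_ & K & _) & _) & _); lra. }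
    assert (Hsq : smooth2_at (fun u v => sqrt (dot (F 0%nat 1%nat u v) (F 0%nat 1%nat u v))) 0 s).
    { apply smooth2_at_sqrt; [now apply vsmooth2_at_dot|easy]. }
    apply smooth2_at_mult; [apply smooth2_at_plus; [|apply smooth2_at_const]|easy].
    apply smooth2_at_pow, smooth2_at_div; [now apply vsmooth2_at_det3|now apply smooth2_at_pow|].
    now apply pow_nonzero, Rgt_not_eq, sqrt_lt_R0.
  - intros t s Ht Hs.
    destruct (partials_vDerive3 e d L c G F t s P Ht ltac:(lra)) as (E0 & E1 & E2 & _).
    unfold geodesic_curvature, speed, vnorm; now rewrite E0, E1, E2.
  - intros s Hs; destruct (HF s Hs) as (HFr & Dk & Dk1 & _).
    assert (O := proj1 HFr); assert (Dn := proj2 (proj2 HFr)).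
    assert (DB := frame_binormal _ _ _ _ HFr).
    assert (DV : forall j, vis_derive (F 1%nat j 0) s (F 1%nat (S j) 0 s)).
    { intros j; apply (partials_s _ _ _ _ _ _ P); [easy|lra]. }
    assert (Dt : forall j, vis_derive (fun u => F 0%nat j u s) 0 (F 1%nat j 0 s)).
    { intros j; apply (partials_t _ _ _ _ _ _ P); [easy|lra]. }
    assert (Da := vis_derive_dot _ _ _ _ _ (Dt 1%nat) (Dt 1%nat)).
    assert (DD := vis_derive_det3 _ _ _ _ _ _ _ (Dt 0%nat) (Dt 1%nat) (Dt 2%nat)).
    assert (A0 : dot (F 0%nat 1%nat 0 s) (F 0%nat 1%nat 0 s) = 1).
    { rewrite (HB 1%nat) by (lia || easy); apply O. }
    assert (D0 : det3 (F 0%nat 0%nat 0 s) (F 0%nat 1%nat 0 s) (F 0%nat 2%nat 0 s) = k s).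
    { rewrite (HB 0%nat), (HB 1%nat), (HB 2%nat) by (lia || easy).
      destruct (orthonormal_cross _ _ O) as (_ & _ & X1 & X2 & X3).
      unfold det3; rewrite dot_comb_r, !(dot_comm (cross _ _)), X1, X2, X3; ring. }
    eexists; split.
    { exact (is_derive_spherical_density l (k s) _ _ _ _ Da DD A0 D0). }
    eapply is_derive_eq.
    { apply is_derive_Rminus; [apply is_derive_Rplus|].
      - apply (is_derive_Rmult (fun _ => 2)); [apply (is_derive_const 2)|].
        apply is_derive_Rmult; [exact Dk|].
        exact (vis_derive_dot _ _ _ _ _ DB (DV 1%nat)).
      - apply is_derive_Rmult; [|exact (vis_derive_dot _ _ _ _ _ Dn (DV 0%nat))].
        apply is_derive_Rminus; [apply (is_derive_const l)|].
        exact (is_derive_Rmult _ _ _ _ _ Dk Dk).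
      - apply (is_derive_Rmult (fun _ => 2)); [apply (is_derive_const 2)|].
        apply is_derive_Rmult; [exact Dk1|].
        exact (vis_derive_dot _ _ _ _ _ DB (DV 0%nat)). }
    rewrite (HB 0%nat), (HB 1%nat), (HB 2%nat) by (lia || easy).
    (* The determinants are rotated so that the varied argument is paired with a cross product of
       base vectors, which is then expanded in the frame. *)
    rewrite (det3_cycle (F _ _ _ _)), (det3_cycle' (c s)).
    change (det3 (c s) (n s) (F 1%nat 2%nat 0 s))
      with (dot (cross (c s) (n s)) (F 1%nat 2%nat 0 s)).
    assert (K := HT s Hs).
    assert (X1 : cross (n s) (comb (c s) (n s) (-1) 0 (k s)) = comb (c s) (n s) (k s) 0 1).
    { replace (n s) with (comb (c s) (n s) 0 1 0) at 1 by (unfold comb; vec_ring).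
      rewrite cross_comb by easy; f_equal; ring. }
    assert (X2 : cross (comb (c s) (n s) (-1) 0 (k s)) (c s) = comb (c s) (n s) 0 (k s) 0).
    { replace (c s) with (comb (c s) (n s) 1 0 0) at 2 by (unfold comb; vec_ring).
      rewrite cross_comb by easy; f_equal; ring. }
    rewrite X1, X2, !dot_vscal_l.
    rewrite (dot_comm (comb _ _ _ _ _) (F _ _ _ _)), !dot_comb_r.
    rewrite (dot_comm (F _ _ _ _) (c s)), K, !(dot_comm (F _ _ _ _)).
    unfold zero; simpl; field.
  - intros s Hs; destruct (HF s Hs) as (HFr & Dk & Dk1 & Ck2).
    assert (Ck : continuous k s) by (apply (ex_derive_continuous k s); now exists (k1 s)).
    assert (DB := frame_binormal _ _ _ _ HFr).
    assert (DV : vis_derive (F 1%nat 0%nat 0) s (F 1%nat 1%nat 0 s)).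
    { apply (partials_s _ _ _ _ _ _ P); [easy|lra]. }
    apply (continuous_mult (K := R_AbsRing)).
    + apply (continuous_plus (V := R_NormedModule));
        [apply (continuous_plus (V := R_NormedModule))|].
      * apply (continuous_mult (K := R_AbsRing)); [apply continuous_const|easy].
      * apply (ex_derive_continuous (fun s => k s ^ 3) s).
        eexists; apply (is_derive_pow k 3 s _ Dk).
      * apply (continuous_mult (K := R_AbsRing)); [apply continuous_const|easy].
    + apply (ex_derive_continuous (fun s => dot (cross (c s) (n s)) (F 1%nat 0%nat 0 s)) s).
      eexists; exact (vis_derive_dot _ _ _ _ _ DB DV).
  - destruct (partials_end _ _ _ _ _ _ P 0%nat) as [-> _].
    destruct (partials_end _ _ _ _ _ _ P 1%nat) as [-> _].
    rewrite !dot_vzero_r; ring.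
  - destruct (partials_end _ _ _ _ _ _ P 0%nat) as [_ ->].
    destruct (partials_end _ _ _ _ _ _ P 1%nat) as [_ ->].
    rewrite !dot_vzero_r; ring.
Qed.

(** * Elasticity of spherical curves as a differential equation *)

(** The neighbourhoods of 0 and L supply the enlargement; in between the property holds at each
    point. *)
Lemma locally_enlarge (P : R -> Prop) (L : R) :
  0 <= L -> (forall s, 0 <= s <= L -> locally s P) ->
  exists d, 0 < d /\ forall s, - d < s < L + d -> P s.
Proof.
  intros HL H.
  destruct (H 0) as [d0 H0]; [lra|]; destruct (H L) as [d1 H1]; [lra|].
  exists (Rmin d0 d1); split; [apply Rmin_glb_lt; apply cond_pos|].
  assert (M1 := Rmin_l d0 d1); assert (M2 := Rmin_r d0 d1).
  intros s Hs.
  destruct (Rlt_le_dec s 0) as [Ha|Ha].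
  - apply H0; apply Rabs_def1; unfold minus, plus, opp; simpl; lra.
  - destruct (Rle_lt_dec s L) as [Hb|Hb].
    + apply (locally_singleton s P), H; lra.
    + apply H1; apply Rabs_def1; unfold minus, plus, opp; simpl; lra.
Qed.

Lemma regular_neighbourhood (L : R) (c : R -> vec) :
  0 < L -> smooth_curve L c -> (forall s, 0 <= s <= L -> speed c s <> 0) ->
  exists d, 0 < d /\ forall s, - d < s < L + d -> vsmooth_at c s /\ speed c s <> 0.
Proof.
  intros HL Hc Hs.
  destruct (proj1 (smooth_curve_vsmooth_at L c) Hc) as (d & Hd & Hsm).
  apply locally_enlarge; [lra|]; intros s Is; apply filter_and.
  - apply (locally_interval _ _ (- d) (L + d)); simpl; [lra|lra|].
    intros u Hu1 Hu2; apply Hsm; split; [exact Hu1|exact Hu2].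
  - assert (K : smooth_at (fun u => speed c u) s).
    { apply vsmooth_at_vnorm; [|now apply Hs]; apply vsmooth_at_vDerive, Hsm; lra. }
    exact (smooth_at_continuous _ _ K _ (locally_neq_0 _ (Hs s Is))).
Qed.

Lemma spherical_elastic_of_ode (l L : R) (c : R -> vec) :
  0 < L -> smooth_curve L c ->
  (forall s, 0 <= s <= L -> vnorm (c s) = 1 /\ speed c s = 1) ->
  (forall s, 0 <= s <= L ->
     2 * Derive (Derive (geodesic_curvature c)) s + geodesic_curvature c s ^ 3 +
     (2 - l) * geodesic_curvature c s = 0) ->
  spherical_elastic l L c.
Proof.
  intros HL Hc H HE; split; [|split].
  - split; [easy|]; intros s Hs; destruct (H s Hs) as [? ->]; split; [easy|lra].
  - intros s Hs; apply H, Hs.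
  - destruct (proj1 (smooth_curve_vsmooth_at L c) Hc) as (d & Hd & Hsm).
    intros G HG HGs.
    set (k := geodesic_curvature c).
    destruct (spherical_first_variation l L c (vDerive c) k (Derive k) (Derive (Derive k)) G HL)
      as (V & _ & HV); [|easy|easy|].
    + intros s Hs.
      assert (K : smooth_at k s).
      { apply geodesic_curvature_smooth_at; [apply Hsm; lra|].
        rewrite (proj2 (H s Hs)); lra. }
      assert (K1 := smooth_at_Derive _ _ K); assert (K2 := smooth_at_Derive _ _ K1).
      split; [now apply (unit_speed_frame L)|].
      split; [now apply smooth_at_is_derive|split; [now apply smooth_at_is_derive|]].
      now apply smooth_at_continuous.
    + eapply is_derive_eq; [exact HV|].
      rewrite (RInt_ext _ (fun _ => 0)).
      * rewrite RInt_const; apply Rmult_0_r.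
      * intros s; rewrite Rmin_left, Rmax_right by lra; intros Hs.
        unfold k; rewrite HE by lra; apply Rmult_0_l.
Qed.

Lemma vsmooth2_at_comb (t n : R -> R -> vec) (a b c : R -> R -> R) (u s : R) :
  vsmooth2_at t u s -> vsmooth2_at n u s -> smooth2_at a u s -> smooth2_at b u s -> smooth2_at c u s ->
  vsmooth2_at (fun x y => comb (t x y) (n x y) (a x y) (b x y) (c x y)) u s.
Proof.
  intros T N A B C; apply vsmooth2_at_vadd; [now apply vsmooth2_at_vscal|].
  apply vsmooth2_at_vadd; [now apply vsmooth2_at_vscal|].
  apply vsmooth2_at_vscal; [easy|now apply vsmooth2_at_cross].
Qed.

Lemma ode_of_spherical_elastic (l L : R) (c : R -> vec) :
  0 < L -> spherical_elastic l L c ->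
  forall s, 0 <= s <= L ->
     2 * Derive (Derive (geodesic_curvature c)) s + geodesic_curvature c s ^ 3 +
     (2 - l) * geodesic_curvature c s = 0.
Proof.
  intros HL ((Hc & Hn) & Hsp & Hcrit).
  assert (H : forall s, 0 <= s <= L -> vnorm (c s) = 1 /\ speed c s = 1).
  { intros s Hs; split; [apply Hn, Hs|apply Hsp, Hs]. }
  destruct (regular_neighbourhood L c HL Hc) as (d & Hd & Hreg).
  { intros s Hs; rewrite Hsp by easy; lra. }
  set (k := geodesic_curvature c).
  assert (Hk : forall s, - d < s < L + d -> smooth_at k s).
  { intros s Hs; destruct (Hreg s Hs); now apply geodesic_curvature_smooth_at. }
  set (E := fun s => 2 * Derive (Derive k) s + k s ^ 3 + (2 - l) * k s).
  assert (HE : forall s, - d < s < L + d -> smooth_at E s).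
  { intros s Hs; assert (K := Hk s Hs).
    apply smooth_at_plus; [apply smooth_at_plus|].
    - apply smooth_at_mult; [apply smooth_at_const|now apply smooth_at_Derive, smooth_at_Derive].
    - now apply smooth_at_pow.
    - apply smooth_at_mult; [apply smooth_at_const|easy]. }
  assert (Hfr := unit_speed_frame L c HL Hc H); fold k in Hfr.
  assert (E0 : forall s, 0 < s < L -> E s = 0).
  { apply fundamental_lemma; [easy|intros s Hs; apply smooth_at_continuous, HE; lra|].
    intros bump r Hr Hb Hb0.
    set (phi := fun s => bump s * E s).
    assert (Hphi : forall s, - d < s < L + d -> smooth_at phi s).
    { intros s Hs; apply smooth_at_mult; [apply Hb|now apply HE]. }
    (* Each point is rotated by the angle t phi in the plane of c and B: the norm stays 1 and the
       velocity at t = 0 is phi B. *)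
    set (G := fun t s => comb (c s) (vDerive c s) (cos (t * phi s)) 0 (sin (t * phi s))).
    assert (HG : forall t s, - d < s < L + d -> vsmooth2_at G t s).
    { intros t s Hs; destruct (Hreg s Hs) as [Hcs _].
      assert (A : smooth2_at (fun t s => t * phi s) t s).
      { apply smooth2_at_mult; [apply smooth2_at_fst|now apply smooth2_at_of_smooth_at, Hphi]. }
      apply (vsmooth2_at_comb (fun _ s => c s) (fun _ s => vDerive c s)).
      - now apply vsmooth2_at_of_vsmooth_at.
      - now apply vsmooth2_at_of_vsmooth_at, vsmooth_at_vDerive.
      - apply (smooth2_at_comp cos); [apply smooth_at_cos_sin|easy].
      - apply smooth2_at_const.
      - apply (smooth2_at_comp sin); [apply smooth_at_cos_sin|easy]. }
    assert (G0 : forall t s, t * phi s = 0 -> G t s = c s).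
    { intros t s Z; unfold G; rewrite Z, cos_0, sin_0; unfold comb; vec_ring. }
    assert (Hvar : variation L c G).
    { exists 1; split; [lra|split; [|split]].
      - repeat split; apply smooth2_intro with d; try easy;
          intros t s _ Hs; apply (HG t s Hs).
      - intros s _; apply G0; ring.
      - exists r; split; [easy|]; intros t s _ Hs Hor; apply G0.
        unfold phi; rewrite Hb0 by easy; ring. }
    assert (Hsph : locally 0 (fun t => spherical_curve L (G t))).
    { destruct (locally_2d_tube (fun t s => speed (G t) s <> 0) 0 0 L) as [e He].
      - intros s Hs.
        assert (S : vsmooth2_at (fun t s => vDerive (G t) s) 0 s).
        { destruct (HG 0 s) as (X & Y & Z); [lra|].
          split; [|split]; [apply (smooth2_at_Derive_snd _ _ _ X)|apply (smooth2_at_Derive_snd _ _ _ Y)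
                           |apply (smooth2_at_Derive_snd _ _ _ Z)]. }
        assert (S0 : speed (G 0) s = 1).
        { rewrite <- (Hsp s Hs); unfold speed; f_equal.
          apply vec_ext; apply Derive_ext; intros u; rewrite G0; try easy; ring. }
        apply (continuity_2d_pt_neq_0 (fun t s => speed (G t) s)).
        + apply smooth2_at_continuity, (vsmooth2_at_vnorm _ _ _ S).
          unfold speed in S0; rewrite S0; lra.
        + rewrite S0; lra.
      - exists e; intros t Ht; split.
        + apply smooth_curve_vsmooth_at; exists d; split; [easy|].
          intros s Hs; now apply (vsmooth_at_of_vsmooth2_at G), HG.
        + intros s Hs; split.
          * destruct (Hfr s Hs) as [O _].
            apply vnorm_1; unfold G; rewrite dot_comb by easy.
            assert (K := sin2_cos2 (t * phi s)); unfold Rsqr in K; lra.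
          * apply He; [exact Ht|easy]. }
    destruct (spherical_first_variation l L c (vDerive c) k (Derive k) (Derive (Derive k)) G)
      as (V & HV & HD); [easy| |easy|easy|].
    { intros s Hs; assert (K : smooth_at k s) by (apply Hk; lra).
      assert (K1 := smooth_at_Derive _ _ K); assert (K2 := smooth_at_Derive _ _ K1).
      split; [now apply Hfr|].
      split; [now apply smooth_at_is_derive|split; [now apply smooth_at_is_derive|]].
      now apply smooth_at_continuous. }
    eapply eq_trans; [|exact (is_derive_unique2 _ _ _ _ HD (Hcrit G Hvar Hsph))].
    apply RInt_ext; intros s; rewrite Rmin_left, Rmax_right by lra; intros Hs.
    assert (Hs' : 0 <= s <= L) by lra.
    destruct (orthonormal_cross _ _ (proj1 (Hfr s Hs'))) as (_ & _ & X3 & X4 & X5).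
    assert (DV : vis_derive (fun t => G t s) 0
                   (vscal (phi s) (cross (c s) (vDerive c s)))).
    { destruct (HG 0 s) as (X & Y & Z); [lra|].
      split; [|split]; unfold G, comb; simpl; auto_derive; try easy;
        rewrite Rmult_0_l, cos_0, sin_0; ring. }
    rewrite <- (vis_derive_unique _ _ _ (HV s Hs')), (vis_derive_unique _ _ _ DV).
    rewrite dot_vscal_r, X3; now rewrite Rmult_1_r. }
  intros s Hs; change (E s = 0).
  (* The fundamental lemma reaches interior points only. A nonzero value at an end point would
     persist, by continuity, at some interior point. *)
  destruct (Req_dec s 0) as [Z|Z].
  2: destruct (Req_dec s L) as [Z'|Z'].
  3: apply E0; lra.
  all: assert (C : continuous E s) by (apply smooth_at_continuous, HE; lra).
  all: apply NNPP; intros N.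
  all: destruct (C _ (locally_neq_0 _ N)) as [e He].
  all: assert (Hm : 0 < Rmin (e / 2) (L / 2))
         by (apply Rmin_glb_lt; [assert (Q := cond_pos e)|]; lra).
  all: assert (M1 := Rmin_l (e / 2) (L / 2)); assert (M2 := Rmin_r (e / 2) (L / 2)).
  - apply (He (Rmin (e / 2) (L / 2))).
    + apply Rabs_def1; unfold minus, plus, opp; simpl; lra.
    + apply E0; lra.
  - apply (He (L - Rmin (e / 2) (L / 2))).
    + apply Rabs_def1; unfold minus, plus, opp; simpl; lra.
    + apply E0; lra.
Qed.

(** * Frenet data *)

Lemma curvature_cross (c : R -> vec) (s : R) : curvature c s <> 0 ->
  vnorm (cross (vDerive c s) (vDerive (vDerive c) s)) <> 0.
Proof. unfold curvature; intros H Z; apply H; rewrite Z; unfold Rdiv; ring. Qed.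

Lemma speed_smooth_at (c : R -> vec) (s : R) :
  vsmooth_at c s -> speed c s <> 0 -> smooth_at (speed c) s.
Proof. intros H Hs; apply vsmooth_at_vnorm; [now apply vsmooth_at_vDerive|easy]. Qed.

Lemma curvature_smooth_at (c : R -> vec) (s : R) :
  vsmooth_at c s -> speed c s <> 0 -> curvature c s <> 0 -> smooth_at (curvature c) s.
Proof.
  intros H Hs Hk; assert (H1 := vsmooth_at_vDerive _ _ H); assert (H2 := vsmooth_at_vDerive _ _ H1).
  apply smooth_at_div.
  - apply vsmooth_at_vnorm; [now apply vsmooth_at_cross|now apply curvature_cross].
  - now apply smooth_at_pow, speed_smooth_at.
  - now apply pow_nonzero.
Qed.

Lemma mod_torsion_smooth_at (c : R -> vec) (s : R) :
  vsmooth_at c s -> speed c s <> 0 -> curvature c s <> 0 -> smooth_at (mod_torsion c) s.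
Proof.
  intros H Hs Hk; assert (H1 := vsmooth_at_vDerive _ _ H); assert (H2 := vsmooth_at_vDerive _ _ H1).
  assert (H3 := vsmooth_at_vDerive _ _ H2).
  apply smooth_at_div; [|now apply curvature_smooth_at|easy].
  apply smooth_at_div.
  - now apply vsmooth_at_det3.
  - apply smooth_at_pow, vsmooth_at_vnorm; [now apply vsmooth_at_cross|now apply curvature_cross].
  - now apply pow_nonzero, curvature_cross.
Qed.

Lemma arc_derive_smooth_at (c : R -> vec) (f : R -> R) (s : R) :
  vsmooth_at c s -> speed c s <> 0 -> smooth_at f s -> smooth_at (arc_derive c f) s.
Proof.
  intros H Hs Hf; apply smooth_at_div; [now apply smooth_at_Derive|now apply speed_smooth_at|easy].
Qed.

(** For use with [f] a geometric quantity, smooth as a germ, and [g] a closed formula that is valid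
    for it on [0, L] only. *)
Lemma Derive_Icc (L : R) (f g : R -> R) (s g' : R) :
  0 < L -> 0 <= s <= L -> smooth_at f s -> (forall u, 0 <= u <= L -> f u = g u) ->
  is_derive g s g' -> Derive f s = g'.
Proof.
  intros HL Hs Hf He Hg.
  exact (is_derive_unique_Icc 0 L f g s _ _ HL Hs (smooth_at_is_derive _ _ Hf) Hg He).
Qed.

Lemma frame_comb (t n : R -> vec) (k a b c : R -> R) (s a' b' c' : R) :
  frame_at t n k s -> is_derive a s a' -> is_derive b s b' -> is_derive c s c' ->
  vis_derive (fun u => comb (t u) (n u) (a u) (b u) (c u)) s
    (comb (t s) (n s) (a' - b s) (b' + a s - k s * c s) (c' + k s * b s)).
Proof.
  intros HF Ha Hb Hc; assert (DB := frame_binormal _ _ _ _ HF).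
  destruct HF as (O & Dt & Dn).
  eapply vis_derive_eq.
  - exact (vis_derive_vadd _ _ _ _ _ (vis_derive_vscal _ _ _ _ _ Ha Dt)
      (vis_derive_vadd _ _ _ _ _ (vis_derive_vscal _ _ _ _ _ Hb Dn)
        (vis_derive_vscal _ _ _ _ _ Hc DB))).
  - unfold comb; generalize (cross (t s) (n s)); vec_ring.
Qed.

(** * The first variation of the Sadowsky functional *)

(* The values at 0 are those of the strip curve: speed 1 + k^2, curvature
   1 / (1 + k^2) and modified torsion k. *)
Lemma is_derive_sadowsky_density (k v a' w' D' : R) (a w D : R -> R) :
  is_derive a 0 a' -> is_derive w 0 w' -> is_derive D 0 D' -> v = 1 + k ^ 2 ->
  a 0 = v ^ 2 -> w 0 = v ^ 4 -> D 0 = v ^ 3 * k ->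
  is_derive (fun u => ((sqrt (w u) / sqrt (a u) ^ 3) ^ 2 *
      (1 + (D u / sqrt (w u) ^ 2 / (sqrt (w u) / sqrt (a u) ^ 3)) ^ 2) ^ 2 - -1) *
      sqrt (a u)) 0
    ((8 * k ^ 2 - 4) / v * (a' / (2 * v)) + (1 - 5 * k ^ 2) / v ^ 4 * w' +
     4 * k / v ^ 3 * D').
Proof.
  intros Ha Hw HD Hv Ha0 Hw0 HD0.
  assert (Hp : 0 < v) by nra.
  assert (Sa0 : sqrt (a 0) = v) by (rewrite Ha0; apply sqrt_pow2; lra).
  assert (Sw0 : sqrt (w 0) = v ^ 2).
  { rewrite Hw0; replace (v ^ 4) with ((v ^ 2) ^ 2) by ring; apply sqrt_pow2; nra. }
  assert (Sa : is_derive (fun u => sqrt (a u)) 0 (a' / (2 * v))).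
  { eapply is_derive_eq; [apply (is_derive_sqrt a 0 a'); [easy|]|now rewrite Sa0].
    rewrite Ha0; now apply pow_lt. }
  assert (Sw : is_derive (fun u => sqrt (w u)) 0 (w' / (2 * v ^ 2))).
  { eapply is_derive_eq; [apply (is_derive_sqrt w 0 w'); [easy|]|now rewrite Sw0].
    rewrite Hw0; now apply pow_lt. }
  (* The functions x and y stand for the roots, that is for the norms of c' and c' x c'', and leave
     a rational expression to differentiate. *)
  assert (K : forall x y, is_derive x 0 (a' / (2 * v)) -> x 0 = v ->
    is_derive y 0 (w' / (2 * v ^ 2)) -> y 0 = v ^ 2 ->
    is_derive (fun u => ((y u / x u ^ 3) ^ 2 *
      (1 + (D u / y u ^ 2 / (y u / x u ^ 3)) ^ 2) ^ 2 - -1) * x u) 0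
    ((8 * k ^ 2 - 4) / v * (a' / (2 * v)) + (1 - 5 * k ^ 2) / v ^ 4 * w' +
     4 * k / v ^ 3 * D')); [|exact (K _ _ Sa Sa0 Sw Sw0)].
  clear Sa Sa0 Sw Sw0; intros x y Hx Hx0 Hy Hy0.
  assert (v <> 0) by lra.
  auto_derive.
  - rewrite ?Hx0, ?Hy0.
    repeat split; try (now exists D'); try (now exists (a' / (2 * v)));
      try (now exists (w' / (2 * v ^ 2))); try easy;
      try (repeat apply Rmult_integral_contrapositive_currified;
           try apply Rinv_neq_0_compat;
           repeat apply Rmult_integral_contrapositive_currified; lra).
  - rewrite (is_derive_unique _ _ _ HD : Derive (fun x => D x) 0 = D').
    rewrite (is_derive_unique _ _ _ Hx : Derive (fun u => x u) 0 = _).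
    rewrite (is_derive_unique _ _ _ Hy : Derive (fun u => y u) 0 = _).
    rewrite Hx0, Hy0, HD0; subst v; field.
    lra.
Qed.

(** With [k1] for k', the elastic equation 2 k'' + k^3 + k = 0 enters as a first order system. Every
    k'' is thus replaced as it arises, and the computations become rational in k and k1. *)
Record strip_frame (L : R) (t n : R -> vec) (k k1 : R -> R) (c : R -> vec) : Prop := {
  sf_L : 0 < L;
  sf_frame : forall s, 0 <= s <= L -> frame_at t n k s;
  sf_k : forall s, 0 <= s <= L -> is_derive k s (k1 s);
  sf_k1 : forall s, 0 <= s <= L -> is_derive k1 s (- (k s ^ 3 + k s) / 2);
  sf_sm : forall s, 0 <= s <= L -> vsmooth_at c s;
  sf_c : forall s, 0 <= s <= L -> vis_derive c s (vscal (1 + k s ^ 2) (t s)) }.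

(* The value at [j = 0] is junk. *)
Definition strip_jet (t n : R -> vec) (k k1 : R -> R) (j : nat) (s : R) : vec :=
  match j with
  | 1%nat => comb (t s) (n s) (1 + k s ^ 2) 0 0
  | 2%nat => comb (t s) (n s) (2 * k s * k1 s) (1 + k s ^ 2) 0
  | _ => comb (t s) (n s)
           (2 * k1 s ^ 2 - k s * (k s ^ 3 + k s) - (1 + k s ^ 2))
           (4 * k s * k1 s) ((1 + k s ^ 2) * k s)
  end.

Lemma strip_jet_derive L t n k k1 c :
  strip_frame L t n k k1 c -> forall j s, (1 <= j <= 2)%nat -> 0 <= s <= L ->
  vis_derive (strip_jet t n k k1 j) s (strip_jet t n k k1 (S j) s).
Proof.
  intros F j s Hj Hs.
  assert (HF := sf_frame _ _ _ _ _ _ F s Hs).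
  assert (Dk := sf_k _ _ _ _ _ _ F s Hs); assert (Dk1 := sf_k1 _ _ _ _ _ _ F s Hs).
  assert (Dv : is_derive (fun u => 1 + k u ^ 2) s (2 * k s * k1 s)).
  { eapply is_derive_eq.
    - apply is_derive_Rplus; [apply (is_derive_const 1)|exact (is_derive_pow k 2 s _ Dk)].
    - unfold zero; simpl; ring. }
  destruct j as [|[|[|j]]]; [lia| | |lia].
  - eapply vis_derive_eq.
    + apply (frame_comb t n k _ (fun _ => 0) (fun _ => 0) s _ 0 0 HF Dv);
        apply (is_derive_const 0).
    + simpl; f_equal; ring.
  - eapply vis_derive_eq.
    + eapply (frame_comb t n k (fun u => 2 * k u * k1 u) (fun u => 1 + k u ^ 2)
        (fun _ => 0) s _ _ 0 HF); [|exact Dv|apply (is_derive_const 0)].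
      apply is_derive_Rmult; [|exact Dk1].
      apply (is_derive_Rmult (fun _ => 2)); [apply (is_derive_const 2)|exact Dk].
    + unfold zero; simpl; f_equal; field.
Qed.

Lemma strip_jet_vDerive L t n k k1 c :
  strip_frame L t n k k1 c -> forall s, 0 <= s <= L ->
  vDerive c s = strip_jet t n k k1 1 s /\
  vDerive (vDerive c) s = strip_jet t n k k1 2 s /\
  vDerive (vDerive (vDerive c)) s = strip_jet t n k k1 3 s.
Proof.
  intros F; assert (HL := sf_L _ _ _ _ _ _ F).
  assert (H1 : forall s, 0 <= s <= L -> vDerive c s = strip_jet t n k k1 1 s).
  { intros s Hs; rewrite (vis_derive_unique _ _ _ (sf_c _ _ _ _ _ _ F s Hs)).
    unfold strip_jet, comb; vec_ring. }
  assert (H2 : forall s, 0 <= s <= L -> vDerive (vDerive c) s = strip_jet t n k k1 2 s).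
  { intros s Hs.
    apply (vis_derive_unique_Icc 0 L (vDerive c) (strip_jet t n k k1 1) s); try easy.
    - apply vsmooth_at_vis_derive, vsmooth_at_vDerive, (sf_sm _ _ _ _ _ _ F s Hs).
    - apply (strip_jet_derive L t n k k1 c F 1); [lia|easy]. }
  intros s Hs; split; [auto|split; [auto|]].
  apply (vis_derive_unique_Icc 0 L (vDerive (vDerive c)) (strip_jet t n k k1 2) s); try easy.
  - apply vsmooth_at_vis_derive, vsmooth_at_vDerive, vsmooth_at_vDerive, (sf_sm _ _ _ _ _ _ F s Hs).
  - apply (strip_jet_derive L t n k k1 c F 2); [lia|easy].
Qed.

Lemma strip_jet_values (t n : R -> vec) (k k1 : R -> R) (s : R) :
  orthonormal (t s) (n s) ->
  dot (strip_jet t n k k1 1 s) (strip_jet t n k k1 1 s) = (1 + k s ^ 2) ^ 2 /\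
  cross (strip_jet t n k k1 1 s) (strip_jet t n k k1 2 s) =
    comb (t s) (n s) 0 0 ((1 + k s ^ 2) ^ 2) /\
  dot (cross (strip_jet t n k k1 1 s) (strip_jet t n k k1 2 s))
      (cross (strip_jet t n k k1 1 s) (strip_jet t n k k1 2 s)) = (1 + k s ^ 2) ^ 4 /\
  det3 (strip_jet t n k k1 1 s) (strip_jet t n k k1 2 s) (strip_jet t n k k1 3 s) =
    (1 + k s ^ 2) ^ 3 * k s.
Proof.
  intros O; assert (X : cross (strip_jet t n k k1 1 s) (strip_jet t n k k1 2 s) =
    comb (t s) (n s) 0 0 ((1 + k s ^ 2) ^ 2)).
  { unfold strip_jet; rewrite cross_comb by easy; f_equal; ring. }
  unfold det3; rewrite X; repeat split; unfold strip_jet; rewrite dot_comb by easy; ring.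
Qed.

Lemma strip_frenet L t n k k1 c :
  strip_frame L t n k k1 c -> forall s, 0 <= s <= L ->
  speed c s = 1 + k s ^ 2 /\ curvature c s = / (1 + k s ^ 2) /\ mod_torsion c s = k s.
Proof.
  intros F s Hs.
  destruct (strip_jet_vDerive L t n k k1 c F s Hs) as (E1 & E2 & E3).
  destruct (strip_jet_values t n k k1 s) as (V1 & V2 & V3 & V4).
  { apply (sf_frame _ _ _ _ _ _ F s Hs). }
  assert (Hp : 0 < 1 + k s ^ 2) by nra.
  assert (S1 : speed c s = 1 + k s ^ 2).
  { unfold speed, vnorm; rewrite E1, V1; apply sqrt_pow2; lra. }
  assert (S2 : vnorm (cross (vDerive c s) (vDerive (vDerive c) s)) = (1 + k s ^ 2) ^ 2).
  { unfold vnorm; rewrite E1, E2, V3.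
    replace ((1 + k s ^ 2) ^ 4) with (((1 + k s ^ 2) ^ 2) ^ 2) by ring.
    apply sqrt_pow2, pow2_ge_0. }
  assert (S3 : curvature c s = / (1 + k s ^ 2)).
  { unfold curvature; rewrite S1, S2; field; lra. }
  split; [easy|split; [easy|]].
  unfold mod_torsion, torsion; rewrite S2, S3, E1, E2, E3, V4; field; lra.
Qed.

Lemma dot_cross_swap_1 (x p y : vec) : dot x (cross p y) = dot p (cross y x).
Proof. vec_ring. Qed.

Lemma dot_cross_swap_2 (x p y : vec) : dot x (cross y p) = dot p (cross x y).
Proof. vec_ring. Qed.

(** The Euler-Lagrange part is identically zero and everything is boundary term. With [P] =
    [F 1 1 0] the boundary term contains [P] and [P'] = [F 1 2 0], both of which vanish at the
    ends. *)
Lemma strip_first_variation L t n k k1 c G :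
  strip_frame L t n k k1 c -> variation L c G ->
  is_derive (fun u => sadowsky (-1) L (G u)) 0 0.
Proof.
  intros SF HG; assert (HL := sf_L _ _ _ _ _ _ SF).
  destruct (variation_partials L c G HL HG) as (e & d & F & P).
  assert (He := partials_e _ _ _ _ _ _ P); assert (Hd := partials_d _ _ _ _ _ _ P).
  assert (He0 : Rabs 0 < e) by now rewrite Rabs_R0.
  (* As [strip_jet] has no meaningful value at index 0, the tower of derivatives starts with [c]
     itself. *)
  assert (HB : forall j s, (1 <= j <= 3)%nat -> 0 <= s <= L ->
            F 0%nat j 0 s = strip_jet t n k k1 j s).
  { intros j s Hj Hs.
    rewrite (partials_base e d L c G F
      (fun j => match j with O => c | S _ => strip_jet t n k k1 j end) HL P
      ltac:(easy) j); [destruct j; [lia|easy]| |easy].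
    intros [|i] u Hi Hu; [|now apply (strip_jet_derive L t n k k1 c SF); [lia|]].
    eapply vis_derive_eq; [exact (sf_c _ _ _ _ _ _ SF u Hu)|].
    unfold strip_jet, comb; vec_ring. }
  eapply is_derive_eq.
  1: apply (is_derive_RInt_primitive
    (fun u s =>
      ((sqrt (dot (cross (F 0%nat 1%nat u s) (F 0%nat 2%nat u s))
                  (cross (F 0%nat 1%nat u s) (F 0%nat 2%nat u s))) /
        sqrt (dot (F 0%nat 1%nat u s) (F 0%nat 1%nat u s)) ^ 3) ^ 2 *
       (1 + (det3 (F 0%nat 1%nat u s) (F 0%nat 2%nat u s) (F 0%nat 3%nat u s) /
         sqrt (dot (cross (F 0%nat 1%nat u s) (F 0%nat 2%nat u s))
                   (cross (F 0%nat 1%nat u s) (F 0%nat 2%nat u s))) ^ 2 /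
         (sqrt (dot (cross (F 0%nat 1%nat u s) (F 0%nat 2%nat u s))
                    (cross (F 0%nat 1%nat u s) (F 0%nat 2%nat u s))) /
          sqrt (dot (F 0%nat 1%nat u s) (F 0%nat 1%nat u s)) ^ 3)) ^ 2) ^ 2 - -1) *
      sqrt (dot (F 0%nat 1%nat u s) (F 0%nat 1%nat u s))) _
    (fun s => 4 * k s / (1 + k s ^ 2) * dot (cross (t s) (n s)) (F 1%nat 2%nat 0 s) +
              (2 - 2 * k s ^ 2) / (1 + k s ^ 2) * dot (n s) (F 1%nat 1%nat 0 s) -
              4 * k1 s * (1 + 3 * k s ^ 2) / (1 + k s ^ 2) ^ 2 *
                dot (cross (t s) (n s)) (F 1%nat 1%nat 0 s)) (fun _ => 0) L e);
    try easy.
  - intros s Hs.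
    assert (S : forall j, vsmooth2_at (F 0%nat j) 0 s).
    { intros j; apply (partials_sm _ _ _ _ _ _ P); [easy|lra]. }
    destruct (strip_jet_values t n k k1 s) as (V1 & V2 & V3 & V4).
    { apply (sf_frame _ _ _ _ _ _ SF s Hs). }
    rewrite <- (HB 1%nat) in V1, V3 by (lia || easy).
    rewrite <- (HB 2%nat) in V3 by (lia || easy).
    assert (Hv : 0 < 1 + k s ^ 2) by nra.
    assert (Pa : 0 < dot (F 0%nat 1%nat 0 s) (F 0%nat 1%nat 0 s))
      by (rewrite V1; now apply pow_lt).
    assert (Pw : 0 < dot (cross (F 0%nat 1%nat 0 s) (F 0%nat 2%nat 0 s))
                         (cross (F 0%nat 1%nat 0 s) (F 0%nat 2%nat 0 s)))
      by (rewrite V3; now apply pow_lt).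
    assert (Sa : smooth2_at (fun u s => sqrt (dot (F 0%nat 1%nat u s) (F 0%nat 1%nat u s))) 0 s).
    { apply smooth2_at_sqrt; [now apply vsmooth2_at_dot|easy]. }
    assert (Sw : smooth2_at (fun u s => sqrt (dot (cross (F 0%nat 1%nat u s) (F 0%nat 2%nat u s))
                              (cross (F 0%nat 1%nat u s) (F 0%nat 2%nat u s)))) 0 s).
    { apply smooth2_at_sqrt; [apply vsmooth2_at_dot; now apply vsmooth2_at_cross|easy]. }
    apply sqrt_lt_R0 in Pa, Pw.
    assert (Sc : smooth2_at (fun u s => sqrt (dot (cross (F 0%nat 1%nat u s) (F 0%nat 2%nat u s))
                              (cross (F 0%nat 1%nat u s) (F 0%nat 2%nat u s))) /
               sqrt (dot (F 0%nat 1%nat u s) (F 0%nat 1%nat u s)) ^ 3) 0 s).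
    { apply smooth2_at_div; [easy|now apply smooth2_at_pow|now apply pow_nonzero, Rgt_not_eq]. }
    apply smooth2_at_mult; [|easy].
    apply smooth2_at_minus; [|apply smooth2_at_const].
    apply smooth2_at_mult; [now apply smooth2_at_pow|].
    apply smooth2_at_pow, smooth2_at_plus; [apply smooth2_at_const|apply smooth2_at_pow].
    apply smooth2_at_div; [|easy|].
    + apply smooth2_at_div; [now apply vsmooth2_at_det3|now apply smooth2_at_pow|].
      now apply pow_nonzero, Rgt_not_eq.
    + apply Rmult_integral_contrapositive_currified; [now apply Rgt_not_eq|].
      now apply Rinv_neq_0_compat, pow_nonzero, Rgt_not_eq.
  - intros u s Hu Hs.
    destruct (partials_vDerive3 e d L c G F u s P Hu ltac:(lra)) as (_ & E1 & E2 & E3).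
    unfold mod_torsion, torsion, curvature, speed, vnorm; now rewrite E1, E2, E3.
  - intros s Hs.
    assert (HF := sf_frame _ _ _ _ _ _ SF s Hs).
    assert (Dk := sf_k _ _ _ _ _ _ SF s Hs); assert (Dk1 := sf_k1 _ _ _ _ _ _ SF s Hs).
    assert (O := proj1 HF); assert (Dn := proj2 (proj2 HF)).
    assert (DB := frame_binormal _ _ _ _ HF).
    assert (DV : forall j, vis_derive (F 1%nat j 0) s (F 1%nat (S j) 0 s)).
    { intros j; apply (partials_s _ _ _ _ _ _ P); [easy|lra]. }
    assert (Dt : forall j, vis_derive (fun u => F 0%nat j u s) 0 (F 1%nat j 0 s)).
    { intros j; apply (partials_t _ _ _ _ _ _ P); [easy|lra]. }
    destruct (strip_jet_values t n k k1 s O) as (V1 & V2 & V3 & V4).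
    rewrite <- (HB 1%nat) in V1, V2, V3, V4 by (lia || easy).
    rewrite <- (HB 2%nat) in V2, V3, V4 by (lia || easy).
    rewrite <- (HB 3%nat) in V4 by (lia || easy).
    assert (Da := vis_derive_dot _ _ _ _ _ (Dt 1%nat) (Dt 1%nat)).
    assert (DW := vis_derive_cross _ _ _ _ _ (Dt 1%nat) (Dt 2%nat)).
    assert (Dw := vis_derive_dot _ _ _ _ _ DW DW).
    assert (DD := vis_derive_det3 _ _ _ _ _ _ _ (Dt 1%nat) (Dt 2%nat) (Dt 3%nat)).
    eexists; split.
    { exact (is_derive_sadowsky_density (k s) _ _ _ _ _ _ _ Da Dw DD eq_refl V1 V3 V4). }
    assert (Hv : 0 < 1 + k s ^ 2) by nra.
    assert (C1 : is_derive (fun u => 4 * k u / (1 + k u ^ 2)) s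
      (4 * k1 s / (1 + k s ^ 2) - 8 * k s ^ 2 * k1 s / (1 + k s ^ 2) ^ 2)).
    { auto_derive; [repeat split; try (now exists (k1 s)); simpl in Hv; lra|].
      rewrite (is_derive_unique _ _ _ Dk : Derive (fun x => k x) s = k1 s).
      field; simpl in Hv; lra. }
    assert (C2 : is_derive (fun u => (2 - 2 * k u ^ 2) / (1 + k u ^ 2)) s
      (- 8 * k s * k1 s / (1 + k s ^ 2) ^ 2)).
    { auto_derive; [repeat split; try (now exists (k1 s)); simpl in Hv; lra|].
      rewrite (is_derive_unique _ _ _ Dk : Derive (fun x => k x) s = k1 s).
      field; simpl in Hv; lra. }
    assert (C3 : is_derive (fun u => 4 * k1 u * (1 + 3 * k u ^ 2) / (1 + k u ^ 2) ^ 2) s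
      (- 2 * k s * (1 + 3 * k s ^ 2) / (1 + k s ^ 2) +
       8 * k s * k1 s ^ 2 * (1 - 3 * k s ^ 2) / (1 + k s ^ 2) ^ 3)).
    { auto_derive.
      - repeat split; try (now exists (k1 s)); try (eexists; exact Dk1); simpl in Hv; nra.
      - rewrite (is_derive_unique _ _ _ Dk : Derive (fun x => k x) s = k1 s).
        rewrite (is_derive_unique _ _ _ Dk1 : Derive (fun x => k1 x) s = _).
        field; simpl in Hv; lra. }
    eapply is_derive_eq.
    { apply is_derive_Rminus; [apply is_derive_Rplus|]; apply is_derive_Rmult.
      - exact C1.
      - exact (vis_derive_dot _ _ _ _ _ DB (DV 2%nat)).
      - exact C2.
      - exact (vis_derive_dot _ _ _ _ _ Dn (DV 1%nat)).
      - exact C3.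
      - exact (vis_derive_dot _ _ _ _ _ DB (DV 1%nat)). }
    (* Both sides are brought to combinations of inner products of frame vectors with [P], [P'] and
       [P'']; what remains is a rational identity in k, k1 and these components. *)
    rewrite (dot_comm (vadd (cross (F 1%nat 1%nat 0 s) _) _)), V2.
    rewrite (det3_cycle (F 1%nat 1%nat 0 s)), (det3_cycle' (F 0%nat 1%nat 0 s)).
    change (det3 (F 0%nat 1%nat 0 s) (F 0%nat 2%nat 0 s) (F 1%nat 3%nat 0 s))
      with (dot (cross (F 0%nat 1%nat 0 s) (F 0%nat 2%nat 0 s)) (F 1%nat 3%nat 0 s)).
    rewrite dot_vadd_r, (dot_cross_swap_1 _ (F 1%nat 1%nat 0 s)),
      (dot_cross_swap_2 _ (F 1%nat 2%nat 0 s)), V2.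
    rewrite (HB 1%nat), (HB 2%nat), (HB 3%nat) by (lia || easy); unfold strip_jet.
    rewrite !cross_comb by easy.
    rewrite !(dot_comm (comb _ _ _ _ _)), !dot_vscal_l, ?(dot_comm (comb _ _ _ _ _)).
    rewrite !dot_comb_r, !(dot_comm (F _ _ _ _)).
    field; lra.
  - intros; apply continuous_const.
  - destruct (partials_end _ _ _ _ _ _ P 1%nat) as [-> _].
    destruct (partials_end _ _ _ _ _ _ P 2%nat) as [-> _].
    rewrite !dot_vzero_r; ring.
  - destruct (partials_end _ _ _ _ _ _ P 1%nat) as [_ ->].
    destruct (partials_end _ _ _ _ _ _ P 2%nat) as [_ ->].
    rewrite !dot_vzero_r; ring.
  - rewrite RInt_const; apply Rmult_0_r.
Qed.

(** * Vanishing of the force along the strip curve *)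

(** On the strip curve kap (1 + lam^2) = 1. This annihilates the tangential component for mu = -1,
    and the normal one, which is 1 + lam^2 times the arclength derivative of that constant. In the
    binormal component the two terms under a derivative add up to 2 k', whose arclength derivative
    is - k by the elastic equation and cancels the remaining term. *)
Lemma strip_force L t n k k1 c :
  strip_frame L t n k k1 c -> forall s, 0 <= s <= L -> force (-1) c s = vzero.
Proof.
  intros F; assert (HL := sf_L _ _ _ _ _ _ F).
  assert (HS : forall u, 0 <= u <= L -> speed c u = 1 + k u ^ 2).
  { intros u Hu; apply (strip_frenet L t n k k1 c F u Hu). }
  assert (HK : forall u, 0 <= u <= L -> curvature c u = / (1 + k u ^ 2)).
  { intros u Hu; apply (strip_frenet L t n k k1 c F u Hu). }
  assert (HM : forall u, 0 <= u <= L -> mod_torsion c u = k u).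
  { intros u Hu; apply (strip_frenet L t n k k1 c F u Hu). }
  assert (Hv : forall u, 0 < 1 + k u ^ 2) by (intros u; nra).
  assert (Sc : forall u, 0 <= u <= L -> vsmooth_at c u) by apply F.
  assert (Ss : forall u, 0 <= u <= L -> speed c u <> 0).
  { intros u Hu; rewrite HS by easy; apply Rgt_not_eq, Hv. }
  assert (Sk0 : forall u, 0 <= u <= L -> curvature c u <> 0).
  { intros u Hu; rewrite HK by easy; apply Rinv_neq_0_compat, Rgt_not_eq, Hv. }
  assert (Sk : forall u, 0 <= u <= L -> smooth_at (curvature c) u).
  { intros u Hu; apply curvature_smooth_at; auto. }
  assert (Sm : forall u, 0 <= u <= L -> smooth_at (mod_torsion c) u).
  { intros u Hu; apply mod_torsion_smooth_at; auto. }
  assert (AK : forall u, 0 <= u <= L ->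
            arc_derive c (curvature c) u = - 2 * k u * k1 u / (1 + k u ^ 2) ^ 3).
  { intros u Hu; unfold arc_derive; rewrite HS by easy.
    assert (Dk := sf_k _ _ _ _ _ _ F u Hu); assert (P := Hv u); simpl in P.
    rewrite (Derive_Icc L _ _ u (- 2 * k u * k1 u / (1 + k u ^ 2) ^ 2)
      HL Hu (Sk u Hu) HK).
    - field; simpl in P; lra.
    - auto_derive; [repeat split; try (now exists (k1 u)); lra|].
      rewrite (is_derive_unique _ _ _ Dk : Derive (fun x => k x) u = k1 u).
      field; lra. }
  assert (AM : forall u, 0 <= u <= L ->
            arc_derive c (mod_torsion c) u = k1 u / (1 + k u ^ 2)).
  { intros u Hu; unfold arc_derive; rewrite HS by easy.
    now rewrite (Derive_Icc L _ _ u _ HL Hu (Sm u Hu) HM (sf_k _ _ _ _ _ _ F u Hu)). }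
  intros s Hs.
  assert (P := Hv s); assert (Dk := sf_k _ _ _ _ _ _ F s Hs).
  assert (Dk1 := sf_k1 _ _ _ _ _ _ F s Hs).
  assert (FT : force_T (-1) c s = 0).
  { unfold force_T; rewrite HK, HM by easy; field; lra. }
  assert (FN : force_N c s = 0).
  { unfold force_N; rewrite AK, AM, HK, HM by easy; field; lra. }
  assert (FB : force_B c s = 0).
  { unfold force_B.
    assert (I1 : Derive (fun u => arc_derive c (curvature c) u / curvature c u *
              (1 + mod_torsion c u ^ 2) * (2 * mod_torsion c u)) s =
              (2 * k s ^ 2 * (k s ^ 3 + k s) - 8 * k s * k1 s ^ 2) / (1 + k s ^ 2) +
              8 * k s ^ 3 * k1 s ^ 2 / (1 + k s ^ 2) ^ 2).
    { apply (Derive_Icc L _ (fun u => - 4 * k u ^ 2 * k1 u / (1 + k u ^ 2)) s _ HL Hs).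
      - apply smooth_at_mult; [apply smooth_at_mult|].
        + apply smooth_at_div; [apply arc_derive_smooth_at|..]; auto.
        + apply smooth_at_plus; [apply smooth_at_const|apply smooth_at_pow; auto].
        + apply smooth_at_mult; [apply smooth_at_const|auto].
      - intros u Hu; assert (P' := Hv u); rewrite AK, HK, HM by easy; field; lra.
      - auto_derive; [repeat split; try (now exists (k1 s)); try (eexists; exact Dk1);
                      simpl in P; lra|].
        rewrite (is_derive_unique _ _ _ Dk : Derive (fun x => k x) s = k1 s).
        rewrite (is_derive_unique _ _ _ Dk1 : Derive (fun x => k1 x) s = _).
        field; simpl in P; lra. }
    assert (I2 : Derive (arc_derive c
                (fun u => (1 + mod_torsion c u ^ 2) * (2 * mod_torsion c u))) s =
              (12 * k s * k1 s ^ 2 - (1 + 3 * k s ^ 2) * (k s ^ 3 + k s)) / (1 + k s ^ 2) -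
              (2 + 6 * k s ^ 2) * 2 * k s * k1 s ^ 2 / (1 + k s ^ 2) ^ 2).
    { assert (Sq : forall u, 0 <= u <= L ->
                smooth_at (fun u => (1 + mod_torsion c u ^ 2) * (2 * mod_torsion c u)) u).
      { intros u Hu; apply smooth_at_mult.
        + apply smooth_at_plus; [apply smooth_at_const|apply smooth_at_pow; auto].
        + apply smooth_at_mult; [apply smooth_at_const|auto]. }
      apply (Derive_Icc L _ (fun u => (2 + 6 * k u ^ 2) * k1 u / (1 + k u ^ 2)) s _ HL Hs).
      - apply arc_derive_smooth_at; auto.
      - intros u Hu; unfold arc_derive; rewrite HS by easy.
        assert (Dku := sf_k _ _ _ _ _ _ F u Hu).
        rewrite (Derive_Icc L _ (fun u => (1 + k u ^ 2) * (2 * k u)) u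
          ((2 + 6 * k u ^ 2) * k1 u) HL Hu (Sq u Hu)); [easy| |].
        + intros w Hw; now rewrite HM.
        + auto_derive; [repeat split; try (now exists (k1 u)); lra|].
          rewrite (is_derive_unique _ _ _ Dku : Derive (fun x => k x) u = k1 u); ring.
      - auto_derive; [repeat split; try (now exists (k1 s)); try (eexists; exact Dk1);
                      simpl in P; lra|].
        rewrite (is_derive_unique _ _ _ Dk : Derive (fun x => k x) s = k1 s).
        rewrite (is_derive_unique _ _ _ Dk1 : Derive (fun x => k1 x) s = _).
        field; simpl in P; lra. }
    (* Only the outer arclength derivatives are unfolded, so that the inner expressions still match
       [I1] and [I2]. *)
    cbv zeta; unfold arc_derive at 1 3.
    rewrite I1, I2, HS, HK, HM by easy; field; lra. }
  unfold force; rewrite FT, FN, FB; vec_ring.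
Qed.

(** * The strip curve of a spherical elastic curve *)

(** The base point 0 is interior to (a, b), so the primitive is differentiable on both sides of 0,
    as smoothness on a neighbourhood of [0, L] requires. *)
Lemma is_derive_RInt_open (f : R -> R) (a b s : R) :
  a < 0 < b -> a < s < b -> (forall u, a < u < b -> continuous f u) ->
  is_derive (fun t => RInt f 0 t) s (f s).
Proof.
  intros H0 Hs Hf.
  apply (is_derive_RInt f (fun t => RInt f 0 t) 0); [|now apply Hf].
  apply (locally_interval _ _ a b); [apply Hs|apply Hs|].
  simpl; intros u Hu1 Hu2; apply (RInt_correct f 0 u).
  apply (ex_RInt_continuous (V := R_CompleteNormedModule)).
  intros z Hz; apply Hf.
  revert Hz; unfold Rmin, Rmax; destruct (Rle_dec 0 u); lra.
Qed.

Lemma strip_curve_strip_frame (L : R) (c : R -> vec) :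
  0 < L -> spherical_elastic 1 L c ->
  smooth_curve L (strip_curve c) /\
  strip_frame L c (vDerive c) (geodesic_curvature c) (Derive (geodesic_curvature c))
    (strip_curve c).
Proof.
  intros HL Hel; assert (ODE := ode_of_spherical_elastic 1 L c HL Hel).
  destruct Hel as ((Hc & Hn) & Hsp & _).
  destruct (regular_neighbourhood L c HL Hc) as (d & Hd & Hreg).
  { intros s Hs; rewrite Hsp by easy; lra. }
  set (k := geodesic_curvature c) in *.
  assert (Hk : forall s, - d < s < L + d -> smooth_at k s).
  { intros s Hs; destruct (Hreg s Hs); now apply geodesic_curvature_smooth_at. }
  set (f := fun s => vscal (1 + k s ^ 2) (c s)).
  assert (Hf : forall s, - d < s < L + d -> vsmooth_at f s).
  { intros s Hs; destruct (Hreg s Hs); apply vsmooth_at_vscal; [|easy].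
    apply smooth_at_plus; [apply smooth_at_const|now apply smooth_at_pow, Hk]. }
  assert (HD : forall s, - d < s < L + d -> vis_derive (strip_curve c) s (f s)).
  { intros s Hs.
    split; [|split];
      [apply (is_derive_RInt_open (fun s => xc (f s)) (- d) (L + d))
      |apply (is_derive_RInt_open (fun s => yc (f s)) (- d) (L + d))
      |apply (is_derive_RInt_open (fun s => zc (f s)) (- d) (L + d))];
      try lra; intros u Hu; apply smooth_at_continuous; apply (Hf u Hu). }
  assert (HS : forall s, - d < s < L + d -> vsmooth_at (strip_curve c) s).
  { intros s Hs.
    assert (HL' : locally s (fun u => vis_derive (strip_curve c) u (f u))).
    { apply (locally_interval _ _ (- d) (L + d)); [apply Hs|apply Hs|].
      simpl; intros u Hu1 Hu2; apply HD; lra. }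
    split; [|split].
    - apply smooth_at_of_is_derive with (fun u => xc (f u)); [|apply (Hf s Hs)].
      revert HL'; apply filter_imp; intros u Hu; apply Hu.
    - apply smooth_at_of_is_derive with (fun u => yc (f u)); [|apply (Hf s Hs)].
      revert HL'; apply filter_imp; intros u Hu; apply Hu.
    - apply smooth_at_of_is_derive with (fun u => zc (f u)); [|apply (Hf s Hs)].
      revert HL'; apply filter_imp; intros u Hu; apply Hu. }
  split; [apply smooth_curve_vsmooth_at; now exists d|].
  constructor; try easy.
  - apply unit_speed_frame; [easy|easy|]; intros s Hs; split; [apply Hn|apply Hsp]; easy.
  - intros s Hs; apply smooth_at_is_derive, Hk; lra.
  - intros s Hs; eapply is_derive_eq.
    + apply smooth_at_is_derive, smooth_at_Derive, Hk; lra.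
    + specialize (ODE s Hs); lra.
  - intros s Hs; apply HS; lra.
  - intros s Hs; apply HD; lra.
Qed.

(** Along the strip curve kap^2 (1 + lam^2)^2 = 1, so for mu = -1 the Sadowsky integrand is twice
    the speed 1 + k^2. *)
Lemma strip_part (L : R) (c : R -> vec) :
  0 < L -> spherical_elastic 1 L c ->
  force_free_strip (-1) L (strip_curve c) /\
  sadowsky (-1) L (strip_curve c) =
    RInt (fun t => 2 * (1 + geodesic_curvature c t ^ 2)) 0 L /\
  RInt (fun t => 2 * (1 + geodesic_curvature c t ^ 2)) 0 L =
    2 * curve_length L (strip_curve c).
Proof.
  intros HL Hel.
  destruct (strip_curve_strip_frame L c HL Hel) as [Hsm SF].
  assert (SV := strip_frenet _ _ _ _ _ _ SF).
  assert (Hv : forall s, 0 < 1 + geodesic_curvature c s ^ 2) by (intros; nra).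
  split; [split; [split; [split|]|]|split].
  - exact Hsm.
  - intros t Ht; destruct (SV t Ht) as (-> & -> & _).
    split; [apply Rgt_not_eq, Hv|apply Rinv_neq_0_compat, Rgt_not_eq, Hv].
  - intros G HG _; exact (strip_first_variation _ _ _ _ _ _ G SF HG).
  - exact (strip_force _ _ _ _ _ _ SF).
  - apply RInt_ext; intros s; rewrite Rmin_left, Rmax_right by lra; intros Hs.
    destruct (SV s ltac:(lra)) as (-> & -> & ->); simpl.
    assert (P := Hv s); simpl in P; field; lra.
  - unfold curve_length; rewrite <- (RInt_scal (V := R_CompleteNormedModule)).
    + apply RInt_ext; intros s; rewrite Rmin_left, Rmax_right by lra; intros Hs.
      now destruct (SV s ltac:(lra)) as (-> & _).
    + apply (ex_RInt_continuous (V := R_CompleteNormedModule)).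
      rewrite Rmin_left, Rmax_right by lra; intros s Hs.
      apply smooth_at_continuous, speed_smooth_at; [now apply SF|].
      destruct (SV s Hs) as (-> & _); apply Rgt_not_eq, Hv.
Qed.

(** * Tangent indicatrices *)

Lemma locally_open_interval (a b s : R) (P : R -> Prop) :
  a < s < b -> (forall u, a < u < b -> P u) -> locally s P.
Proof.
  intros Hs H; apply (locally_interval _ _ a b); [apply Hs|apply Hs|].
  simpl; intros u Hu1 Hu2; apply H; lra.
Qed.

Lemma tangent_smooth_at (c : R -> vec) (s : R) :
  vsmooth_at c s -> speed c s <> 0 -> vsmooth_at (tangent c) s.
Proof.
  intros H Hs; apply vsmooth_at_vscal; [|now apply vsmooth_at_vDerive].
  apply smooth_at_Rinv; [now apply speed_smooth_at|easy].
Qed.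

Lemma speed_nonneg (c : R -> vec) (s : R) : 0 <= speed c s.
Proof. apply vnorm_nonneg. Qed.

Lemma vnorm_tangent (c : R -> vec) (s : R) : speed c s <> 0 -> vnorm (tangent c s) = 1.
Proof.
  intros H; assert (P := speed_nonneg c s).
  unfold tangent; rewrite vnorm_vscal, Rabs_pos_eq.
  - change (/ speed c s * speed c s = 1); now field.
  - left; apply Rinv_0_lt_compat; lra.
Qed.

(** Only the leading coefficient / v is made explicit: the terms with x, y and z drop out of the
    cross product and the determinant in which these derivatives are used. *)
Lemma vDerive_tangent (a b : R) (c : R -> vec) (s : R) :
  (forall u, a < u < b -> vsmooth_at c u /\ speed c u <> 0) -> a < s < b ->
  exists x y z : R,
    vDerive (tangent c) s =
      vadd (vscal x (vDerive c s)) (vscal (/ speed c s) (vDerive (vDerive c) s)) /\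
    vDerive (vDerive (tangent c)) s =
      vadd (vscal y (vDerive c s)) (vadd (vscal z (vDerive (vDerive c) s))
        (vscal (/ speed c s) (vDerive (vDerive (vDerive c)) s))).
Proof.
  intros H Hs.
  set (w := fun u => / speed c u).
  assert (W : forall u, a < u < b -> smooth_at w u).
  { intros u Hu; destruct (H u Hu); apply smooth_at_Rinv; [now apply speed_smooth_at|easy]. }
  assert (D1 : forall u, a < u < b -> vDerive (tangent c) u =
     vadd (vscal (Derive w u) (vDerive c u)) (vscal (w u) (vDerive (vDerive c) u))).
  { intros u Hu; apply vis_derive_unique, (vis_derive_vscal w).
    - now apply smooth_at_is_derive, W.
    - now apply vsmooth_at_vis_derive, vsmooth_at_vDerive, H. }
  exists (Derive w s), (Derive (Derive w) s), (2 * Derive w s).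
  split; [now apply D1|].
  apply vis_derive_unique.
  apply vis_derive_ext_loc with (fun u => vadd (vscal (Derive w u) (vDerive c u))
    (vscal (w u) (vDerive (vDerive c) u))).
  - apply (locally_open_interval a b); [easy|]; intros u Hu; symmetry; now apply D1.
  - destruct (H s Hs) as [Hc _].
    assert (C1 := vsmooth_at_vDerive _ _ Hc); assert (C2 := vsmooth_at_vDerive _ _ C1).
    eapply vis_derive_eq.
    + apply vis_derive_vadd; apply vis_derive_vscal.
      * now apply smooth_at_is_derive, smooth_at_Derive, W.
      * now apply vsmooth_at_vis_derive.
      * now apply smooth_at_is_derive, W.
      * now apply vsmooth_at_vis_derive.
    + fold (w s); vec_ring.
Qed.

Lemma tangent_orthogonal (a b : R) (c : R -> vec) (s : R) :
  (forall u, a < u < b -> vsmooth_at c u /\ speed c u <> 0) -> a < s < b ->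
  dot (tangent c s) (vDerive (tangent c) s) = 0.
Proof.
  intros H Hs; destruct (H s Hs) as [Hc Hv].
  assert (DT := vsmooth_at_vis_derive _ _ (tangent_smooth_at c s Hc Hv)).
  assert (E1 := vis_derive_dot _ _ _ _ _ DT DT).
  assert (E2 : is_derive (fun t => dot (tangent c t) (tangent c t)) s 0).
  { apply is_derive_ext_loc with (fun _ => 1); [|apply (is_derive_const 1)].
    apply (locally_open_interval a b); [easy|]; intros u Hu.
    symmetry; now apply vnorm_1, vnorm_tangent, H. }
  assert (E3 := is_derive_unique2 _ _ _ _ E1 E2).
  rewrite (dot_comm (vDerive _ _)) in E3; lra.
Qed.

(** Up to powers of v, T x T' is c' x c'' and det (T, T', T'') is det (c', c'', c'''). Since T is a
    unit vector orthogonal to T', the norm of T' equals that of T x T', and the quotient defining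
    the geodesic curvature becomes tau / kap. *)
Lemma tangent_geometry (a b : R) (c : R -> vec) (s : R) :
  (forall u, a < u < b -> vsmooth_at c u /\ speed c u <> 0) -> a < s < b ->
  curvature c s <> 0 ->
  speed (tangent c) s = speed c s * curvature c s /\
  geodesic_curvature (tangent c) s = mod_torsion c s.
Proof.
  intros H Hs Hk.
  destruct (H s Hs) as [Hc Hv].
  assert (Hv' : 0 < speed c s) by (assert (P := speed_nonneg c s); lra).
  assert (HW := curvature_cross c s Hk).
  destruct (vDerive_tangent a b c s H Hs) as (x & y & z & D1 & D2).
  set (W := cross (vDerive c s) (vDerive (vDerive c) s)) in *.
  assert (HW' : 0 < vnorm W) by (assert (P := vnorm_nonneg W); lra).
  assert (Cr : cross (tangent c s) (vDerive (tangent c) s) = vscal ((/ speed c s) ^ 2) W).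
  { rewrite D1; unfold W, tangent; vec_ring. }
  assert (T1 : dot (tangent c s) (tangent c s) = 1) by now apply vnorm_1, vnorm_tangent.
  assert (T2 := tangent_orthogonal a b c s H Hs).
  assert (Sp : speed (tangent c) s = speed c s * curvature c s).
  { transitivity (vnorm (cross (tangent c s) (vDerive (tangent c) s))).
    - unfold speed at 1, vnorm; rewrite dot_cross_cross, T1, T2; f_equal; ring.
    - rewrite Cr, vnorm_vscal, Rabs_pos_eq.
      + unfold curvature; fold W; field; lra.
      + apply pow_le; left; now apply Rinv_0_lt_compat. }
  split; [exact Sp|].
  unfold geodesic_curvature; rewrite Sp; unfold det3; rewrite Cr, D2.
  replace (dot (vscal ((/ speed c s) ^ 2) W) _) with ((/ speed c s) ^ 3 *
    dot W (vDerive (vDerive (vDerive c)) s)) by (unfold W; vec_ring).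
  unfold mod_torsion, torsion, curvature, det3; fold W.
  field; lra.
Qed.

(** The phi'' term is parallel to c' and drops out of the determinant. The factor phi'^3 left there
    cancels against the cube of the speed, with the right sign because phi' > 0. *)
Lemma reparam_geometry (c : R -> vec) (phi : R -> R) (s : R) :
  locally s (fun u => vsmooth_at c (phi u) /\ smooth_at phi u) -> 0 < Derive phi s ->
  speed (fun u => c (phi u)) s = Derive phi s * speed c (phi s) /\
  (speed c (phi s) <> 0 ->
   geodesic_curvature (fun u => c (phi u)) s = geodesic_curvature c (phi s)).
Proof.
  intros H Hp.
  assert (D1 : locally s (fun u => vDerive (fun u => c (phi u)) u =
     vscal (Derive phi u) (vDerive c (phi u)))).
  { revert H; apply filter_imp; intros u [A B].
    apply vis_derive_unique, vis_derive_comp;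
      [now apply vsmooth_at_vis_derive|now apply smooth_at_is_derive]. }
  destruct (locally_singleton _ _ H) as [A B].
  assert (E1 := locally_singleton _ _ D1); cbv beta in E1.
  assert (E2 : vDerive (vDerive (fun u => c (phi u))) s =
    vadd (vscal (Derive (Derive phi) s) (vDerive c (phi s)))
      (vscal (Derive phi s) (vscal (Derive phi s) (vDerive (vDerive c) (phi s))))).
  { apply vis_derive_unique.
    apply vis_derive_ext_loc with (fun u => vscal (Derive phi u) (vDerive c (phi u))).
    - revert D1; apply filter_imp; intros u ->; easy.
    - apply (vis_derive_vscal (Derive phi) (fun u => vDerive c (phi u)));
        [now apply smooth_at_is_derive, smooth_at_Derive|].
      apply (vis_derive_comp (vDerive c) phi); [|now apply smooth_at_is_derive].
      now apply vsmooth_at_vis_derive, vsmooth_at_vDerive. }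
  assert (Sp : speed (fun u => c (phi u)) s = Derive phi s * speed c (phi s)).
  { unfold speed at 1; rewrite E1, vnorm_vscal, Rabs_pos_eq; [easy|lra]. }
  split; [exact Sp|]; intros Hs.
  unfold geodesic_curvature; rewrite Sp, E1, E2.
  replace (det3 (c (phi s)) _ _) with (Derive phi s ^ 3 *
    det3 (c (phi s)) (vDerive c (phi s)) (vDerive (vDerive c) (phi s))) by vec_ring.
  field; lra.
Qed.

Lemma frenet_neighbourhood (L : R) (c : R -> vec) :
  0 < L -> frenet_curve L c ->
  exists d, 0 < d /\ forall s, - d < s < L + d ->
    vsmooth_at c s /\ speed c s <> 0 /\ curvature c s <> 0.
Proof.
  intros HL [Hc Hf].
  destruct (regular_neighbourhood L c HL Hc) as (d & Hd & Hreg).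
  { intros s Hs; apply Hf, Hs. }
  apply locally_enlarge; [lra|]; intros s Hs.
  destruct (Hf s Hs) as [H1 H2]; destruct (Hreg s ltac:(lra)) as [H3 _].
  assert (N1 := locally_open_interval (- d) (L + d) s _ ltac:(lra) Hreg).
  assert (N2 : locally s (fun u => curvature c u <> 0)).
  { exact (smooth_at_continuous _ _ (curvature_smooth_at c s H3 H1 H2) _ (locally_neq_0 _ H2)). }
  generalize (filter_and _ _ N1 N2); apply filter_imp; tauto.
Qed.

Lemma curvature_nonneg (c : R -> vec) (s : R) : speed c s <> 0 -> 0 <= curvature c s.
Proof.
  intros H; assert (P := speed_nonneg c s).
  apply Rmult_le_pos; [apply vnorm_nonneg|].
  left; apply Rinv_0_lt_compat, pow_lt; lra.
Qed.

Lemma tangent_arclength (L : R) (c : R -> vec) :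
  0 < L -> frenet_curve L c ->
  exists (L' : R) (phi : R -> R), arclength_reparam L (tangent c) L' phi.
Proof.
  intros HL Hf; destruct (frenet_neighbourhood L c HL Hf) as (d & Hd & H).
  assert (H' : forall u, - d < u < L + d -> vsmooth_at c u /\ speed c u <> 0)
    by (intros u Hu; split; apply (H u Hu)).
  assert (HT : forall s, - d < s < L + d -> vsmooth_at (tangent c) s /\ 0 < speed (tangent c) s).
  { intros s Hs; destruct (H s Hs) as (A & B & C); split; [now apply tangent_smooth_at|].
    rewrite (proj1 (tangent_geometry (- d) (L + d) c s H' Hs C)).
    assert (P := speed_nonneg c s); assert (Q := curvature_nonneg c s B).
    apply Rmult_lt_0_compat; lra. }
  assert (HS : forall s, - d < s < L + d -> smooth_at (speed (tangent c)) s).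
  { intros s Hs; destruct (HT s Hs); apply speed_smooth_at; [easy|lra]. }
  set (A := (fun t => RInt (speed (tangent c)) 0 t) : R -> R).
  assert (HD : forall s, - d < s < L + d -> is_derive A s (speed (tangent c) s)).
  { intros s Hs; apply (is_derive_RInt_open _ (- d) (L + d)); [lra|easy|].
    intros u Hu; now apply smooth_at_continuous, HS. }
  assert (HA : forall s, - d < s < L + d -> smooth_at A s /\ 0 < Derive A s).
  { intros s Hs; split.
    - apply smooth_at_of_is_derive with (speed (tangent c)); [|now apply HS].
      now apply (locally_open_interval (- d) (L + d)).
    - rewrite (is_derive_unique _ _ _ (HD s Hs)); now apply HT. }
  (* The reparametrization is the inverse of the arclength function. Half margins put [0, L] inside
     (p, q) and [p, q] inside the domain of regularity. *)
  destruct (smooth_inverse A (- d) (L + d) (- d / 2) (L + d / 2)) as (phi & P1 & P2);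
    try lra; [exact HA|].
  assert (Inc := increasing_of_Derive A _ _ HA).
  assert (A0 : A 0 = 0) by exact (RInt_point 0 (speed (tangent c))).
  assert (I1 : A (- d / 2) < 0) by (rewrite <- A0; apply Inc; lra).
  assert (I2 : 0 < A L) by (rewrite <- A0; apply Inc; lra).
  assert (I3 : A L < A (L + d / 2)) by (apply Inc; lra).
  exists (A L), phi; split; [easy|split; [|split; [|split]]].
  - apply smooth_smooth_at.
    (* This margin keeps the enlarged parameter interval around [0, A L] within the range on which
       the inverse is smooth. *)
    set (r := Rmin (- A (- d / 2)) (A (L + d / 2) - A L)).
    assert (M1 := Rmin_l (- A (- d / 2)) (A (L + d / 2) - A L)).
    assert (M2 := Rmin_r (- A (- d / 2)) (A (L + d / 2) - A L)); fold r in M1, M2.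
    exists r; split; [apply Rmin_glb_lt; lra|].
    intros y Hy; apply P2; lra.
  - rewrite <- A0 at 1; apply P1; lra.
  - apply P1; lra.
  - intros s Hs.
    assert (Hs' : A (- d / 2) < s < A (L + d / 2)) by lra.
    destruct (P2 s Hs') as (B & _ & Dphi).
    assert (Hps : - d < phi s < L + d) by lra.
    assert (Dp : Derive phi s = / speed (tangent c) (phi s)).
    { rewrite (is_derive_unique _ _ _ Dphi); f_equal; now apply is_derive_unique, HD. }
    destruct (HT _ Hps) as [_ Hpos].
    assert (Hp : 0 < Derive phi s) by (rewrite Dp; now apply Rinv_0_lt_compat).
    split; [easy|].
    rewrite (proj1 (reparam_geometry (tangent c) phi s
      ltac:(apply (locally_open_interval (A (- d / 2)) (A (L + d / 2))); [easy|];
            intros u Hu; destruct (P2 u Hu) as (Bu & Su & _);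
            split; [apply HT; lra|easy]) Hp)).
    rewrite Dp; field; lra.
Qed.

(** * From the force-free equations to the tangent indicatrix *)

Lemma force_components (mu : R) (c : R -> vec) (a b s : R) :
  (forall u, a < u < b -> vsmooth_at c u /\ speed c u <> 0) -> a < s < b ->
  curvature c s <> 0 -> force mu c s = vzero ->
  force_T mu c s = 0 /\ force_B c s = 0.
Proof.
  intros H Hs Hk Hf; destruct (H s Hs) as [Hc Hv].
  assert (T1 : dot (tangent c s) (tangent c s) = 1) by now apply vnorm_1, vnorm_tangent.
  assert (T2 := tangent_orthogonal a b c s H Hs).
  assert (Sp : speed (tangent c) s <> 0).
  { rewrite (proj1 (tangent_geometry a b c s H Hs Hk)).
    now apply Rmult_integral_contrapositive_currified. }
  assert (O : orthonormal (tangent c s) (normal c s)).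
  { unfold normal; split; [easy|split].
    - rewrite dot_vscal_l, dot_vscal_r, <- vnorm_sqr.
      change (vnorm (vDerive (tangent c) s)) with (speed (tangent c) s); now field.
    - rewrite dot_vscal_r, T2; ring. }
  assert (E : force mu c s = comb (tangent c s) (normal c s) (force_T mu c s)
                (force_N c s) (force_B c s)) by easy.
  rewrite Hf in E.
  (* In an orthonormal frame the squared norm of the force is the sum of the squares of its
     components. *)
  assert (K := dot_comb (tangent c s) (normal c s) (force_T mu c s) (force_N c s)
    (force_B c s) (force_T mu c s) (force_N c s) (force_B c s) O).
  rewrite <- E, dot_vzero_r in K; split; nra.
Qed.

(* In terms of [h = (1 + lam^2) lam' / v] the vanishing of the binormal
   component of the force reads [h' / v = mu lam / 2]. *)
Lemma force_free_ode (mu L : R) (c : R -> vec) :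
  0 < L -> force_free_strip mu L c ->
  exists m, 0 < m /\ forall s, 0 <= s <= L ->
    curvature c s * (1 + mod_torsion c s ^ 2) = m /\
    Derive (fun u => (1 + mod_torsion c u ^ 2) * Derive (mod_torsion c) u / speed c u) s =
      - m ^ 2 * mod_torsion c s * speed c s / 2.
Proof.
  intros HL [[Hf _] HF].
  destruct (frenet_neighbourhood L c HL Hf) as (d & Hd & H).
  assert (H' : forall u, - d < u < L + d -> vsmooth_at c u /\ speed c u <> 0)
    by (intros u Hu; split; apply (H u Hu)).
  assert (FC : forall s, 0 <= s <= L -> force_T mu c s = 0 /\ force_B c s = 0).
  { intros s Hs; apply (force_components mu c (- d) (L + d) s H'); [lra| |now apply HF].
    apply H; lra. }
  set (k := curvature c); set (q := mod_torsion c); set (v := speed c).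
  assert (Sv : forall s, 0 <= s <= L -> smooth_at v s /\ 0 < v s).
  { intros s Hs; destruct (H s) as (A & B & C); [lra|].
    split; [now apply speed_smooth_at|]; assert (P := speed_nonneg c s); fold v in P, B; lra. }
  assert (Sk : forall s, 0 <= s <= L -> smooth_at k s /\ 0 < k s).
  { intros s Hs; destruct (H s) as (A & B & C); [lra|].
    split; [now apply curvature_smooth_at|].
    assert (P := curvature_nonneg c s B); fold k in P, C; lra. }
  assert (Sq : forall s, 0 <= s <= L -> smooth_at q s).
  { intros s Hs; destruct (H s) as (A & B & C); [lra|]; now apply mod_torsion_smooth_at. }
  assert (Hg : forall s, 0 <= s <= L -> (k s * (1 + q s ^ 2)) ^ 2 = - mu).
  { intros s Hs; destruct (FC s Hs) as [E _]; unfold force_T in E; fold k q in E; nra. }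
  assert (Hpos : forall s, 0 <= s <= L -> 0 < k s * (1 + q s ^ 2)).
  { intros s Hs; destruct (Sk s Hs); apply Rmult_lt_0_compat; nra. }
  set (m := k 0 * (1 + q 0 ^ 2)).
  assert (Hm : 0 < m) by (apply Hpos; lra).
  assert (Hmu : m ^ 2 = - mu) by (apply Hg; lra).
  (* Both sides are positive with square - mu, as given by the tangential component. *)
  assert (Hgm : forall s, 0 <= s <= L -> k s * (1 + q s ^ 2) = m).
  { intros s Hs; assert (P := Hpos s Hs); assert (E := Hg s Hs); nra. }
  exists m; split; [easy|]; intros s Hs; split; [now apply Hgm|].
  set (h := fun u => (1 + q u ^ 2) * Derive q u / v u).
  assert (Sd : forall u, 0 <= u <= L -> smooth_at (Derive q) u).
  { intros u Hu; now apply smooth_at_Derive, Sq. }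
  (* Differentiating the constant kap (1 + lam^2) expresses kap' through lam', which removes kap'
     from the binormal component. *)
  assert (Dk : forall u, 0 <= u <= L ->
            Derive k u * (1 + q u ^ 2) + k u * (2 * q u * Derive q u) = 0).
  { intros u Hu; destruct (Sk u Hu) as [S1 _]; assert (S2 := Sq u Hu).
    apply (is_derive_unique_Icc 0 L (fun u => k u * (1 + q u ^ 2)) (fun _ => m) u);
      [easy|easy| |apply (is_derive_const m)|exact Hgm].
    apply (is_derive_Rmult k (fun u => 1 + q u ^ 2)); [now apply smooth_at_is_derive|].
    eapply is_derive_eq.
    - apply is_derive_Rplus; [apply (is_derive_const 1)|].
      exact (is_derive_pow q 2 u _ (smooth_at_is_derive _ _ S2)).
    - unfold zero; simpl; ring. }
  set (g1 := fun u => arc_derive c k u / k u * (1 + q u ^ 2) * (2 * q u)).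
  set (g2 := arc_derive c (fun u => (1 + q u ^ 2) * (2 * q u))).
  assert (Spoly : forall u, 0 <= u <= L -> smooth_at (fun u => (1 + q u ^ 2) * (2 * q u)) u).
  { intros u Hu; assert (S2 := Sq u Hu); apply smooth_at_mult.
    - apply smooth_at_plus; [apply smooth_at_const|now apply smooth_at_pow].
    - apply smooth_at_mult; [apply smooth_at_const|easy]. }
  assert (E1 : forall u, 0 <= u <= L -> g1 u = - 4 * q u ^ 2 * Derive q u / v u).
  { intros u Hu; destruct (Sk u Hu) as [_ P1]; destruct (Sv u Hu) as [_ P2].
    unfold g1, arc_derive; fold v.
    replace (Derive k u / v u / k u * (1 + q u ^ 2) * (2 * q u)) with
      (Derive k u * (1 + q u ^ 2) / v u / k u * (2 * q u)) by (field; lra).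
    replace (Derive k u * (1 + q u ^ 2)) with (- (k u * (2 * q u * Derive q u)))
      by (specialize (Dk u Hu); lra).
    field; lra. }
  assert (E2 : forall u, 0 <= u <= L -> g2 u = (2 + 6 * q u ^ 2) * Derive q u / v u).
  { intros u Hu; unfold g2, arc_derive; fold v; f_equal.
    apply (Derive_Icc L _ (fun u => (1 + q u ^ 2) * (2 * q u)) u _ HL Hu); [auto|easy|].
    assert (Dq := smooth_at_is_derive _ _ (Sq u Hu)).
    auto_derive; [repeat split; now exists (Derive q u)|].
    change (Derive (fun x => q x) u) with (Derive q u); ring. }
  assert (Sg1 : forall u, 0 <= u <= L -> smooth_at g1 u).
  { intros u Hu; destruct (Sk u Hu) as [K1 K2]; destruct (H u) as (A & B & C); [lra|].
    assert (S2 := Sq u Hu).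
    apply smooth_at_mult; [apply smooth_at_mult|].
    - apply smooth_at_div; [now apply arc_derive_smooth_at|easy|lra].
    - apply smooth_at_plus; [apply smooth_at_const|now apply smooth_at_pow].
    - apply smooth_at_mult; [apply smooth_at_const|easy]. }
  assert (Sg2 : forall u, 0 <= u <= L -> smooth_at g2 u).
  { intros u Hu; destruct (H u) as (A & B & C); [lra|]; now apply arc_derive_smooth_at; auto. }
  assert (Sh : smooth_at h s).
  { destruct (Sv s Hs) as [V1 V2]; assert (S2 := Sq s Hs).
    apply smooth_at_div; [|easy|lra]; apply smooth_at_mult; [|now apply Sd].
    apply smooth_at_plus; [apply smooth_at_const|now apply smooth_at_pow]. }
  (* The two contributions have coefficients - 4 lam^2 and 2 + 6 lam^2, whose sum 2 (1 + lam^2)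
     produces 2 [h]. *)
  assert (Sum : Derive g1 s + Derive g2 s = 2 * Derive h s).
  { apply (is_derive_unique_Icc 0 L (fun u => g1 u + g2 u) (fun u => 2 * h u) s);
      [easy|easy| | |].
    - apply is_derive_Rplus; apply smooth_at_is_derive; auto.
    - eapply is_derive_eq.
      + apply (is_derive_Rmult (fun _ => 2)); [apply (is_derive_const 2)|].
        apply smooth_at_is_derive, Sh.
      + unfold zero; simpl; ring.
    - intros u Hu; rewrite E1, E2 by easy; destruct (Sv u Hu); unfold h; field; lra. }
  destruct (FC s Hs) as [_ FB]; unfold force_B in FB; cbv zeta in FB.
  fold k q in FB; fold g2 in FB; change (arc_derive c g1 s) with (Derive g1 s / v s) in FB.
  change (arc_derive c (fun u => arc_derive c k u / k u * (1 + q u ^ 2) * (2 * q u)) s)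
    with (Derive g1 s / v s) in FB.
  change (arc_derive c g2 s) with (Derive g2 s / v s) in FB.
  replace (k s ^ 2 * (1 + q s ^ 2) ^ 2) with (m ^ 2) in FB
    by (rewrite <- (Hgm s Hs); ring).
  change (Derive h s = - m ^ 2 * q s * v s / 2).
  destruct (Sv s Hs) as [_ V2].
  apply Rmult_eq_reg_r with (2 / v s);
    [|apply Rmult_integral_contrapositive_currified; [lra|apply Rinv_neq_0_compat; lra]].
  transitivity ((Derive g1 s + Derive g2 s) / v s); [rewrite Sum; field; lra|].
  transitivity (- m ^ 2 * q s); [|field; lra].
  unfold Rdiv in FB |- *; lra.
Qed.

Lemma force_free_tangent (mu L : R) (c : R -> vec) (L' : R) (phi : R -> R) :
  0 < L -> force_free_strip mu L c ->
  arclength_reparam L (tangent c) L' phi ->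
  spherical_elastic 1 L' (fun s => tangent c (phi s)).
Proof.
  intros HL HF (HL' & Hphi & P0 & P1 & Hp).
  destruct (force_free_ode mu L c HL HF) as (m & Hm & ODE).
  destruct HF as [[Hf _] _].
  destruct (frenet_neighbourhood L c HL Hf) as (d & Hd & H).
  assert (H' : forall u, - d < u < L + d -> vsmooth_at c u /\ speed c u <> 0)
    by (intros u Hu; split; apply (H u Hu)).
  assert (HT : forall s, - d < s < L + d -> vsmooth_at (tangent c) s).
  { intros s Hs; destruct (H s Hs) as (A & B & C); now apply tangent_smooth_at. }
  destruct (proj1 (smooth_smooth_at L' phi) Hphi) as (e & He & Sphi).
  assert (Mono : forall x y, 0 <= x -> x <= y -> y <= L' -> phi x <= phi y).
  { intros x y Hx Hxy Hy; destruct (MVT_gen phi x y (Derive phi)) as (z & Hz & E).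
    - rewrite Rmin_left, Rmax_right by lra.
      intros u Hu; apply smooth_at_is_derive, Sphi; lra.
    - rewrite Rmin_left, Rmax_right by lra.
      intros u Hu; apply (is_derive_continuity_pt _ _ (Derive phi u)), smooth_at_is_derive, Sphi.
      lra.
    - rewrite Rmin_left, Rmax_right in Hz by lra.
      assert (0 < Derive phi z) by (apply Hp; lra); nra. }
  assert (Rg : forall s, 0 <= s <= L' -> 0 <= phi s <= L).
  { intros s Hs; rewrite <- P0, <- P1; split; apply Mono; lra. }
  (* The enlarged parameter interval must still be mapped into the neighbourhood of [0, L] on which
     [c] is a Frenet curve. *)
  assert (Nb : exists r, 0 < r /\ forall s, - r < s < L' + r ->
            (- d < phi s < L + d) /\ smooth_at phi s).
  { apply locally_enlarge; [lra|]; intros s Hs; apply filter_and.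
    - refine (smooth_at_continuous phi s (Sphi s ltac:(lra)) (fun t => - d < t < L + d) _).
      apply (locally_open_interval (- d) (L + d)); [|easy].
      specialize (Rg s Hs); lra.
    - apply (locally_open_interval (- e) (L' + e)); [lra|exact Sphi]. }
  destruct Nb as (r & Hr & Nb).
  set (w := fun s => tangent c (phi s)).
  assert (Sw : forall s, - r < s < L' + r -> vsmooth_at w s).
  { intros s Hs; destruct (Nb s Hs); apply (vsmooth_at_comp (tangent c) phi); [now apply HT|easy]. }
  set (k := curvature c) in *; set (q := mod_torsion c) in *; set (v := speed c) in *.
  assert (Geo : forall s, 0 <= s <= L' ->
     Derive phi s = / (v (phi s) * k (phi s)) /\ geodesic_curvature w s = q (phi s)).
  { intros s Hs.
    assert (Hps : - d < phi s < L + d) by (specialize (Rg s Hs); lra).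
    destruct (H _ Hps) as (A & B & C); fold v in B; fold k in C.
    destruct (tangent_geometry (- d) (L + d) c (phi s) H' Hps C) as [T1 T2].
    destruct (Hp s Hs) as [Q1 Q2].
    destruct (reparam_geometry (tangent c) phi s) as [R1 R2]; [|easy|].
    { apply (locally_open_interval (- r) (L' + r)); [lra|].
      intros u Hu; destruct (Nb u Hu); split; [now apply HT|easy]. }
    rewrite Q2, T1 in R1; fold k v in R1, T1.
    assert (N : v (phi s) * k (phi s) <> 0)
      by now apply Rmult_integral_contrapositive_currified.
    split; [apply Rmult_eq_reg_r with (v (phi s) * k (phi s)); [|easy];
            rewrite Rinv_l by easy; lra|].
    unfold w; rewrite R2; [exact T2|now rewrite T1]. }
  assert (Hn : forall s, 0 <= s <= L' -> vnorm (w s) = 1 /\ speed w s = 1).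
  { intros s Hs; split; [|apply Hp, Hs].
    apply vnorm_tangent, H; specialize (Rg s Hs); lra. }
  assert (Sg : forall s, 0 <= s <= L' -> smooth_at (geodesic_curvature w) s).
  { intros s Hs; apply geodesic_curvature_smooth_at; [apply Sw; lra|].
    rewrite (proj2 (Hn s Hs)); lra. }
  set (h := fun u => (1 + q u ^ 2) * Derive q u / v u) in *.
  assert (Pos : forall t, 0 <= t <= L ->
            0 < v t /\ 0 < k t /\ smooth_at v t /\ smooth_at q t).
  { intros t Ht; destruct (H t) as (A & B & C); [lra|].
    assert (Q1 := speed_nonneg c t); assert (Q2 := curvature_nonneg c t B).
    fold v in Q1, B |- *; fold k in Q2, C |- *.
    split; [lra|split; [lra|]].
    split; [now apply speed_smooth_at|now apply mod_torsion_smooth_at]. }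
  (* The chain rule gives lam' / (v kap), and / kap = (1 + lam^2) / m turns it into [h] / m. *)
  assert (D1 : forall s, 0 <= s <= L' -> Derive (geodesic_curvature w) s = h (phi s) / m).
  { intros s Hs; destruct (Geo s Hs) as [G1 _].
    destruct (Pos _ (Rg s Hs)) as (Q1 & Q2 & Q3 & Q4).
    destruct (ODE _ (Rg s Hs)) as [E _].
    rewrite (Derive_Icc L' _ (fun s => q (phi s)) s (Derive q (phi s) * Derive phi s) HL' Hs).
    - rewrite G1; unfold h; rewrite <- E.
      assert (0 < 1 + q (phi s) ^ 2) by nra.
      field; simpl in *; repeat split; lra.
    - now apply Sg.
    - intros u Hu; now apply Geo.
    - apply (is_derive_Rcomp q phi); apply smooth_at_is_derive; [easy|apply Nb; lra]. }
  assert (D2 : forall s, 0 <= s <= L' -> Derive (Derive (geodesic_curvature w)) s =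
            - q (phi s) * (1 + q (phi s) ^ 2) / 2).
  { intros s Hs; destruct (Geo s Hs) as [G1 _].
    destruct (Pos _ (Rg s Hs)) as (Q1 & Q2 & Q3 & Q4).
    destruct (ODE _ (Rg s Hs)) as [E E'].
    assert (Sh : smooth_at h (phi s)).
    { apply smooth_at_div; [|easy|lra]; apply smooth_at_mult; [|now apply smooth_at_Derive].
      apply smooth_at_plus; [apply smooth_at_const|now apply smooth_at_pow]. }
    rewrite (Derive_Icc L' _ (fun s => / m * h (phi s)) s
      (0 * h (phi s) + / m * (Derive h (phi s) * Derive phi s)) HL' Hs).
    (* One factor m of m^2 is traded for kap (1 + lam^2): kap cancels against phi' and the other m
       against / m, so the equation no longer depends on mu. *)
    - rewrite G1, E'; replace (m ^ 2) with (m * (k (phi s) * (1 + q (phi s) ^ 2)))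
        by (rewrite E; ring).
      field; repeat split; lra.
    - now apply smooth_at_Derive, Sg.
    - intros u Hu; rewrite D1 by easy; unfold Rdiv; ring.
    - apply (is_derive_Rmult (fun _ => / m) (fun s => h (phi s)));
        [apply (is_derive_const (/ m))|].
      apply (is_derive_Rcomp h phi); apply smooth_at_is_derive; [easy|apply Nb; lra]. }
  apply spherical_elastic_of_ode; [easy| |exact Hn|].
  - apply smooth_curve_vsmooth_at; now exists r.
  - intros s Hs; fold w; rewrite D2, (proj2 (Geo s Hs)) by easy; field.
Qed.

(** The existence clause in the first half ensures that the claim about every arclength
    reparametrization of the tangent is not vacuous. *)
Theorem theorem2 :
  (forall (mu L : R) (gamma : R -> vec),
      0 < L -> force_free_strip mu L gamma ->
      (exists (L' : R) (phi : R -> R),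
          arclength_reparam L (tangent gamma) L' phi) /\
      (forall (L' : R) (phi : R -> R),
          arclength_reparam L (tangent gamma) L' phi ->
          spherical_elastic 1 L' (fun s => tangent gamma (phi s)))) /\
  (forall (L' : R) (T : R -> vec),
      0 < L' -> spherical_elastic 1 L' T ->
      force_free_strip (-1) L' (strip_curve T) /\
      sadowsky (-1) L' (strip_curve T) =
        RInt (fun t => 2 * (1 + geodesic_curvature T t ^ 2)) 0 L' /\
      RInt (fun t => 2 * (1 + geodesic_curvature T t ^ 2)) 0 L' =
        2 * curve_length L' (strip_curve T)).
Proof.
  split.
  - intros mu L gamma HL HF; split.
    + apply tangent_arclength; [easy|apply HF].
    + intros L' phi; now apply force_free_tangent with mu.
  - intros L' T; apply strip_part.
Qed.
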